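(* (a) The assignment sending $E\in S^{(\mathfrak g)}_{(k_1,\dots,k_r)}$ to $$\sum\Big\{\prod_{i,k}\prod_{p=1}^{m^{(i)}_k}Y_{i,k}\big(w_{i,k}-(p-1)d_i\big)\cdot E\Big(\{w_{i,k}-(p-1)d_i\}_{1\le i\le r,\,1\le k\le a_i,\,1\le p\le m^{(i)}_k}\Big)$$ $$\times\prod_{i,k}\prod_{1\le p_1<p_2\le m_k^{(i)}}\zeta_{ii}^{-1}\big((w_{i,k}-(p_1-1)d_i)-(w_{i,k}-(p_2-1)d_i)\big)$$ $$\times\prod_i\prod_{k_1\ne k_2}\prod_{p_1\le m^{(i)}_{k_1}}^{p_2\le m^{(i)}_{k_2}}\zeta_{ii}^{-1}\big((w_{i,k_1}-(p_1-1)d_i)-(w_{i,k_2}-(p_2-1)d_i)\big)$$ $$\times\prod_{j\to i}\prod_{k_1\le a_i}^{k_2\le a_j}\prod_{p_1\le m^{(i)}_{k_1}}^{p_2\le m^{(j)}_{k_2}}\zeta_{ij}^{-1}\big((w_{i,k_1}-(p_1-1)d_i)-(w_{j,k_2}-(p_2-1)d_j)\big)\cdot\prod_{i,k}\mathsf u_{i,k}^{-m^{(i)}_k}\Big\},$$ the sum over all $m^{(i)}_k\in\mathbb Z_{\ge0}$ ($1\le i\le r$, $1\le k\le a_i$) with $\sum_{k}m^{(i)}_k=k_i$ for every $i$, defines an algebra homomorphism $\widetilde\Phi\colon S^{(\mathfrak g)}\to\tilde{\mathcal A}$. Moreover the composition $Y^+_{\bar\mu}(\mathfrak g)\simeq Y^+(\mathfrak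 g)\xrightarrow{\Upsilon}S^{(\mathfrak g)}\xrightarrow{\widetilde\Phi}\tilde{\mathcal A}$ equals the restriction of $\Phi^{\bar\lambda}_{\bar\mu}$ to $Y^+_{\bar\mu}(\mathfrak g)$. (b) The assignment sending $F\in S^{(\mathfrak g),\mathrm{op}}_{(k_1,\dots,k_r)}$ to $$\sum\Big\{\prod_{i,k}\prod_{p=1}^{m^{(i)}_k}Y'_{i,k}\big(w_{i,k}+(p-1)d_i\big)\cdot F\Big(\{w_{i,k}+pd_i\}_{1\le i\le r,\,1\le k\le a_i,\,1\le p\le m^{(i)}_k}\Big)$$ $$\times\prod_{i,k}\prod_{1\le p_1<p_2\le m_k^{(i)}}\zeta_{ii}^{-1}\big((w_{i,k}+p_2d_i)-(w_{i,k}+p_1d_i)\big)\times\prod_i\prod_{k_1\ne k_2}\prod_{p_1\le m^{(i)}_{k_1}}^{p_2\le m^{(i)}_{k_2}}\zeta_{ii}^{-1}\big((w_{i,k_2}+p_2d_i)-(w_{i,k_1}+p_1d_i)\big)$$ $$\times\prod_{j\leftarrow i}\prod_{k_1\le a_i}^{k_2\le a_j}\prod_{p_1\le m^{(i)}_{k_1}}^{p_2\le m^{(j)}_{k_2}}\zeta_{ji}^{-1}\big((w_{j,k_2}+p_2d_j)-(w_{i,k_1}+p_1d_i)\big)\cdot\prod_{i,k}\mathsf u_{i,k}^{m^{(i)}_k}\Big\}$$ (same summation range) defines an algebra homomorphism $\widetilde\Phi\colon S^{(\mathfrak g),\mathrm{op}}\to\tilde{\mathcal A}$. Moreover the composition $Y^-_{\bar\mu}(\mathfrak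 g)\simeq Y^-(\mathfrak g)\xrightarrow{\Upsilon}S^{(\mathfrak g),\mathrm{op}}\xrightarrow{\widetilde\Phi}\tilde{\mathcal A}$ equals the restriction of $\Phi^{\bar\lambda}_{\bar\mu}$ to $Y^-_{\bar\mu}(\mathfrak g)$.
   Context: $\mathfrak g$ is a simple complex Lie algebra of rank $r$ with simple roots $\alpha_i^\vee$, simple coroots $\alpha_i$, fundamental coweights $\omega_i$, invariant form $(\cdot,\cdot)$ on the root lattice, $d_i=\frac{(\alpha_i^\vee,\alpha_i^\vee)}2$, Cartan matrix $a_{ij}$ with $d_ia_{ij}=(\alpha_i^\vee,\alpha_j^\vee)$. Fix an orientation of the graph obtained from the Dynkin diagram by replacing multiple edges by simple ones; $i-j$ means connected, $j\to i$ (equivalently $i\leftarrow j$) means an edge oriented from $j$ to $i$. $A^{\mathrm{op}}$ is the opposite algebra. **Shifted Yangian.** For a coweight $\bar\mu$, $b_i=\alpha_i^\vee(\bar\mu)$: $Y_{\bar\mu}(\mathfrak g)$ is generated by $\mathsf E_i^{(k)},\mathsf F_i^{(k)}$ ($k\ge1$), $\mathsf H_i^{(k)}$ ($k>-b_i$), with $\mathsf H_i^{(-b_i)}=1$, $\mathsf H_i^{(k)}=0$ for $k<-b_i$, and relations ($\{a,b\}=ab+ba$): $[\mathsf H_i^{(k)},\mathsf H_j^{(\ell)}]=0$; $[\mathsf E_i^{(k)},\mathsf F_j^{(\ell)}]=\delta_{ij}\mathsf H_i^{(k+\ell-1)}$; $[\mathsf H_i^{(k+1)},\mathsf E_j^{(\ell)}]-[\mathsf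 H_i^{(k)},\mathsf E_j^{(\ell+1)}]=\frac{(\alpha_i^\vee,\alpha_j^\vee)}2\{\mathsf H_i^{(k)},\mathsf E_j^{(\ell)}\}$ and the same for $\mathsf F_j$ with opposite sign on the right; $[\mathsf E_i^{(k+1)},\mathsf E_j^{(\ell)}]-[\mathsf E_i^{(k)},\mathsf E_j^{(\ell+1)}]=\frac{(\alpha_i^\vee,\alpha_j^\vee)}2\{\mathsf E_i^{(k)},\mathsf E_j^{(\ell)}\}$ and the same for $\mathsf F$ with opposite sign on the right; Serre relations $\sum_{\sigma\in S_m}[\mathsf E_i^{(k_{\sigma(1)})},[\cdots,[\mathsf E_i^{(k_{\sigma(m)})},\mathsf E_j^{(\ell)}]\cdots]]=0$ ($i\ne j$, $m=1-a_{ij}$) and the same for $\mathsf F$. $Y(\mathfrak g)=Y_0(\mathfrak g)$; $Y^+_{\bar\mu}$, $Y^-_{\bar\mu}$ are the subalgebras generated by the $\mathsf E_i^{(k)}$, resp. $\mathsf F_i^{(k)}$; $Y^\pm_{\bar\mu}(\mathfrak g)\simeq Y^\pm(\mathfrak g)$ via $\mathsf E_i^{(k)}\mapsto\mathsf E_i^{(k)}$, $\mathsf F_i^{(k)}\mapsto\mathsf F_i^{(k)}$. **Oscillator algebra and $\Phi$.** Fix a dominant coweight $\bar\lambda=\omega_{i_1}+\dots+\omega_{i_M}$ with $\bar\lambda-\bar\mu=\sum_ia_i\alpha_i$, $a_i\in\mathbb Z_{\ge0}$, and $z_1,\dots,z_M\in\mathbb C$. $\tilde{\mathcal A}$ is the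 algebra generated by $w_{i,k},\mathsf u_{i,k}^{\pm1}$ ($1\le i\le r$, $1\le k\le a_i$), $(w_{i,k}-w_{i,\ell}+md_i)^{-1}$ ($k\ne\ell$, $m\in\mathbb Z$) with $[\mathsf u_{i,k},w_{j,\ell}]=d_i\delta_{ij}\delta_{k\ell}\mathsf u_{i,k}$, $w$'s commuting, $\mathsf u$'s commuting. $W_i(z)=\prod_k(z-w_{i,k})$, $W_{i,\ell}(z)=\prod_{k\ne\ell}(z-w_{i,k})$, $\mathsf Z_i(z)=\prod_{s:i_s=i}(z-z_s-\frac12)$. Set $$Y_{i,\ell}(z)=\frac{\prod_{j\to i}\prod_{p=1}^{-a_{ji}}W_j(z-\frac12(\alpha_i^\vee,\alpha_j^\vee)-pd_j)}{d_iW_{i,\ell}(z)},$$ $$Y'_{i,\ell}(z)=-\frac{\mathsf Z_i(z+d_i)\prod_{j\leftarrow i}\prod_{p=1}^{-a_{ji}}W_j(z+d_i-\frac12(\alpha_i^\vee,\alpha_j^\vee)-pd_j)}{W_{i,\ell}(z)}.$$ There is an algebra homomorphism $\Phi^{\bar\lambda}_{\bar\mu}\colon Y_{\bar\mu}(\mathfrak g)\to\tilde{\mathcal A}$ with $\sum_{k\ge1}\mathsf E_i^{(k)}z^{-k}\mapsto\sum_k\frac{Y_{i,k}(w_{i,k})}{z-w_{i,k}}\mathsf u_{i,k}^{-1}$, $\sum_{k\ge1}\mathsf F_i^{(k)}z^{-k}\mapsto\sum_k\frac{Y'_{i,k}(w_{i,k})}{z-w_{i,k}-d_i}\mathsf u_{i,k}$,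 $\sum_k\mathsf H_i^{(k)}z^{-k}\mapsto\frac{\mathsf Z_i(z)\prod_{j-i}\prod_{p=1}^{-a_{ji}}W_j(z-\frac12(\alpha_i^\vee,\alpha_j^\vee)-pd_j)}{W_i(z)W_i(z-d_i)}$. **Shuffle algebra.** $\mathbb S_{\underline k}$ ($\underline k\in\mathbb Z_{\ge0}^r$) is the space of rational functions in $\{x_{i,k}\}_{1\le i\le r}^{1\le k\le k_i}$ symmetric under $\prod_iS_{k_i}$; $\zeta_{ij}(z)=1+\frac{(\alpha_i^\vee,\alpha_j^\vee)}{2z}$. On $\bigoplus_{\underline k}\mathbb S_{\underline k}$ the product of $F\in\mathbb S_{\underline k}$, $G\in\mathbb S_{\underline\ell}$ is $F\star G=\frac1{\prod_ik_i!\ell_i!}\mathrm{Sym}\Big(F(\{x_{i,k}\}_{k\le k_i})\,G(\{x_{i',k'}\}_{k_{i'}<k'\le k_{i'}+\ell_{i'}})\prod_{i,i'}\prod_{k\le k_i}^{k'>k_{i'}}\zeta_{ii'}(x_{i,k}-x_{i',k'})\Big)$, Sym being the sum over $\prod_iS_{k_i+\ell_i}$. $S^{(\mathfrak g)}=\bigoplus S^{(\mathfrak g)}_{\underline k}$ is the subalgebra of elements $F$ satisfying: (pole) $F=f/\prod_{i-j}\prod_{k\le k_i,k'\le k_j}(x_{i,k}-x_{j,k'})$ (unordered connected pairs) with $f$ a symmetric polynomial; (wheel) for connected $i-j$, $F$ vanishes upon $(x_{i,1},\dots,x_{i,1-a_{ij}})\mapsto(w,w-d_i,w-2d_i,\dots,w+d_ia_{ij})$,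 $x_{j,1}\mapsto w+\frac{d_ia_{ij}}2$. The algebra maps $\Upsilon\colon Y^+(\mathfrak g)\to S^{(\mathfrak g)}$, $\Upsilon\colon Y^-(\mathfrak g)\to S^{(\mathfrak g),\mathrm{op}}$ are given by $\mathsf E_i^{(k)}\mapsto x_{i,1}^{k-1}$, $\mathsf F_i^{(k)}\mapsto x_{i,1}^{k-1}$. *)

(* Defs.v *)
From HB Require Import structures.
From mathcomp Require Import all_boot all_order all_algebra.
From mathcomp Require Import fingroup perm generic_quotient ring_quotient fraction.
From mathcomp Require Import boolp.
From mathcomp Require classical_sets.
From mathcomp Require Import -(notations) monalg.
From mathcomp Require Import mpoly.

Set Implicit Arguments.
Unset Strict Implicit.
Unset Printing Implicit Defensive.

Import Order.TTheory GRing.Theory Num.Theory.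
Local Open Scope quotient_scope.
Local Open Scope ring_scope.

Section Presentation.
Variables (C : fieldType) (G : choiceType).

Definition free_alg : Type := malg (fmonom G) C.
HB.instance Definition _ := GRing.Lalgebra.on free_alg.

Definition free_gen (g : G) : free_alg := mkmalgU (fmu g) 1.

Variable rel : free_alg -> Prop.

Inductive ideal_gen : free_alg -> Prop :=
| ideal_gen_rel x : rel x -> ideal_gen x
| ideal_gen0 : ideal_gen 0
| ideal_genB x y : ideal_gen x -> ideal_gen y -> ideal_gen (x - y)
| ideal_genMl z x : ideal_gen x -> ideal_gen (z * x)
| ideal_genMr z x : ideal_gen x -> ideal_gen (x * z).

Definition ideal_pred : {pred free_alg} := fun x => `[< ideal_gen x >].

Lemma ideal_pred_zmod : zmod_closed ideal_pred.
Proof.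
split=> [|x y /asboolP hx /asboolP hy]; apply/asboolP.
  exact: ideal_gen0.
exact: ideal_genB.
Qed.
HB.instance Definition _ :=
  GRing.isZmodClosed.Build free_alg ideal_pred ideal_pred_zmod.

(* The quotient may a priori be the zero ring, so it is only a pzRingType. *)
Definition presented : Type := Quotient.quot (ideal_pred : zmodClosed free_alg).
HB.instance Definition _ := GRing.Zmodule.on presented.

Definition pcls (x : free_alg) : presented :=
  \pi_(Quotient.quot (ideal_pred : zmodClosed free_alg)) x.

Lemma pclsP x y : (pcls x = pcls y) <-> ideal_gen (x - y).
Proof.
split=> [/eqP|h].
  by rewrite /pcls -Quotient.idealrBE => /asboolP.
by apply/eqP; rewrite /pcls -Quotient.idealrBE; apply/asboolP.
Qed.

Lemma pcls_surj a : exists x, a = pcls x.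
Proof. by exists (repr a); rewrite /pcls reprK. Qed.

Lemma pclsD x y : pcls (x + y) = pcls x + pcls y.
Proof. by rewrite /pcls; exact: Quotient.pi_add. Qed.

Definition presented_one : presented := pcls 1.
Definition presented_mul (a b : presented) : presented :=
  pcls (repr a * repr b).
Definition presented_scale (c : C) (a : presented) : presented :=
  pcls (c *: repr a).

Lemma pcls_repr x : ideal_gen (repr (pcls x) - x).
Proof. by apply/pclsP; rewrite {1}/pcls reprK. Qed.

Lemma ideal_genD x y : ideal_gen x -> ideal_gen y -> ideal_gen (x + y).
Proof.
move=> hx hy; rewrite -[y]opprK -[- y]add0r.
by apply: ideal_genB => //; apply: ideal_genB => //; exact: ideal_gen0.
Qed.

Lemma pclsM x y : presented_mul (pcls x) (pcls y) = pcls (x * y).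
Proof.
apply/pclsP.
have -> : repr (pcls x) * repr (pcls y) - x * y =
    (repr (pcls x) - x) * repr (pcls y) + x * (repr (pcls y) - y).
  by rewrite mulrBl mulrBr addrA subrK.
by apply: ideal_genD; [apply: ideal_genMr|apply: ideal_genMl];
  exact: pcls_repr.
Qed.

Lemma pclsZ c x : presented_scale c (pcls x) = pcls (c *: x).
Proof.
apply/pclsP; rewrite -scalerBr -[_ - _]mul1r scalerAl.
by apply: ideal_genMl; exact: pcls_repr.
Qed.

Lemma presented_mulA : associative presented_mul.
Proof.
move=> a b c; have [x ->] := pcls_surj a; have [y ->] := pcls_surj b.
by have [z ->] := pcls_surj c; rewrite !pclsM mulrA.
Qed.

Lemma presented_mul1 : left_id presented_one presented_mul.
Proof. by move=> a; have [x ->] := pcls_surj a; rewrite pclsM mul1r. Qed.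

Lemma presented_mulr1 : right_id presented_one presented_mul.
Proof. by move=> a; have [x ->] := pcls_surj a; rewrite pclsM mulr1. Qed.

Lemma presented_mulDl : left_distributive presented_mul +%R.
Proof.
move=> a b c; have [x ->] := pcls_surj a; have [y ->] := pcls_surj b.
by have [z ->] := pcls_surj c; rewrite -pclsD !pclsM mulrDl pclsD.
Qed.

Lemma presented_mulDr : right_distributive presented_mul +%R.
Proof.
move=> a b c; have [x ->] := pcls_surj a; have [y ->] := pcls_surj b.
by have [z ->] := pcls_surj c; rewrite -pclsD !pclsM mulrDr pclsD.
Qed.

HB.instance Definition _ := GRing.Zmodule_isPzRing.Build presented
  presented_mulA presented_mul1 presented_mulr1
  presented_mulDl presented_mulDr.

Lemma presented_scaleA c e a :
  presented_scale c (presented_scale e a) = presented_scale (c * e) a.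
Proof. by have [x ->] := pcls_surj a; rewrite !pclsZ scalerA. Qed.

Lemma presented_scale1 : left_id 1 presented_scale.
Proof. by move=> a; have [x ->] := pcls_surj a; rewrite pclsZ scale1r. Qed.

Lemma presented_scaleDr : right_distributive presented_scale +%R.
Proof.
move=> c a b; have [x ->] := pcls_surj a; have [y ->] := pcls_surj b.
by rewrite -pclsD !pclsZ scalerDr pclsD.
Qed.

Lemma presented_scaleDl a : {morph presented_scale^~ a : c e / c + e}.
Proof.
by move=> c e; have [x ->] := pcls_surj a; rewrite !pclsZ scalerDl pclsD.
Qed.

HB.instance Definition _ := GRing.Zmodule_isLmodule.Build C presented
  presented_scaleA presented_scale1 presented_scaleDr presented_scaleDl.

Inductive subalg_gen (S : presented -> Prop) : presented -> Prop :=
| subalg_gen_gen a : S a -> subalg_gen S a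
| subalg_gen1 : subalg_gen S 1
| subalg_genD a b : subalg_gen S a -> subalg_gen S b -> subalg_gen S (a + b)
| subalg_genZ c a : subalg_gen S a -> subalg_gen S (c *: a)
| subalg_genM a b : subalg_gen S a -> subalg_gen S b -> subalg_gen S (a * b).

End Presentation.

Definition commutator {A : pzRingType} (x y : A) : A := x * y - y * x.
Definition anticommutator {A : pzRingType} (x y : A) : A := x * y + y * x.

(* The shuffle product is not packaged as a ring structure, so homomorphisms
   are stated for bare operations, on the subalgebra cut out by [D]. *)
Record alg_ops (C T : Type) := AlgOps {
  op_add : T -> T -> T;
  op_scale : C -> T -> T;
  op_one : T;
  op_mul : T -> T -> T }.

Definition opposite_ops (C T : Type) (o : alg_ops C T) : alg_ops C T :=
  AlgOps (op_add o) (op_scale o) (op_one o) (fun x y => op_mul o y x).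

Definition presented_ops (C : fieldType) (G : choiceType)
    (rel : free_alg C G -> Prop) : alg_ops C (presented rel) :=
  AlgOps (fun x y => x + y) (fun c (x : presented rel) => c *: x) 1
         (fun x y => x * y).

Definition alg_hom_on (C T U : Type) (oT : alg_ops C T) (D : T -> Prop)
    (oU : alg_ops C U) (f : T -> U) : Prop :=
  [/\ forall x y, D x -> D y -> f (op_add oT x y) = op_add oU (f x) (f y),
      forall c x, D x -> f (op_scale oT c x) = op_scale oU c (f x),
      f (op_one oT) = op_one oU &
      forall x y, D x -> D y -> f (op_mul oT x y) = op_mul oU (f x) (f y)].

Definition alg_iso_on (C T U : Type) (oT : alg_ops C T) (D : T -> Prop)
    (oU : alg_ops C U) (D' : U -> Prop) (f : T -> U) : Prop :=
  [/\ alg_hom_on oT D oU f,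
      forall x, D x -> D' (f x),
      forall x y, D x -> D y -> f x = f y -> x = y &
      forall z, D' z -> exists2 x, D x & f x = z].

(* Simple complex Lie algebras correspond to indecomposable Cartan matrices of
   finite type.  The invariant form (alpha_i, alpha_j) = d_i a_ij on the root
   lattice is fixed only up to a positive scalar. *)
Record simple_datum (C : numFieldType) := SimpleDatum {
  rk : nat;
  cartan : 'M[int]_rk;
  dd : 'I_rk -> C;
  rk_gt0 : (0 < rk)%N;
  cartan_diag : forall i, cartan i i = 2;
  cartan_offdiag : forall i j, i != j -> cartan i j <= 0;
  dd_gt0 : forall i, 0 < dd i;
  dd_sym : forall i j, dd i * (cartan i j)%:~R = dd j * (cartan j i)%:~R;
  form_pos : forall x : 'rV[int]_rk, x != 0 ->
    0 < \sum_i \sum_j dd i * (cartan i j)%:~R * (x 0 i)%:~R * (x 0 j)%:~R;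
  cartan_conn : forall i j,
    connect [rel i j | (i != j) && (cartan i j != 0)] i j }.

Section RootData.
Variables (C : numFieldType) (g : simple_datum C).
Local Notation I := 'I_(rk g).

Definition rform (i j : I) : C := dd i * (cartan g i j)%:~R.

Definition linked (i j : I) : bool := (i != j) && (cartan g i j != 0).

(* [o j i] is the edge j -> i. *)
Definition is_orientation (o : rel I) : Prop :=
  (forall i j, o i j -> linked i j) /\
  (forall i j, linked i j -> o i j = ~~ o j i).

(* [GE i k] and [GF i k] stand for E_i^(k+1) and F_i^(k+1), and [GH i k] for
   H_i^(k+1-b_i). *)
Inductive yang_gen := GE of I & nat | GF of I & nat | GH of I & nat.

Definition yang_gen_code (x : yang_gen) : I * nat + (I * nat + I * nat) :=
  match x with
  | GE i k => inl (i, k) | GF i k => inr (inl (i, k)) | GH i k => inr (inr (i, k))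
  end.
Definition yang_gen_decode (x : I * nat + (I * nat + I * nat)) : yang_gen :=
  match x with
  | inl (i, k) => GE i k | inr (inl (i, k)) => GF i k | inr (inr (i, k)) => GH i k
  end.
Lemma yang_gen_codeK : cancel yang_gen_code yang_gen_decode.
Proof. by case. Qed.
HB.instance Definition _ := Choice.copy yang_gen (can_type yang_gen_codeK).

Local Notation FY := (free_alg C yang_gen).

(* Only used with 1 <= k. *)
Definition fE (i : I) (k : nat) : FY := free_gen C (GE i k.-1).
Definition fF (i : I) (k : nat) : FY := free_gen C (GF i k.-1).

Section Yangian.
(* b i is the pairing of the i-th simple root with the coweight mu. *)
Variable b : I -> int.

Definition fH (i : I) (k : int) : FY :=
  if k < - b i then 0
  else if k == - b i then 1
  else free_gen C (GH i (absz (k + b i)).-1).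

Definition serre (m : nat) (x : 'I_m -> FY) (y : FY) : FY :=
  \sum_(s : {perm 'I_m})
    foldr (fun t z => commutator (x (s t)) z) y (enum 'I_m).

Inductive yang_rel : FY -> Prop :=
| rel_HH i j k l : yang_rel (commutator (fH i k) (fH j l))
| rel_EF i j (k l : nat) : (0 < k)%N -> (0 < l)%N ->
    yang_rel (commutator (fE i k) (fF j l) -
              (if i == j then fH i (k%:Z + l%:Z - 1) else 0))
| rel_HE i j (k : int) (l : nat) : (0 < l)%N ->
    yang_rel (commutator (fH i (k + 1)) (fE j l) -
              commutator (fH i k) (fE j l.+1) -
              (rform i j / 2) *: anticommutator (fH i k) (fE j l))
| rel_HF i j (k : int) (l : nat) : (0 < l)%N ->
    yang_rel (commutator (fH i (k + 1)) (fF j l) -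
              commutator (fH i k) (fF j l.+1) +
              (rform i j / 2) *: anticommutator (fH i k) (fF j l))
| rel_EE i j (k l : nat) : (0 < k)%N -> (0 < l)%N ->
    yang_rel (commutator (fE i k.+1) (fE j l) -
              commutator (fE i k) (fE j l.+1) -
              (rform i j / 2) *: anticommutator (fE i k) (fE j l))
| rel_FF i j (k l : nat) : (0 < k)%N -> (0 < l)%N ->
    yang_rel (commutator (fF i k.+1) (fF j l) -
              commutator (fF i k) (fF j l.+1) +
              (rform i j / 2) *: anticommutator (fF i k) (fF j l))
| rel_serreE i j (k : 'I_(absz (1 - cartan g i j)) -> nat) (l : nat) :
    i != j -> (forall t, (0 < k t)%N) -> (0 < l)%N ->
    yang_rel (serre (fun t => fE i (k t)) (fE j l))
| rel_serreF i j (k : 'I_(absz (1 - cartan g i j)) -> nat) (l : nat) :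
    i != j -> (forall t, (0 < k t)%N) -> (0 < l)%N ->
    yang_rel (serre (fun t => fF i (k t)) (fF j l)).

Definition yangian : Type := presented yang_rel.
HB.instance Definition _ := GRing.PzRing.on yangian.
HB.instance Definition _ := GRing.Lmodule.on yangian.
Definition yangian_ops := presented_ops yang_rel.

Definition yE i k : yangian := pcls yang_rel (fE i k).
Definition yF i k : yangian := pcls yang_rel (fF i k).
Definition yH i k : yangian := pcls yang_rel (fH i k).

Definition yangian_plus : yangian -> Prop :=
  subalg_gen (fun y => exists i k, (0 < k)%N /\ y = yE i k).
Definition yangian_minus : yangian -> Prop :=
  subalg_gen (fun y => exists i k, (0 < k)%N /\ y = yF i k).

End Yangian.

(* The identification of the positive (resp. negative) halves of Y_mu and Y. *)
Definition is_plus_iso b (iota : yangian b -> yangian (fun=> 0)) : Prop :=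
  alg_iso_on (yangian_ops b) (@yangian_plus b)
             (yangian_ops (fun=> 0)) (@yangian_plus (fun=> 0)) iota /\
  (forall i k, (0 < k)%N -> iota (yE b i k) = yE (fun=> 0) i k).
Definition is_minus_iso b (iota : yangian b -> yangian (fun=> 0)) : Prop :=
  alg_iso_on (yangian_ops b) (@yangian_minus b)
             (yangian_ops (fun=> 0)) (@yangian_minus (fun=> 0)) iota /\
  (forall i k, (0 < k)%N -> iota (yF b i k) = yF (fun=> 0) i k).

Definition mdegree := {ffun I -> nat}.

(* The boxes (i, s) with 0 <= s < k_i index the variables x_{i,s+1}. *)
Definition box (k : mdegree) := {i : I & 'I_(k i)}.

Definition rpoly (k : mdegree) := {mpoly C[#|{: box k}|]}.
Definition rfun (k : mdegree) := {fraction (rpoly k)}.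

Definition cst (k : mdegree) (c : C) : rfun k := tofrac (mpolyC _ c).
Definition var (k : mdegree) (v : box k) : rfun k := tofrac ('X_(enum_rank v)).

Definition poly_subst (k n : mdegree) (P : rpoly k) (x : box k -> rfun n) :
    rfun n :=
  mmap (@cst n) (fun t => x (enum_val t)) P.

(* Substitution into a rational function: the value is P(x) / Q(x) for any
   writing F = P / Q with Q(x) <> 0 (it does not depend on the choice), and 0
   if there is none. *)
Definition rsubst (k n : mdegree) (F : rfun k) (x : box k -> rfun n) : rfun n :=
  classical_sets.xget 0 (fun y : rfun n => exists P Q : rpoly k,
    [/\ poly_subst Q x != 0, F = tofrac P / tofrac Q &
        y = poly_subst P x / poly_subst Q x]).

(* The group \prod_i S_{k_i}, as the permutations of boxes preserving colours. *)
Definition colour_perm (k : mdegree) (s : {perm box k}) : bool :=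
  [forall v, tag (s v) == tag v].

Definition symmetric_rfun (k : mdegree) (F : rfun k) : Prop :=
  forall s : {perm box k}, colour_perm s -> rsubst F (fun v => var (s v)) = F.

(* The variable x_{i,s+1} (0 if s >= n_i). *)
Definition xvar (n : mdegree) (i : I) (s : nat) : rfun n :=
  if insub s is Some o then var (Tagged (fun i => 'I_(n i)) (o : 'I_(n i)))
  else 0.

Definition zeta (n : mdegree) (i j : I) (z : rfun n) : rfun n :=
  1 + cst n (rform i j) / (2 * z).

(* Families of rational functions, one in each degree; the direct sum of the
   symmetric ones is cut out in [in_shuffle]. *)
Definition shuffle := forall k : mdegree, rfun k.

Definition Sym (n : mdegree) (F : rfun n) : rfun n :=
  \sum_(s : {perm box n} | colour_perm s) rsubst F (fun v => var (s v)).

(* The product of F in degree k and G in degree l, where k + l = n. *)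
Definition star_hom (n k l : mdegree) (F : rfun k) (G : rfun l) : rfun n :=
  let xl (v : box k) := xvar n (tag v) (tagged v) in
  let xr (v : box l) := xvar n (tag v) (k (tag v) + tagged v)%N in
  (\prod_i ((k i)`! * (l i)`!)%:R)^-1 *
  Sym (rsubst F xl * rsubst G xr *
       \prod_(v : box k) \prod_(v' : box l) zeta (tag v) (tag v') (xl v - xr v')).

Definition star (F G : shuffle) : shuffle := fun n =>
  \sum_(k : {dffun forall i : I, 'I_(n i).+1})
     let k1 : mdegree := [ffun i => nat_of_ord (k i)] in
     let k2 : mdegree := [ffun i => (n i - k i)%N] in
     star_hom n (F k1) (G k2).

Definition shuffle_ops : alg_ops C shuffle :=
  AlgOps (fun F G k => F k + G k) (fun c F k => cst k c * F k)
         (fun k => if k == [ffun=> 0%N] then 1 else 0) star.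

Definition unit_degree (i : I) : mdegree := [ffun j => (j == i) : nat].

Definition shuffle_gen (i : I) (e : nat) : shuffle :=
  fun k => if k == unit_degree i then xvar k i 0 ^+ e else 0.

Definition pole_denominator (k : mdegree) : rfun k :=
  \prod_(v : box k) \prod_(v' : box k |
     (tag v < tag v')%N && linked (tag v) (tag v')) (var v - var v').

(* Vanishing of the numerator f at all points of the wheel.  When a_ij is even
   the pole denominator also vanishes there, so that the condition on
   F = f / pole_denominator only makes sense through f. *)
Definition wheel (k : mdegree) (f : rpoly k) : Prop :=
  forall i j, linked i j ->
    (absz (1 - cartan g i j) <= k i)%N -> (0 < k j)%N ->
  forall (w : C) (x : box k -> C),
    (forall s : 'I_(k i), (s < absz (1 - cartan g i j)%R)%N ->
       x (Tagged (fun i => 'I_(k i)) s) = w - s%:R * dd i) ->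
    (forall s : 'I_(k j), s = 0%N :> nat ->
       x (Tagged (fun i => 'I_(k i)) s) = w + dd i * (cartan g i j)%:~R / 2) ->
  f.@[fun t => x (enum_val t)] = 0.

Definition in_shuffle_deg (k : mdegree) (F : rfun k) : Prop :=
  symmetric_rfun F /\
  exists f : rpoly k,
    [/\ F = tofrac f / pole_denominator k, symmetric_rfun (tofrac f) & wheel f].

Definition in_shuffle (F : shuffle) : Prop :=
  (exists s : seq mdegree, forall k, k \notin s -> F k = 0) /\
  (forall k, in_shuffle_deg (F k)).

Definition homogeneous (k : mdegree) (F : shuffle) : Prop :=
  forall l, l != k -> F l = 0.

Definition is_Upsilon_plus (Ups : yangian (fun=> 0) -> shuffle) : Prop :=
  [/\ alg_hom_on (yangian_ops (fun=> 0)) (@yangian_plus (fun=> 0))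
                 shuffle_ops Ups,
      forall y, yangian_plus y -> in_shuffle (Ups y) &
      forall i k, (0 < k)%N -> Ups (yE (fun=> 0) i k) = shuffle_gen i k.-1].
Definition is_Upsilon_minus (Ups : yangian (fun=> 0) -> shuffle) : Prop :=
  [/\ alg_hom_on (yangian_ops (fun=> 0)) (@yangian_minus (fun=> 0))
                 (opposite_ops shuffle_ops) Ups,
      forall y, yangian_minus y -> in_shuffle (Ups y) &
      forall i k, (0 < k)%N -> Ups (yF (fun=> 0) i k) = shuffle_gen i k.-1].

Section Oscillator.
Variable a : mdegree.

Definition box_pair := {p : box a * box a | (tag p.1 == tag p.2) && (p.1 != p.2)}.

(* [Ginv p m] is the inverse of w_{i,k} - w_{i,l} + m d_i, for
   p = ((i,k),(i,l)). *)
Inductive osc_gen :=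
  Gw of box a | Gu of box a | Guinv of box a | Ginv of box_pair & int.

Definition osc_gen_code (x : osc_gen) :
    box a + (box a + (box a + box_pair * int)) :=
  match x with
  | Gw v => inl v | Gu v => inr (inl v) | Guinv v => inr (inr (inl v))
  | Ginv p m => inr (inr (inr (p, m)))
  end.
Definition osc_gen_decode (x : box a + (box a + (box a + box_pair * int))) :=
  match x with
  | inl v => Gw v | inr (inl v) => Gu v | inr (inr (inl v)) => Guinv v
  | inr (inr (inr (p, m))) => Ginv p m
  end.
Lemma osc_gen_codeK : cancel osc_gen_code osc_gen_decode.
Proof. by case. Qed.
HB.instance Definition _ := Choice.copy osc_gen (can_type osc_gen_codeK).

Local Notation FO := (free_alg C osc_gen).
Local Notation fg := (free_gen C).

Definition fdiff (p : box_pair) (m : int) : FO :=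
  fg (Gw (val p).1) - fg (Gw (val p).2) + (m%:~R * dd (tag (val p).1)) *: 1.

Inductive osc_rel : FO -> Prop :=
| osc_uw v v' : osc_rel (commutator (fg (Gu v)) (fg (Gw v')) -
                         (if v == v' then dd (tag v) *: fg (Gu v) else 0))
| osc_ww v v' : osc_rel (commutator (fg (Gw v)) (fg (Gw v')))
| osc_uu v v' : osc_rel (commutator (fg (Gu v)) (fg (Gu v')))
| osc_uV v : osc_rel (fg (Gu v) * fg (Guinv v) - 1)
| osc_Vu v : osc_rel (fg (Guinv v) * fg (Gu v) - 1)
| osc_invr p m : osc_rel (fdiff p m * fg (Ginv p m) - 1)
| osc_invl p m : osc_rel (fg (Ginv p m) * fdiff p m - 1).

Definition osc : Type := presented osc_rel.
HB.instance Definition _ := GRing.PzRing.on osc.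
HB.instance Definition _ := GRing.Lmodule.on osc.
Definition osc_ops := presented_ops osc_rel.

Definition ow (v : box a) : osc := pcls osc_rel (fg (Gw v)).
Definition ou (v : box a) : osc := pcls osc_rel (fg (Gu v)).
Definition ouV (v : box a) : osc := pcls osc_rel (fg (Guinv v)).
Definition oinv (p : box_pair) (m : int) : osc := pcls osc_rel (fg (Ginv p m)).

Local Notation w := (@var a).
Local Notation K := (rfun a).

(* The graph of the algebra map from the localization of C[w] at the
   w_{i,k} - w_{i,l} + m d_i, inside the field C(w), to the oscillator
   algebra: [osc_value f x] says that f lies in this localization and that x
   is f read in the oscillator algebra. *)
Inductive osc_value : K -> osc -> Prop :=
| osc_value_cst c : osc_value (cst a c) (c *: (1 : osc))
| osc_value_w v : osc_value (w v) (ow v)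
| osc_value_inv p m :
    osc_value (w (val p).1 - w (val p).2 + cst a (m%:~R * dd (tag (val p).1)))^-1
              (oinv p m)
| osc_value_add f f' x x' :
    osc_value f x -> osc_value f' x' -> osc_value (f + f') (x + x')
| osc_value_mul f f' x x' :
    osc_value f x -> osc_value f' x' -> osc_value (f * f') (x * x').

Definition Wfun (j : I) (z : K) : K := \prod_(v : box a | tag v == j) (z - w v).
Definition Wfun' (v : box a) (z : K) : K :=
  \prod_(v' : box a | (tag v' == tag v) && (v' != v)) (z - w v').

Definition Wstring (i j : I) (z : K) : K :=
  \prod_(1 <= p < (absz (cartan g j i)).+1)
     Wfun j (z - cst a (rform i j / 2) - cst a (p%:R * dd j)).

Variables (o : rel I) (M : nat) (cw : 'I_M -> I) (zs : 'I_M -> C).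

Definition Zfun (i : I) (z : K) : K :=
  \prod_(s | cw s == i) (z - cst a (zs s) - cst a (1 / 2)).

Definition Yfun (v : box a) (z : K) : K :=
  let i := tag v in
  (\prod_(j | o j i) Wstring i j z) / (cst a (dd i) * Wfun' v z).

Definition Yfun' (v : box a) (z : K) : K :=
  let i := tag v in
  - ((Zfun i (z + cst a (dd i)) *
      \prod_(j | o i j) Wstring i j (z + cst a (dd i))) / Wfun' v z).

(* Numerator and denominator of the image of H_i(z), as polynomials in z. *)
Definition Hnum (i : I) : {poly K} :=
  (\prod_(s | cw s == i) ('X - (cst a (zs s) + cst a (1 / 2))%:P)) *
  \prod_(j | linked i j) \prod_(1 <= p < (absz (cartan g j i)).+1)
    \prod_(v : box a | tag v == j)
      ('X - (cst a (rform i j / 2) + cst a (p%:R * dd j) + w v)%:P).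
Definition Hden (i : I) : {poly K} :=
  (\prod_(v : box a | tag v == i) ('X - (w v)%:P)) *
  \prod_(v : box a | tag v == i) ('X - (cst a (dd i) + w v)%:P).

(* \sum_k h_k z^-k is the expansion of P(z) / Q(z) at z = oo. *)
Definition expansion_at_infty (P Q : {poly K}) (h : int -> K) : Prop :=
  (exists N : int, forall k, k < N -> h k = 0) /\
  (forall n : int, \sum_(t < size Q) Q`_t * h (t%:Z - n) =
                   if n is Posz n' then P`_n' else 0).

(* The coefficient of z^-k in 1/(z - c) is c^(k-1). *)
Definition is_Phi (b : I -> int) (Phi : yangian b -> osc) : Prop :=
  [/\ alg_hom_on (yangian_ops b) (fun=> True) osc_ops Phi,
      forall i k, (0 < k)%N -> exists c : box a -> osc,
        (forall v, tag v = i ->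
           osc_value (Yfun v (w v) * w v ^+ k.-1) (c v)) /\
        Phi (yE b i k) = \sum_(v : box a | tag v == i) c v * ouV v,
      forall i k, (0 < k)%N -> exists c : box a -> osc,
        (forall v, tag v = i ->
           osc_value (Yfun' v (w v) * (w v + cst a (dd i)) ^+ k.-1) (c v)) /\
        Phi (yF b i k) = \sum_(v : box a | tag v == i) c v * ou v &
      forall i, exists h : int -> K,
        expansion_at_infty (Hnum i) (Hden i) h /\
        (forall k, osc_value (h k) (Phi (yH b i k)))].

Definition occupation (k : mdegree) := {ffun box a -> 'I_(\sum_i k i).+1}.
Definition occ_ok (k : mdegree) (m : occupation k) : bool :=
  [forall i, (\sum_(v : box a | tag v == i) m v == k i)%N].

Definition pt_plus (v : box a) (p : nat) : K :=
  w v - cst a ((p%:R - 1) * dd (tag v)).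
Definition pt_minus (v : box a) (p : nat) : K :=
  w v + cst a (p%:R * dd (tag v)).

(* The tuple of the points pt (i,k) p, 1 <= p <= m_{i,k}, assigned to the
   variables x_{i,1}, ..., x_{i,k_i}.  The order is irrelevant for symmetric
   functions. *)
Definition points (pt : box a -> nat -> K) (k : mdegree) (m : occupation k)
    (u : box k) : K :=
  nth 0 (flatten [seq [seq pt v p | p <- iota 1 (m v)]
                 | v <- enum {: box a} & tag v == tag u]) (tagged u).

Definition coef_plus (k : mdegree) (E : rfun k) (m : occupation k) : K :=
  (\prod_(v : box a) \prod_(1 <= p < (m v).+1) Yfun v (pt_plus v p)) *
  rsubst E (points pt_plus m) *
  (\prod_(v : box a) \prod_(1 <= p2 < (m v).+1) \prod_(1 <= p1 < p2)
     (zeta (tag v) (tag v) (pt_plus v p1 - pt_plus v p2))^-1) *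
  (\prod_(v1 : box a)
     \prod_(v2 : box a | (tag v2 == tag v1) && (v1 != v2))
       \prod_(1 <= p1 < (m v1).+1) \prod_(1 <= p2 < (m v2).+1)
         (zeta (tag v1) (tag v2) (pt_plus v1 p1 - pt_plus v2 p2))^-1) *
  (\prod_(v1 : box a) \prod_(v2 : box a | o (tag v2) (tag v1))
     \prod_(1 <= p1 < (m v1).+1) \prod_(1 <= p2 < (m v2).+1)
       (zeta (tag v1) (tag v2) (pt_plus v1 p1 - pt_plus v2 p2))^-1).

Definition coef_minus (k : mdegree) (F : rfun k) (m : occupation k) : K :=
  (\prod_(v : box a) \prod_(1 <= p < (m v).+1) Yfun' v (pt_minus v p.-1)) *
  rsubst F (points pt_minus m) *
  (\prod_(v : box a) \prod_(1 <= p2 < (m v).+1) \prod_(1 <= p1 < p2)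
     (zeta (tag v) (tag v) (pt_minus v p2 - pt_minus v p1))^-1) *
  (\prod_(v1 : box a)
     \prod_(v2 : box a | (tag v2 == tag v1) && (v1 != v2))
       \prod_(1 <= p1 < (m v1).+1) \prod_(1 <= p2 < (m v2).+1)
         (zeta (tag v1) (tag v2) (pt_minus v2 p2 - pt_minus v1 p1))^-1) *
  (\prod_(v1 : box a) \prod_(v2 : box a | o (tag v1) (tag v2))
     \prod_(1 <= p1 < (m v1).+1) \prod_(1 <= p2 < (m v2).+1)
       (zeta (tag v2) (tag v1) (pt_minus v2 p2 - pt_minus v1 p1))^-1).

(* Each coefficient, a priori in C(w), is required to lie in the localization
   that maps to the oscillator algebra. *)
Definition plus_formula (Phit : shuffle -> osc) : Prop :=
  forall (k : mdegree) (E : shuffle), in_shuffle E -> homogeneous k E ->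
  exists c : occupation k -> osc,
    (forall m, occ_ok m -> osc_value (coef_plus (E k) m) (c m)) /\
    Phit E = \sum_(m : occupation k | occ_ok m)
               c m * \prod_(v : box a) ouV v ^+ m v.

Definition minus_formula (Phit : shuffle -> osc) : Prop :=
  forall (k : mdegree) (F : shuffle), in_shuffle F -> homogeneous k F ->
  exists c : occupation k -> osc,
    (forall m, occ_ok m -> osc_value (coef_minus (F k) m) (c m)) /\
    Phit F = \sum_(m : occupation k | occ_ok m)
               c m * \prod_(v : box a) ou v ^+ m v.

End Oscillator.
End RootData.

(* Main.v *)
(** The two halves are treated together, with a sign [eps]: for the F half the
    product is the opposite one and z becomes -z in zeta.  Evaluate F * G at the
    strings of points attached to an occupation n.  As zeta_ii vanishes between
    consecutive points of one string, a permutation contributes to Sym only if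
    the variables of F fill initial segments of all strings; what remains is a
    sum over m <= n.  In the term of m, G is evaluated at points shifted by m,
    which is what commuting with u^m does, and the mixed zeta factors cancel
    against the quotients of the factors Y before and after the shift, which
    telescope.

    The coefficients have no poles along w_{i,k} - w_{j,l} + const with i, j
    connected: by the wheel conditions the numerator of E, evaluated on the
    strings, is divisible by each of the linear forms in question, and linear
    forms of different pairs (i,k), (j,l) are coprime. *)

Require Import Defs.
From HB Require Import structures.
From mathcomp Require Import all_boot all_order all_algebra.
From mathcomp Require Import fingroup perm fraction.
From mathcomp Require Import boolp.
From mathcomp Require classical_sets.
From mathcomp Require finmap.
From mathcomp Require Import -(notations) monalg.
From mathcomp Require Import ssrcomplements mpoly.
From mathcomp Require Import ring.

Set Implicit Arguments.
Unset Strict Implicit.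
Unset Printing Implicit Defensive.

Import Order.TTheory GRing.Theory Num.Theory.
Local Open Scope ring_scope.

(** * Substitution into rational functions *)

(** Two evaluations are only partial: substituting special points into a rational function may hit a
    pole, and a function of w can be read in the oscillator algebra only on the localization. Both
    are handled through their graphs, and identities between coefficients are proved in the field
    C(w) before they are transported.

    Regularity along w_{i,k} - w_{j,l} + const rests on a count. Put n = -a_ji and let m be the
    length of the string of (j,l). For each point of the string of (i,k), the inverse zeta factors
    bring one linear form for every q < m into the denominator. The W_j in Y supply the forms with q
    < n, the wheel conditions those with n <= q < m. For a fixed pair of strings, different points
    and different q may give the same form in w, so vanishing tested on w alone would lose
    multiplicities. Hence only the string of (j,l) is specialised at first, the points of (i,k)
    being kept as free variables: there the forms are distinct, and the divisibility obtained is
    specialised afterwards. *)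

Lemma mpoly_alg_ind (n : nat) (R : nzRingType) (P : {mpoly R[n]} -> Prop) :
  (forall c, P c%:MP) -> (forall i, P 'X_i) ->
  (forall p q, P p -> P q -> P (p + q)) ->
  (forall p q, P p -> P q -> P (p * q)) -> forall p, P p.
Proof.
move=> hC hX hD hM; have h1 : P 1 by rewrite -mpolyC1.
have hpow i k : P ('X_i ^+ k).
  by elim: k => [|k IH]; rewrite ?expr0 // exprS; apply: hM.
elim/mpolyind => [|c m p _ _ hp]; first by rewrite -mpolyC0.
apply: hD => //; rewrite -mul_mpolyC; apply: (hM) => //.
rewrite mpolyXE_id; by elim/big_ind: _.
Qed.

Lemma mpoly_hom_ext (n : nat) (R : nzRingType) (S : pzRingType)
    (f h : {rmorphism {mpoly R[n]} -> S}) :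
  (forall c, f c%:MP = h c%:MP) -> (forall i, f 'X_i = h 'X_i) -> f =1 h.
Proof.
move=> hC hX; apply: mpoly_alg_ind => // p q ep eq.
  by rewrite !rmorphD ep eq.
by rewrite !rmorphM ep eq.
Qed.

(** Induction on the number of variables, the last one being singled out: for fixed values of the
    others, the resulting univariate polynomial vanishes at all natural numbers, which are distinct
    in characteristic 0. *)
Lemma mpoly_meval_inj (C : numFieldType) (n : nat) (p : {mpoly C[n]}) :
  (forall x, p.@[x] = 0) -> p = 0.
Proof.
elim: n p => [|n IH] p hp.
  suff e : idfun =1 (@mpolyC 0 C) \o meval (fun=> 0) :> ({mpoly C[0]} -> _).
    by rewrite -[p]/(idfun p) e /= hp mpolyC0.
  by apply: mpoly_hom_ext => [c|[]//]; rewrite /= mevalC.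
pose xv (i : 'I_n.+1) : {poly {mpoly C[n]}} :=
  if unlift ord_max i is Some j then ('X_j)%:P else 'X.
pose phi : {rmorphism {mpoly C[n.+1]} -> {poly {mpoly C[n]}}} :=
  mmap (polyC \o @mpolyC n C) xv.
pose wid : {rmorphism {mpoly C[n]} -> {mpoly C[n.+1]}} :=
  mmap (@mpolyC n.+1 C) (fun j => 'X_(lift ord_max j)).
have phiC c : phi c%:MP = c%:MP%:P by rewrite /phi /= mmapC.
have phiX i : phi 'X_i = xv i by rewrite /phi /= mmapX mmap1U.
(* A left inverse of [phi], so it is enough that [phi p] vanishes. *)
have back : horner_eval 'X_ord_max \o map_poly wid \o phi =1 idfun.
  apply: mpoly_hom_ext => [c|i] /=.
    by rewrite phiC map_polyC /horner_eval hornerC /= mmapC.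
  rewrite phiX /xv; case: unliftP => [j ->|->].
    by rewrite map_polyC /horner_eval hornerC /= mmapX mmap1U.
  by rewrite map_polyX /horner_eval hornerX.
suff phi0 : phi p = 0 by rewrite -[LHS]/(idfun p) -back [LHS]/= phi0 !rmorph0.
apply/polyP => d; rewrite coef0; apply: IH => x.
pose q := map_poly (meval x) (phi p).
suff q0 : q = 0 by rewrite -[LHS](coef_map (meval x)) -/q q0 coef0.
have qz z : q.[z] = 0.
  pose y (i : 'I_n.+1) := if unlift ord_max i is Some j then x j else z.
  suff e : horner_eval z \o map_poly (meval x) \o phi =1 meval y.
    by rewrite -[LHS]/((horner_eval z \o map_poly (meval x) \o phi) p) e.
  apply: mpoly_hom_ext => [c|i] /=.
    by rewrite phiC map_polyC /horner_eval hornerC /= !mevalC.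
  rewrite phiX /xv mevalXU /y; case: unliftP => [j _|_].
    by rewrite map_polyC /horner_eval hornerC /= mevalXU.
  by rewrite map_polyX /horner_eval hornerX.
apply/eqP/negPn/negP => nz.
have := max_poly_roots (rs := [seq i%:R | i <- iota 0 (size q)]) nz.
rewrite size_map size_iota ltnn => hr; apply: notF; apply: hr.
  by apply/allP => _ /mapP[i _ ->]; apply/rootP.
rewrite map_inj_uniq ?iota_uniq // => i j /eqP; rewrite eqr_nat; exact: eqP.
Qed.

(** Modulo X_t - L the substitution X_t := L is the identity on generators, hence everywhere. Every
    element of its kernel is thus a multiple of X_t - L, which is the source of all divisibilities
    below. *)
Lemma mpoly_elim_var (n : nat) (R : comNzRingType) (t : 'I_n) (L : {mpoly R[n]})
    (phi : {rmorphism {mpoly R[n]} -> {mpoly R[n]}}) :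
  (forall c, phi c%:MP = c%:MP) ->
  (forall i, phi 'X_i = if i == t then L else 'X_i) ->
  forall p, exists q, p = phi p + ('X_t - L) * q.
Proof.
move=> hC hX; apply: mpoly_alg_ind => [c|i|p q [p' ep] [q' eq]|p q [p' ep] [q' eq]].
- by exists 0; rewrite hC mulr0 addr0.
- rewrite hX; case: (i =P t) => [->|_]; last by exists 0; rewrite mulr0 addr0.
  by exists 1; rewrite mulr1 addrC subrK.
- by exists (p' + q'); rewrite rmorphD {1}ep {1}eq mulrDr addrACA.
- exists (p' * q + phi p * q'); rewrite rmorphM.
  by rewrite mulrDr mulrA mulrCA addrCA -mulrDr -eq -mulrDl addrC -ep.
Qed.

Lemma divf_eq_cross (K : fieldType) (a b c d : K) :
  b != 0 -> d != 0 -> a / b = c / d -> a * d = c * b.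
Proof. by move=> hb hd /eqP; rewrite eqr_div // => /eqP. Qed.

Lemma cross_divf_eq (K : fieldType) (a b c d : K) :
  b != 0 -> d != 0 -> a * d = c * b -> a / b = c / d.
Proof. by move=> hb hd e; apply/eqP; rewrite eqr_div // e. Qed.

(* The partial map F = i P / i Q |-> phi P / phi Q induced on fractions by phi,
   as a relation. *)
Section FractionValue.
Variables (A : pzRingType) (K L : fieldType).
Variables (i : {rmorphism A -> K}) (phi : {rmorphism A -> L}).
Hypothesis i_inj : injective i.

Definition frac_value (F : K) (y : L) : Prop := exists P Q : A,
  [/\ phi Q != 0, F = i P / i Q & y = phi P / phi Q].

Lemma frac_den_neq0 Q : phi Q != 0 -> i Q != 0.
Proof.
by apply: contraNneq => e; rewrite (i_inj (x1 := Q) (x2 := 0)) ?rmorph0.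
Qed.

Lemma frac_value_fun F y z : frac_value F y -> frac_value F z -> y = z.
Proof.
move=> [P [Q [nz -> ->]]] [P' [Q' [nz' e ->]]].
have := divf_eq_cross (frac_den_neq0 nz) (frac_den_neq0 nz') e.
rewrite -!rmorphM => /i_inj e'.
by apply: cross_divf_eq nz nz' _; rewrite -!rmorphM e'.
Qed.

Lemma frac_value_ring P : frac_value (i P) (phi P).
Proof. by exists P, 1; rewrite !rmorph1 oner_eq0 !divr1. Qed.

Lemma frac_valueD F G y z :
  frac_value F y -> frac_value G z -> frac_value (F + G) (y + z).
Proof.
move=> [P [Q [nz -> ->]]] [P' [Q' [nz' -> ->]]].
exists (P * Q' + P' * Q), (Q * Q'); rewrite !rmorphD !rmorphM mulf_neq0 //.
by rewrite !addf_div ?frac_den_neq0.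
Qed.

Lemma frac_valueM F G y z :
  frac_value F y -> frac_value G z -> frac_value (F * G) (y * z).
Proof.
move=> [P [Q [nz -> ->]]] [P' [Q' [nz' -> ->]]].
by exists (P * P'), (Q * Q'); rewrite !rmorphM mulf_neq0 // !mulf_div.
Qed.

Lemma frac_valueV F y : frac_value F y -> y != 0 -> frac_value F^-1 y^-1.
Proof.
move=> [P [Q [nz -> ->]]]; rewrite mulf_eq0 invr_eq0 negb_or nz andbT => nP.
by exists Q, P; rewrite !invf_div.
Qed.

End FractionValue.

Section Substitution.
Variables (C : numFieldType) (g : simple_datum C).
Local Notation rfun := (@rfun C g).
Local Notation rpoly := (@rpoly C g).
Local Notation mdegree := (@mdegree C g).
Implicit Types k n l : mdegree.

HB.instance Definition _ n := GRing.RMorphism.copy (@cst C g n)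
  (@tofrac _ \o @mpolyC _ C).

Definition psub k n (x : box k -> rfun n) (P : rpoly k) : rfun n :=
  poly_subst P x.
HB.instance Definition _ k n (x : box k -> rfun n) :=
  GRing.RMorphism.copy (psub x) (mmap (@cst C g n) (fun t => x (enum_val t))).

Definition pvar k (v : box k) : rpoly k := 'X_(enum_rank v).

Lemma psubC k n (x : box k -> rfun n) c : psub x c%:MP = cst n c.
Proof. by rewrite /psub /poly_subst mmapC. Qed.

Lemma psubX k n (x : box k -> rfun n) v : psub x (pvar v) = x v.
Proof. by rewrite /psub /poly_subst mmapX mmap1U enum_rankK. Qed.

Lemma rpoly_hom_ext k (S : pzRingType) (f h : {rmorphism rpoly k -> S}) :
  (forall c, f c%:MP = h c%:MP) -> (forall v, f (pvar v) = h (pvar v)) ->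
  f =1 h.
Proof.
move=> hC hX; apply: mpoly_hom_ext => // i.
by rewrite -[i]enum_valK; exact: hX.
Qed.

Lemma cst_eq0 n c : (cst n c == 0 :> rfun n) = (c == 0).
Proof. exact: fmorph_eq0. Qed.

(** As [rsubst] takes the value 0 off its domain, it does not respect sums and products in general.
    Its graph does, and [svalP] returns to [rsubst] once a value has been exhibited. *)
Definition sval k n (x : box k -> rfun n) (F : rfun k) (y : rfun n) : Prop :=
  frac_value (@tofrac (rpoly k)) (psub x) F y.
Definition reg k n (x : box k -> rfun n) (F : rfun k) : Prop :=
  exists y, sval x F y.

Lemma tofrac_inj (R : idomainType) : injective (@tofrac R).
Proof. by move=> x y /eqP; rewrite tofrac_eq => /eqP. Qed.

Lemma sval_fun k n (x : box k -> rfun n) F y z : sval x F y -> sval x F z -> y = z.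
Proof. by apply: frac_value_fun; exact: tofrac_inj. Qed.

Lemma svalP k n (x : box k -> rfun n) F y : sval x F y -> rsubst F x = y.
Proof.
move=> h; rewrite /rsubst; case: classical_sets.xgetP; last first.
  by move=> /(_ y) []; case: h => P [Q [h1 h2 h3]]; exists P, Q.
move=> z _ [P [Q [nz e ->]]]; apply: sval_fun h.
by exists P, Q.
Qed.

Lemma reg_sval k n (x : box k -> rfun n) F : reg x F -> sval x F (rsubst F x).
Proof. by move=> [y h]; rewrite (svalP h). Qed.

Section Sval.
Variables (k n : mdegree) (x : box k -> rfun n).

Lemma sval_poly (P : rpoly k) : sval x (tofrac P) (psub x P).
Proof. exact: frac_value_ring. Qed.

Lemma svalC c : sval x (cst k c) (cst n c).
Proof. by have := sval_poly c%:MP; rewrite psubC. Qed.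

Lemma svalX v : sval x (var v) (x v).
Proof. by have := sval_poly (pvar v); rewrite psubX. Qed.

Lemma svalD F G y z : sval x F y -> sval x G z -> sval x (F + G) (y + z).
Proof. by apply: frac_valueD; exact: tofrac_inj. Qed.

Lemma svalM F G y z : sval x F y -> sval x G z -> sval x (F * G) (y * z).
Proof. by apply: frac_valueM. Qed.

Lemma svalV F y : sval x F y -> y != 0 -> sval x F^-1 y^-1.
Proof. by apply: frac_valueV. Qed.

Lemma sval0 : sval x 0 0.
Proof. by have := svalC 0; rewrite !rmorph0. Qed.

Lemma sval1 : sval x 1 1.
Proof. by have := svalC 1; rewrite !rmorph1. Qed.

Lemma svalN F y : sval x F y -> sval x (- F) (- y).
Proof. by move=> h; have := svalM (svalC (-1)) h; rewrite !rmorphN1 !mulN1r. Qed.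

Lemma svalB F G y z : sval x F y -> sval x G z -> sval x (F - G) (y - z).
Proof. by move=> hF hG; apply: svalD hF (svalN hG). Qed.

Lemma sval_prod (J : Type) (s : seq J) (p : pred J) (F : J -> rfun k) y :
  (forall j, p j -> sval x (F j) (y j)) ->
  sval x (\prod_(j <- s | p j) F j) (\prod_(j <- s | p j) y j).
Proof.
by move=> h; elim/big_rec2: _ => [|j G z pj]; [exact: sval1 | apply: svalM; exact: h].
Qed.

Lemma sval_sum (J : Type) (s : seq J) (p : pred J) (F : J -> rfun k) y :
  (forall j, p j -> sval x (F j) (y j)) ->
  sval x (\sum_(j <- s | p j) F j) (\sum_(j <- s | p j) y j).
Proof.
by move=> h; elim/big_rec2: _ => [|j G z pj]; [exact: sval0 | apply: svalD; exact: h].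
Qed.

Lemma svalXn F y e : sval x F y -> sval x (F ^+ e) (y ^+ e).
Proof.
by move=> h; elim: e => [|e IH]; [exact: sval1 | rewrite !exprS; apply: svalM].
Qed.

End Sval.

Lemma psub_comp k n l (y : box k -> rfun n) (z : box n -> rfun l) t :
  (forall v, sval z (y v) (t v)) -> forall P : rpoly k,
  sval z (psub y P) (psub t P).
Proof.
move=> hy; apply: mpoly_alg_ind => [c|i|P Q h1 h2|P Q h1 h2].
- by rewrite !psubC; exact: svalC.
- by rewrite -[i]enum_valK !psubX.
- by rewrite !rmorphD; apply: svalD.
- by rewrite !rmorphM; apply: svalM.
Qed.

(** A denominator Q that is nonzero at the final point t is nonzero at the intermediate point y,
    since Q(y) specialises to Q(t) and 0 specialises to 0 only. So regularity need only be checked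
    at the final point. *)
Lemma sval_comp k n l (y : box k -> rfun n) (z : box n -> rfun l) t F u :
  (forall v, sval z (y v) (t v)) -> sval t F u ->
  reg y F /\ sval z (rsubst F y) u.
Proof.
move=> hy [P [Q [nz -> ->]]].
have hP := psub_comp hy P; have hQ := psub_comp hy Q.
have nzQ : psub y Q != 0.
  apply: contraNneq nz => e0; rewrite e0 in hQ.
  by apply/eqP; apply: sval_fun hQ (sval0 z).
have h : sval y (tofrac P / tofrac Q) (psub y P / psub y Q) by exists P, Q.
by split; [exists (psub y P / psub y Q) | rewrite (svalP h); apply: svalM hP (svalV hQ nz)].
Qed.

End Substitution.

(** * Evaluation in the oscillator algebra *)

Section CommutingEvaluation.
Variables (n : nat) (C : comNzRingType) (S : pzRingType).
Variables (sc : {rmorphism C -> S}) (h : 'I_n -> S).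
Hypothesis sc_central : forall c x, sc c * x = x * sc c.
Hypothesis h_comm : forall i j, h i * h j = h j * h i.

Let mon (m : 'X_{1..n}) : S := \prod_(i < n) h i ^+ m i.

(** Evaluation at pairwise commuting elements of a ring that may be noncommutative, with central
    scalars: polynomials in w are read in the oscillator algebra in this way. *)
Definition comm_eval (p : {mpoly C[n]}) : S := \sum_(m <- msupp p) sc p@_m * mon m.

Let comm_evalE p i : (msize p <= i)%N ->
  comm_eval p = \sum_(m : 'X_{1..n < i}) sc p@_m * mon m.
Proof.
move=> le_pi; set I : subFinType _ := 'X_{1..n < i}.
rewrite /comm_eval (big_mksub I) ?msupp_uniq //=; first last.
  by move=> x /msize_mdeg_lt /leq_trans; apply.
rewrite big_rmcond //= => j /memN_msupp_eq0 ->.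
by rewrite raddf0 mul0r.
Qed.

Lemma comm_eval_zmod : zmod_morphism comm_eval.
Proof.
move=> p q /=; set i := maxn (msize (p - q)) (maxn (msize p) (msize q)).
rewrite !(@comm_evalE _ i) /i ?leq_max ?leqnn ?orbT //.
by rewrite -sumrB; apply/eq_bigr => m _; rewrite !raddfB /= mulrDl mulNr.
Qed.
HB.instance Definition _ := GRing.isZmodMorphism.Build {mpoly C[n]} S comm_eval
  comm_eval_zmod.

Let monM m1 m2 : mon (m1 + m2) = mon m1 * mon m2.
Proof.
have pw i j e f : h i ^+ e * h j ^+ f = h j ^+ f * h i ^+ e.
  by apply: commrX; apply/commr_sym/commrX/h_comm.
rewrite /mon; elim: (index_enum _) => [|i s IH]; first by rewrite !big_nil mulr1.
rewrite !big_cons IH mnmDE exprD -!mulrA; congr (_ * _); rewrite !mulrA.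
congr (_ * _); elim/big_ind: _ => [|x y hx hy|j _]; first by rewrite mulr1 mul1r.
- by rewrite mulrA hx -mulrA hy mulrA.
- exact: pw.
Qed.

Lemma comm_evalC c : comm_eval c%:MP = sc c.
Proof.
have m0 : mon 0%MM = 1 by rewrite /mon big1 // => i _; rewrite mnm0E expr0.
rewrite /comm_eval msuppC; case: eqP => [->|_].
  by rewrite big_nil rmorph0.
by rewrite big_seq1 mcoeffC eqxx mulr1 m0 mulr1.
Qed.

Let comm_evalMon m : comm_eval 'X_[m] = mon m.
Proof. by rewrite /comm_eval msuppX big_seq1 mcoeffX eqxx rmorph1 mul1r. Qed.

Lemma comm_evalX i : comm_eval 'X_i = h i.
Proof.
rewrite comm_evalMon /mon (big_only1 i) //= => [|j /negbTE ne _].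
  by rewrite mnm1E eqxx expr1.
by rewrite mnm1E eq_sym ne expr0.
Qed.

Let comm_evalZ c p : comm_eval (c *: p) = sc c * comm_eval p.
Proof.
set i := maxn (msize (c *: p)) (msize p).
rewrite !(@comm_evalE _ i) /i ?leq_max ?leqnn ?orbT //.
by rewrite mulr_sumr; apply/eq_bigr => m _; rewrite mcoeffZ mulrA -rmorphM.
Qed.

Let comm_eval_mulX m q : comm_eval ('X_[m] * q) = comm_eval 'X_[m] * comm_eval q.
Proof.
elim/mpolyind: q => [|e m' q _ _ hq]; first by rewrite mulr0 raddf0 mulr0.
rewrite mulrDr !raddfD /= hq mulrDr; congr (_ + _).
rewrite -scalerAr !comm_evalZ -mpolyXD !comm_evalMon monM.
by rewrite mulrA sc_central -mulrA.
Qed.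

Lemma comm_eval_monoid : monoid_morphism comm_eval.
Proof.
split=> [|p q]; first by rewrite -mpolyC1 comm_evalC rmorph1.
elim/mpolyind: p => [|c m p _ _ hp]; first by rewrite mul0r raddf0 mul0r.
rewrite mulrDl !raddfD /= hp mulrDl; congr (_ + _).
by rewrite -scalerAl !comm_evalZ comm_eval_mulX mulrA.
Qed.

End CommutingEvaluation.

Section PresentedAlgebra.
Variables (C : fieldType) (G : choiceType) (rel : free_alg C G -> Prop).
Local Notation A := (presented rel).
Local Notation cl := (pcls rel).

Lemma pcls_mul x y : cl x * cl y = cl (x * y).
Proof. exact: pclsM. Qed.

Lemma pcls_scale c x : c *: cl x = cl (c *: x).
Proof. exact: pclsZ. Qed.

Lemma pcls0 : cl 0 = 0.
Proof. by apply: (addrI (cl 0)); rewrite -pclsD !addr0. Qed.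

Lemma pclsB x y : cl (x - y) = cl x - cl y.
Proof. by apply: (addIr (cl y)); rewrite -pclsD !subrK. Qed.

Lemma pcls_rel x : rel x -> cl x = 0.
Proof.
by move=> h; rewrite -pcls0; apply/pclsP; rewrite subr0; exact: ideal_gen_rel.
Qed.

Lemma presented_scalerAl c (x y : A) : c *: (x * y) = (c *: x) * y.
Proof.
have [x' ->] := pcls_surj x; have [y' ->] := pcls_surj y.
by rewrite !(pcls_mul, pcls_scale) scalerAl.
Qed.

Lemma free_alg_scalerAr c (x y : free_alg C G) : c *: (x * y) = x * (c *: y).
Proof.
apply/monalg.malgP => k; rewrite monalg.mcoeffZ.
rewrite (monalg.mcoeffMlw _ (finmap.fsubset_refl _) (finmap.fsubset_refl _)).
rewrite (monalg.mcoeffMlw _ (finmap.fsubset_refl _) (monalg.msuppZ_le c y)).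
rewrite mulr_sumr; apply: eq_bigr => i _; rewrite mulr_sumr.
by apply: eq_bigr => j _; rewrite monalg.mcoeffZ mulrnAr mulrCA.
Qed.

Lemma presented_scalerAr c (x y : A) : c *: (x * y) = x * (c *: y).
Proof.
have [x' ->] := pcls_surj x; have [y' ->] := pcls_surj y.
by rewrite !(pcls_mul, pcls_scale) free_alg_scalerAr.
Qed.

Definition presented_scalar (c : C) : A := c *: (1 : A).

Lemma presented_scalar_zmod : zmod_morphism presented_scalar.
Proof. by move=> c e; rewrite /presented_scalar scalerBl. Qed.
HB.instance Definition _ :=
  GRing.isZmodMorphism.Build C A presented_scalar presented_scalar_zmod.

Lemma presented_scalarE c x : presented_scalar c * x = c *: x.
Proof. by rewrite /presented_scalar -presented_scalerAl mul1r. Qed.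

Lemma presented_scalar_monoid : monoid_morphism presented_scalar.
Proof.
split=> [|c e]; first by rewrite /presented_scalar scale1r.
by rewrite presented_scalarE /presented_scalar scalerA.
Qed.
HB.instance Definition _ :=
  GRing.isMonoidMorphism.Build C A presented_scalar presented_scalar_monoid.

Lemma presented_scalarC c x : presented_scalar c * x = x * presented_scalar c.
Proof.
by rewrite presented_scalarE /presented_scalar -presented_scalerAr mulr1.
Qed.

End PresentedAlgebra.

(* The value x of the fraction i P / i D in S, where ev D is invertible. *)
Section RingValue.
Variables (A : comPzRingType) (K : fieldType) (S : pzRingType).
Variables (i : {rmorphism A -> K}) (ev : {rmorphism A -> S}).
Hypothesis i_inj : injective i.

Definition ring_value (f : K) (x : S) : Prop := exists P D : A, exists y : S,
  [/\ i D != 0, f = i P / i D, ev D * y = 1, y * ev D = 1 & x = ev P * y].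

Let ev_comm P Q : ev P * ev Q = ev Q * ev P.
Proof. by rewrite -!rmorphM mulrC. Qed.

Lemma inverse_comm (x y z : S) :
  x * y = 1 -> y * x = 1 -> x * z = z * x -> y * z = z * y.
Proof.
move=> xy yx xz; rewrite -[LHS]mulr1 -xy -mulrA [z * (x * y)]mulrA -xz.
by rewrite !mulrA yx mul1r.
Qed.

(** Cross-multiplication takes place in [A], where [i_inj] justifies it; the inverses of [ev D] and
    [ev D'] carry the result to [S], which may have zero divisors. *)
Lemma ring_value_fun f x x' : ring_value f x -> ring_value f x' -> x = x'.
Proof.
move=> [P [D [y [nz -> Dy yD ->]]]] [P' [D' [y' [nz' e Dy' yD' ->]]]].
have := divf_eq_cross nz nz' e; rewrite -!rmorphM => /i_inj e'.
have cy : y * y' = y' * y.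
  by apply: inverse_comm Dy yD _; apply/esym; apply: inverse_comm Dy' yD' _.
have e1 : ev P = ev P' * ev D * y'.
  by rewrite -rmorphM -e' rmorphM -mulrA Dy' mulr1.
by rewrite e1 -!mulrA -cy [ev D * _]mulrA Dy mul1r.
Qed.

Lemma ring_valueD f f' x x' :
  ring_value f x -> ring_value f' x' -> ring_value (f + f') (x + x').
Proof.
move=> [P [D [y [nz -> Dy yD ->]]]] [P' [D' [y' [nz' -> Dy' yD' ->]]]].
exists (P * D' + P' * D), (D * D'), (y' * y); rewrite !rmorphM !rmorphD !rmorphM.
have cy : y * y' = y' * y.
  by apply: inverse_comm Dy yD _; apply/esym; apply: inverse_comm Dy' yD' _.
split.
- by rewrite mulf_neq0.
- by rewrite addf_div.
- by rewrite -mulrA [ev D' * _]mulrA Dy' mul1r.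
- by rewrite -mulrA [y * _]mulrA yD mul1r.
- rewrite mulrDl -!mulrA [ev D' * _]mulrA Dy' mul1r; congr (_ + ev P' * _).
  by rewrite -cy mulrA Dy mul1r.
Qed.

Lemma ring_valueM f f' x x' :
  ring_value f x -> ring_value f' x' -> ring_value (f * f') (x * x').
Proof.
move=> [P [D [y [nz -> Dy yD ->]]]] [P' [D' [y' [nz' -> Dy' yD' ->]]]].
exists (P * P'), (D * D'), (y' * y); rewrite !rmorphM.
have cy : y * y' = y' * y.
  by apply: inverse_comm Dy yD _; apply/esym; apply: inverse_comm Dy' yD' _.
split.
- by rewrite mulf_neq0.
- by rewrite mulf_div.
- by rewrite -mulrA [ev D' * _]mulrA Dy' mul1r.
- by rewrite -mulrA [y * _]mulrA yD mul1r.
- rewrite -!mulrA; congr (_ * _); rewrite -cy !mulrA; congr (_ * _).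
  exact: inverse_comm Dy yD (ev_comm D P').
Qed.

Lemma ring_value_ring P : ring_value (i P) (ev P).
Proof. by exists P, 1, 1; rewrite !rmorph1 oner_eq0 divr1 !mulr1. Qed.

End RingValue.

Section OscillatorValue.
Variables (C : numFieldType) (g : simple_datum C) (a : mdegree g).
Local Notation K := (rfun a).
Local Notation Osc := (osc a).
Local Notation sc := (presented_scalar (@osc_rel C g a)).
Let owt (t : 'I_#|{: box a}|) : Osc := ow (enum_val t).

Lemma ow_comm (v v' : box a) : ow v * ow v' = ow v' * ow v.
Proof.
apply/eqP; rewrite -subr_eq0 /ow !pcls_mul -pclsB; apply/eqP.
by apply: pcls_rel; exact: osc_ww.
Qed.

Definition oeval : rpoly a -> Osc := comm_eval sc owt.

Let sc_central : forall c x, sc c * x = x * sc c.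
Proof. exact: presented_scalarC. Qed.
Let owt_comm i j : owt i * owt j = owt j * owt i.
Proof. exact: ow_comm. Qed.

HB.instance Definition _ := GRing.isZmodMorphism.Build (rpoly a) Osc oeval
  (comm_eval_zmod sc owt).
HB.instance Definition _ := GRing.isMonoidMorphism.Build (rpoly a) Osc oeval
  (comm_eval_monoid sc_central owt_comm).

Lemma oevalC c : oeval c%:MP = c *: (1 : Osc).
Proof. exact: comm_evalC. Qed.

Lemma oevalX v : oeval (pvar v) = ow v.
Proof. by rewrite /oeval comm_evalX /owt enum_rankK. Qed.

Definition oval : K -> Osc -> Prop := ring_value (@tofrac (rpoly a)) oeval.

Lemma oevalD P Q : oeval (P + Q) = oeval P + oeval Q.
Proof. exact: (rmorphD oeval). Qed.

Lemma oevalN P : oeval (- P) = - oeval P.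
Proof. exact: (rmorphN oeval). Qed.

Lemma oeval1 : oeval 1 = 1.
Proof. exact: (rmorph1 oeval). Qed.

Lemma ow_inv p m :
  let d := ow (val p).1 - ow (val p).2 + (m%:~R * dd (tag (val p).1)) *: (1 : Osc) in
  d * oinv p m = 1 /\ oinv p m * d = 1.
Proof.
move=> d; have -> : d = pcls _ (fdiff p m).
  by rewrite pclsD pclsB -pcls_scale.
split; apply/eqP; rewrite -subr_eq0 pcls_mul -[1]/(pcls _ 1) -pclsB; apply/eqP.
  by apply: pcls_rel; exact: osc_invr.
by apply: pcls_rel; exact: osc_invl.
Qed.

Definition diff_poly (v v' : box a) (c : C) : rpoly a := pvar v - pvar v' + c%:MP.

Lemma diff_poly_neq0 v v' c : v != v' -> diff_poly v v' c != 0.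
Proof.
(* At the point with coordinate 1 - c at v and 0 elsewhere the form takes the value 1. *)
move=> ne; apply/eqP => e; have := congr1 (meval (fun t => (enum_val t == v)%:R * (1 - c))) e.
rewrite !rmorphD rmorphN /= !mevalXU mevalC rmorph0 !enum_rankK eqxx eq_sym.
by rewrite (negbTE ne) mul0r subr0 mul1r subrK => /eqP; rewrite oner_eq0.
Qed.

Lemma tofrac_diff v v' c :
  tofrac (diff_poly v v' c) = var v - var v' + cst a c :> K.
Proof. by rewrite rmorphD rmorphB. Qed.

Lemma osc_value_oval (f : K) (x : Osc) : osc_value f x -> oval f x.
Proof.
elim=> [c|v|p m|f1 f2 x1 x2 _ h1 _ h2|f1 f2 x1 x2 _ h1 _ h2].
- by rewrite -oevalC; exact: (ring_value_ring _ oeval c%:MP).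
- by rewrite -oevalX; exact: (ring_value_ring _ oeval (pvar v)).
- have [h1 h2] := ow_inv p m; have /andP[_ ne] := valP p.
  exists 1, (diff_poly (val p).1 (val p).2 (m%:~R * dd (tag (val p).1))), (oinv p m).
  have e : oeval (diff_poly (val p).1 (val p).2 (m%:~R * dd (tag (val p).1))) =
      ow (val p).1 - ow (val p).2 + (m%:~R * dd (tag (val p).1)) *: (1 : Osc).
    by rewrite !oevalD oevalN !oevalX oevalC.
  split.
  + by rewrite tofrac_eq0; exact: diff_poly_neq0.
  + have := tofrac_diff (val p).1 (val p).2 (m%:~R * dd (tag (val p).1)).
    by move=> /= ->; rewrite tofrac1 div1r.
  + exact: (etrans (congr1 (fun z => z * oinv p m) e) h1).
  + exact: (etrans (congr1 (fun z => oinv p m * z) e) h2).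
  + exact: esym (etrans (congr1 (fun z => z * oinv p m) oeval1) (mul1r _)).
- exact: ring_valueD.
- exact: ring_valueM.
Qed.

(** The inductive relation admits many derivations for one f. All of them end in [oval], which is
    single-valued. *)
Lemma osc_value_fun (f : K) (x x' : Osc) : osc_value f x -> osc_value f x' -> x = x'.
Proof. move=> /osc_value_oval h /osc_value_oval; move: h; exact: (ring_value_fun (@tofrac_inj _)). Qed.

End OscillatorValue.

(** * Conjugation of functions of w by monomials in the u's *)

Lemma conj_add (S : pzRingType) (u x1 x2 y1 y2 : S) :
  u * x1 = y1 * u -> u * x2 = y2 * u -> u * (x1 + x2) = (y1 + y2) * u.
Proof. by move=> e1 e2; rewrite mulrDr e1 e2 -mulrDl. Qed.

Lemma conj_mul (S : pzRingType) (u x1 x2 y1 y2 : S) :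
  u * x1 = y1 * u -> u * x2 = y2 * u -> u * (x1 * x2) = (y1 * y2) * u.
Proof. by move=> e1 e2; rewrite mulrA e1 -!mulrA e2. Qed.

Section ShiftMonomial.
Variables (C : comNzRingType) (S : pzRingType) (T : finType).
Variables (sc : {rmorphism C -> S}) (w U : T -> S) (d : T -> C).
Hypothesis sc_central : forall c x, sc c * x = x * sc c.
Hypothesis U_w : forall v v',
  U v * w v' = (w v' - sc (if v == v' then d v else 0)) * U v.
Hypothesis U_comm : forall v v', U v * U v' = U v' * U v.

Definition umon (m : T -> nat) : S := \prod_v U v ^+ m v.

Lemma umonD m m' : umon (fun v => (m v + m' v)%N) = umon m * umon m'.
Proof.
have pw i j e f : U i ^+ e * U j ^+ f = U j ^+ f * U i ^+ e.
  by apply: commrX; apply/commr_sym/commrX/U_comm.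
rewrite /umon; elim: (index_enum _) => [|i s IH]; first by rewrite !big_nil mulr1.
rewrite !big_cons IH exprD -!mulrA; congr (_ * _); rewrite !mulrA.
congr (_ * _); elim/big_ind: _ => [|x y hx hy|j _]; first by rewrite mulr1 mul1r.
- by rewrite mulrA hx -mulrA hy mulrA.
- exact: pw.
Qed.

Let upow_w v v' e : U v ^+ e * w v' =
  (w v' - sc (if v == v' then e%:R * d v else 0)) * U v ^+ e.
Proof.
elim: e => [|e IH].
  by rewrite !expr0 mul0r if_same rmorph0 subr0 mulr1 mul1r.
rewrite exprS -mulrA IH mulrA mulrBr U_w -sc_central -mulrBl mulrA.
congr (_ * _ * _); case: eqP => _; last by rewrite rmorph0 !subr0.
by rewrite -addrA -opprD -rmorphD -natr1 mulrDl mul1r [d v + _]addrC.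
Qed.

Lemma umon_w m v : umon m * w v = (w v - sc ((m v)%:R * d v)) * umon m.
Proof.
pose c u := if u == v then (m u)%:R * d u else 0.
have key s : (\prod_(u <- s) U u ^+ m u) * w v =
    (w v - sc (\sum_(u <- s) c u)) * \prod_(u <- s) U u ^+ m u.
  elim: s => [|u s IH].
    by rewrite !big_nil rmorph0 subr0 mulr1 mul1r.
  rewrite !big_cons -mulrA IH mulrA mulrBr upow_w -sc_central -mulrBl mulrA.
  by congr (_ * _ * _); rewrite -addrA -opprD -rmorphD.
by rewrite /umon key /c -big_mkcond /= big_pred1_eq.
Qed.

Lemma umon_conj_inv m D D' i i' : umon m * D = D' * umon m ->
  D * i = 1 -> i' * D' = 1 -> umon m * i = i' * umon m.
Proof.
move=> hD Di iD; rewrite -[LHS]mul1r -iD -mulrA; congr (_ * _).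
by rewrite mulrA -hD -mulrA Di mulr1.
Qed.

Lemma umon_conj_diff m v v' c c' :
  c' = c - (m v)%:R * d v + (m v')%:R * d v' ->
  umon m * (w v - w v' + sc c) = (w v - w v' + sc c') * umon m.
Proof.
move=> ->; rewrite mulrDr mulrBr !umon_w -sc_central -mulrBl -mulrDl.
congr (_ * _); rewrite rmorphD rmorphB opprB [sc _ - w v']addrC addrACA.
by rewrite -[LHS]addrA; congr (_ + _); rewrite addrC addrA.
Qed.

End ShiftMonomial.

Section Localization.
Variables (C : numFieldType) (g : simple_datum C) (a : mdegree g).
Local Notation K := (rfun a).
Local Notation Osc := (osc a).

Definition loc (f : K) : Prop := exists x, osc_value f x.

Definition oscv (f : K) : Osc := classical_sets.xget 0 (fun x => osc_value f x).

Lemma oscvP f : loc f -> osc_value f (oscv f).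
Proof.
by move=> [x hx]; rewrite /oscv; case: classical_sets.xgetP => [y _ //|/(_ x)].
Qed.

Lemma oscvE f x : osc_value f x -> oscv f = x.
Proof. by move=> h; have hl : loc f by [exists x]; exact: osc_value_fun (oscvP hl) h. Qed.

Lemma locC c : loc (cst a c).
Proof. by exists (c *: (1 : Osc)); exact: osc_value_cst. Qed.

Lemma oscvC c : oscv (cst a c) = c *: (1 : Osc).
Proof. by apply: oscvE; exact: osc_value_cst. Qed.

Lemma locX v : loc (var v).
Proof. by exists (ow v); exact: osc_value_w. Qed.

Lemma locD f f' : loc f -> loc f' -> loc (f + f').
Proof. by move=> [x h] [x' h']; exists (x + x'); exact: osc_value_add. Qed.

Lemma oscvD f f' : loc f -> loc f' -> oscv (f + f') = oscv f + oscv f'.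
Proof. by move=> h h'; apply: oscvE; apply: osc_value_add; exact: oscvP. Qed.

Lemma locM f f' : loc f -> loc f' -> loc (f * f').
Proof. by move=> [x h] [x' h']; exists (x * x'); exact: osc_value_mul. Qed.

Lemma oscvM f f' : loc f -> loc f' -> oscv (f * f') = oscv f * oscv f'.
Proof. by move=> h h'; apply: oscvE; apply: osc_value_mul; exact: oscvP. Qed.

Lemma loc0 : loc 0.
Proof. by rewrite -(rmorph0 (@cst C g a)); exact: locC. Qed.

Lemma oscv0 : oscv 0 = 0.
Proof. by rewrite -(rmorph0 (@cst C g a)) oscvC scale0r. Qed.

Lemma loc1 : loc 1.
Proof. by rewrite -(rmorph1 (@cst C g a)); exact: locC. Qed.

Lemma oscv1 : oscv 1 = 1.
Proof. by rewrite -(rmorph1 (@cst C g a)) oscvC scale1r. Qed.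

Lemma oscvZ c f : loc f -> oscv (cst a c * f) = c *: oscv f.
Proof.
move=> h; rewrite oscvM //; last exact: locC.
by rewrite oscvC -presented_scalerAl mul1r.
Qed.

Lemma locN f : loc f -> loc (- f).
Proof.
by move=> h; rewrite -mulN1r -(rmorphN1 (@cst C g a)); apply: locM => //; exact: locC.
Qed.

Lemma locB f f' : loc f -> loc f' -> loc (f - f').
Proof. by move=> h h'; apply: locD => //; exact: locN. Qed.

Lemma loc_prod (J : Type) (s : seq J) (p : pred J) (F : J -> K) :
  (forall j, p j -> loc (F j)) -> loc (\prod_(j <- s | p j) F j).
Proof.
by move=> h; elim/big_ind: _ => [|x y|j pj]; [exact: loc1|exact: locM|exact: h].
Qed.

Lemma oscv_sum (J : Type) (s : seq J) (p : pred J) (F : J -> K) :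
  (forall j, p j -> loc (F j)) ->
  oscv (\sum_(j <- s | p j) F j) = \sum_(j <- s | p j) oscv (F j).
Proof.
move=> h; suff [] : loc (\sum_(j <- s | p j) F j) /\
  oscv (\sum_(j <- s | p j) F j) = \sum_(j <- s | p j) oscv (F j) by [].
elim/big_ind2: _ => [|x1 y1 x2 y2 [h1 <-] [h2 <-]|j pj] //.
- by split; [exact: loc0 | exact: oscv0].
- by split; [exact: locD | exact: oscvD].
- by split; [exact: h|].
Qed.

Lemma loc_poly (P : rpoly a) : loc (tofrac P).
Proof.
elim/mpoly_alg_ind: P => [c|i|p q hp hq|p q hp hq].
- exact: locC.
- by rewrite -[i]enum_valK; exact: locX.
- by rewrite rmorphD; exact: locD.
- by rewrite rmorphM; exact: locM.
Qed.

Lemma loc_inv_diff (v v' : box a) (m : int) : tag v = tag v' -> v != v' ->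
  loc (var v - var v' + cst a (m%:~R * dd (tag v)))^-1.
Proof.
move=> e ne; have hp : (tag (v, v').1 == tag (v, v').2) && ((v, v').1 != (v, v').2).
  by rewrite /= e eqxx.
exists (oinv (Sub (v, v') hp) m).
exact: (osc_value_inv (Sub (v, v') hp) m).
Qed.

Section Shift.
Variables (eps : int) (U : box a -> Osc).
Local Notation d v := (eps%:~R * dd (tag v) : C).
Local Notation sc := (presented_scalar (@osc_rel C g a)).
Hypothesis U_ow : forall v v', U v * ow v' =
  (ow v' - sc (if v == v' then d v else 0)) * U v.
Hypothesis U_comm : forall v v', U v * U v' = U v' * U v.

(** Moving U^m to the right past a function of w replaces each w_v by w_v - m_v eps d_v; eps = 1
    belongs to U = u^-1 and eps = -1 to U = u. *)
Definition shift (m : box a -> nat) (v : box a) : K :=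
  var v - cst a ((m v)%:R * d v).

Let sc_central : forall c x, sc c * x = x * sc c.
Proof. exact: presented_scalarC. Qed.

Lemma shift_diff m v v' (k : int) : tag v = tag v' ->
  shift m v - shift m v' + cst a (k%:~R * dd (tag v)) =
  var v - var v' + cst a ((k - (m v)%:Z * eps + (m v')%:Z * eps)%:~R * dd (tag v)).
Proof.
move=> e; rewrite /shift opprB [cst a _ - var v']addrC addrACA -[LHS]addrA.
congr (_ + _).
have -> : (k - (m v)%:Z * eps + (m v')%:Z * eps)%:~R * dd (tag v) =
    - ((m v)%:R * d v) + (m v')%:R * d v' + k%:~R * dd (tag v).
  rewrite -e !rmorphD rmorphN !rmorphM /= -!pmulrn !mulrDl mulNr -!mulrA.
  by rewrite -addrA addrC.
by rewrite 2!(rmorphD (@cst C g a)) (rmorphN (@cst C g a)).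
Qed.

(** Induction on the derivation. Shifts preserve the localization because the two w's in an inverted
    form have the same colour: the constant changes by an integer multiple of their common d, so the
    result is again an inverted generator. *)
Lemma umon_osc_value m (f : K) (x : Osc) : osc_value f x -> exists f' x',
  [/\ sval (shift m) f f', osc_value f' x' & umon U m * x = x' * umon U m].
Proof.
elim=> [c|v|p k|f1 f2 x1 x2 _ [f1' [y1 [s1 o1 e1]]] _ [f2' [y2 [s2 o2 e2]]]
  |f1 f2 x1 x2 _ [f1' [y1 [s1 o1 e1]]] _ [f2' [y2 [s2 o2 e2]]]].
- exists (cst a c), (c *: (1 : Osc)); split; [exact: svalC | exact: osc_value_cst|].
  exact: esym (sc_central c (umon U m)).
- exists (shift m v), (ow v + (- ((m v)%:R * d v)) *: (1 : Osc)); split.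
  + exact: svalX.
  + rewrite /shift -[- cst _ _]rmorphN.
    by apply: osc_value_add; [exact: osc_value_w | exact: osc_value_cst].
  + have := umon_w sc_central U_ow m v; rewrite -rmorphN; exact.
- have /andP[/eqP etag ne] := valP p.
  set k' : int := k - (m (val p).1)%:Z * eps + (m (val p).2)%:Z * eps.
  exists (var (val p).1 - var (val p).2 + cst a (k'%:~R * dd (tag (val p).1)))^-1.
  exists (oinv p k'); split.
  + have hs := shift_diff m k etag.
    have hk := tofrac_diff (val p).1 (val p).2 (k'%:~R * dd (tag (val p).1)).
    rewrite -hs; apply: svalV; last first.
      rewrite hs -/k' -hk tofrac_eq0; exact: diff_poly_neq0.
    apply: svalD; last exact: svalC.
    by apply: svalB; exact: svalX.
  + exact: osc_value_inv.
  + have [h1 _] := ow_inv p k; have [_ h2] := ow_inv p k'.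
    apply: umon_conj_inv _ h1 h2.
    apply: (umon_conj_diff sc_central U_ow).
    rewrite -etag /k' !rmorphD rmorphN !rmorphM /= -!pmulrn !mulrDl mulNr.
    by rewrite -!mulrA.
- exists (f1' + f2'), (y1 + y2); split; [exact: svalD | exact: osc_value_add|].
  exact: conj_add e1 e2.
- exists (f1' * f2'), (y1 * y2); split; [exact: svalM | exact: osc_value_mul|].
  exact: conj_mul e1 e2.
Qed.

End Shift.
End Localization.

(** * Shuffle products at string points *)

Section PermCount.
Variables (X Y : finType) (f : X -> Y).

Definition fiber_perm (s : {perm X}) : bool := [forall x, f (s x) == f x].

Lemma fiber_permP (s : {perm X}) : reflect (forall x, f (s x) = f x) (fiber_perm s).
Proof. by apply: (iffP forallP) => h x; apply/eqP. Qed.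

(** Restricting to permutations that move only the fibres over a list [r] makes an induction on [r]
    possible: each new fibre contributes its full symmetric group as an independent factor. *)
Let perm_within (r : seq Y) : {set {perm X}} :=
  [set s | fiber_perm s & [forall x, (f x \in r) || (s x == x)]].

Let perm_withinP (r : seq Y) (s : {perm X}) : reflect
  ((forall x, f (s x) = f x) /\ forall x, f x \notin r -> s x = x) (s \in perm_within r).
Proof.
rewrite inE; apply: (iffP andP) => [[/fiber_permP h1 /forallP h2]|[h1 h2]].
  by split=> // x nx; have := h2 x; rewrite (negbTE nx) => /eqP.
split; first exact/fiber_permP.
by apply/forallP => x; case: (boolP (f x \in r)) => //= /h2 ->.
Qed.

Let split_perm (s : {perm X}) (b : bool) : fiber_perm s -> forall y,
  injective (fun x => if (f x == y) == b then s x else x).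
Proof.
move=> /fiber_permP h y x x' /=.
case: ((f x == y) =P b) => e; case: ((f x' == y) =P b) => e' // exx'.
- exact: perm_inj exx'.
- by case: e'; rewrite -exx' h.
- by case: e; rewrite exx' h.
Qed.

Let card_perm_within r : uniq r ->
  #|perm_within r| = (\prod_(y <- r) #|[set x | f x == y]|`!)%N.
Proof.
elim: r => [_|y r IH /= /andP[yr ur]].
  rewrite big_nil; apply/eqP/cards1P; exists 1%g; apply/setP => s.
  rewrite in_set1; apply/perm_withinP/eqP => [[_ h]|->].
    by apply/permP => x; rewrite perm1 h.
  by split=> x; rewrite perm1.
rewrite big_cons -IH // -card_perm -(cardsE (perm_on _)).
pose A : {set {perm X}} := [set s in perm_on [set x | f x == y]].
have AP s : s \in A -> (forall x, f (s x) = f x) /\ (forall x, f x != y -> s x = x).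
  rewrite inE => hs; split=> x.
    have := perm_closed x hs; rewrite !inE; case: (f x =P y) => [->|/eqP ne] /eqP //.
    by move=> _; rewrite (out_perm hs) // inE.
  by move=> ne; rewrite (out_perm hs) // inE.
have -> : perm_within (y :: r) =
    [set (p.1 * p.2)%g | p in setX A (perm_within r)].
  apply/setP => s; apply/perm_withinP/imsetP => [[h1 h2]|[[s1 s2]]].
    have fs : fiber_perm s by apply/fiber_permP.
    pose s1 := perm (@split_perm s true fs y).
    pose s2 := perm (@split_perm s false fs y).
    exists (s1, s2); last first.
      apply/permP => x; rewrite permM /= !permE; case: (f x =P y) => e /=.
        by rewrite h1 e eqxx.
      by move/eqP/negbTE: e => ->.
    rewrite !inE /=; apply/andP; split.
      by apply/subsetP => x; rewrite !inE permE; case: (f x == y); rewrite ?eqxx.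
    apply/andP; split; first apply/fiber_permP => x.
      by rewrite permE; case: ifP.
    apply/forallP => x; rewrite permE; case: (f x =P y) => [|/eqP ne] /=.
      by rewrite eqxx orbT.
    case: (boolP (f x \in r)) => //= nx; apply/eqP/h2.
    by rewrite inE negb_or ne.
  rewrite inE /= => /andP[/AP[h1 h1'] /perm_withinP[h2 h2']] ->.
  split=> x; first by rewrite permM h2 h1.
  by rewrite inE negb_or => /andP[ne nr]; rewrite permM h1' // h2'.
rewrite card_in_imset ?cardsX // => -[s1 s2] [t1 t2].
rewrite !inE /= => /andP[h1 /andP[h2 h2']] /andP[h3 /andP[h4 h4']] e.
have {}h1 : s1 \in A by rewrite inE.
have {}h3 : t1 \in A by rewrite inE.
have {h2 h2'} : s2 \in perm_within r by rewrite inE h2.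
have {h4 h4'} : t2 \in perm_within r by rewrite inE h4.
move=> /perm_withinP[_ ht] /perm_withinP[_ hs].
have e1 : s1 = t1.
  apply/permP => x; case: (f x =P y) => [ex|/eqP nx]; last first.
    by rewrite (AP _ h1).2 // (AP _ h3).2.
  have := congr1 (fun t : {perm X} => t x) e; rewrite !permM.
  by rewrite hs ?ht // ((AP _ h1).1, (AP _ h3).1) ex.
by rewrite e1 in e *; rewrite (mulgI _ _ _ e).
Qed.

Lemma card_fiber_perm :
  #|[set s | fiber_perm s]| = (\prod_y #|[set x | f x == y]|`!)%N.
Proof.
rewrite -card_perm_within ?index_enum_uniq //; apply: eq_card => s.
rewrite [RHS]inE inE; case: (fiber_perm s) => //=; apply/esym/forallP => x.
by rewrite mem_index_enum.
Qed.

End PermCount.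

Section CosetSum.
Variables (X Y M : finType) (K : nmodType).
Variables (colour : X -> Y) (side : X -> bool) (W : {perm X} -> K).
Variables (P : pred M) (sigma : M -> {perm X}).

Definition side_image (s : {perm X}) : {set X} := s @: [set x | side x].

Hypothesis W_inv : forall h s, fiber_perm (fun x => (colour x, side x)) h ->
  fiber_perm colour s -> W (h * s)%g = W s.
Hypothesis sigma_col : forall m, P m -> fiber_perm colour (sigma m).
Hypothesis sigma_inj : forall m m', P m -> P m' ->
  side_image (sigma m) = side_image (sigma m') -> m = m'.
Hypothesis W_supp : forall s, fiber_perm colour s -> W s != 0 ->
  exists2 m, P m & side_image s = side_image (sigma m).

Let fiber_permM (Z : finType) (f : X -> Z) (s t : {perm X}) :
  fiber_perm f s -> fiber_perm f t -> fiber_perm f (s * t)%g.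
Proof.
move=> /fiber_permP h1 /fiber_permP h2; apply/fiber_permP => x.
by rewrite permM h2 h1.
Qed.

Let fiber_permV (Z : finType) (f : X -> Z) (s : {perm X}) : fiber_perm f s -> fiber_perm f s^-1%g.
Proof. by move=> /fiber_permP h; apply/fiber_permP => x; rewrite -{2}(permKV s x) h. Qed.

(** Let H be the group of permutations preserving colour and side. As (h * s) x = s (h x),
    [side_image s] depends only on the coset H s, and it determines this coset among
    colour-preserving permutations. [W] is constant on cosets and vanishes on those without a
    representative [sigma m]; each remaining coset counts |H| times. *)
Lemma coset_sum : \sum_(s | fiber_perm colour s) W s =
  \sum_(m | P m) W (sigma m) *+ #|[set h | fiber_perm (fun x => (colour x, side x)) h]|.
Proof.
have hs s : fiber_perm colour s ->
    W s = \sum_(m | P m && (side_image s == side_image (sigma m))) W s.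
  move=> cs; case: (W s =P 0) => [->|/eqP nz]; first by rewrite big1.
  have [m Pm em] := W_supp cs nz; rewrite (big_pred1 m) // => m' /=.
  apply/andP/eqP => [[Pm' /eqP em']|->]; last by rewrite Pm em.
  by apply: sigma_inj; rewrite -?em.
rewrite (eq_bigr _ hs) (exchange_big_dep P) //=; last by move=> s m _ /andP[].
apply: eq_bigr => m Pm; rewrite -sumr_const.
rewrite (reindex_inj (mulIg (sigma m))) /=.
have key h : fiber_perm colour (h * sigma m)%g &&
      (P m && (side_image (h * sigma m)%g == side_image (sigma m))) =
    (h \in [set h | fiber_perm (fun x => (colour x, side x)) h]).
  rewrite inE Pm /=; apply/andP/idP => [[hc /eqP hi]|hh].
    have ch : fiber_perm colour h.
      by rewrite -[h](mulgK (sigma m)); apply: fiber_permM => //; apply/fiber_permV/sigma_col.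
    apply/fiber_permP => x; congr (_, _); first by move/fiber_permP: ch.
    have : (sigma m (h x) \in side_image (h * sigma m)%g) =
           (sigma m (h x) \in side_image (sigma m)) by rewrite hi.
    have {1}-> : sigma m (h x) = (h * sigma m)%g x by rewrite permM.
    by rewrite !mem_imset ?inE //; exact: perm_inj.
  have /fiber_permP hh' := hh.
  split.
    apply: fiber_permM; last exact: sigma_col.
    by apply/fiber_permP => x; case: (hh' x).
  apply/eqP/setP => x; rewrite -[x](permKV (sigma m)).
  set z := ((sigma m)^-1%g : {perm X}) x; rewrite [RHS]mem_imset ?inE; last exact: perm_inj.
  rewrite -[z in LHS](permKV h) -permM mem_imset ?inE; last exact: perm_inj.
  by have := hh' ((h^-1%g : {perm X}) z); rewrite permKV => -[].
rewrite (eq_bigl _ _ key); apply: eq_bigr => h; rewrite inE => hh.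
by apply: W_inv => //; exact: sigma_col.
Qed.

End CosetSum.

(** Turns a downward closed set of positions in a string into the length of an initial segment. *)
Lemma downset_ord N (A : {set 'I_N}) :
  (forall p q : 'I_N, (p <= q)%N -> q \in A -> p \in A) ->
  forall p : 'I_N, (p \in A) = (p < #|A|)%N.
Proof.
have card_lt q : (q <= N)%N -> #|[set p : 'I_N | (p < q)%N]| = q.
  move=> le.
  have -> : [set p : 'I_N | (p < q)%N] = widen_ord le @: [set: 'I_q].
    apply/setP => p; rewrite inE; apply/idP/imsetP => [lt|[t _ ->]].
      by exists (Ordinal lt) => //; apply: val_inj.
    by rewrite /= ltn_ord.
  rewrite card_imset ?cardsT ?card_ord // => s t /(congr1 val) /= e.
  exact: val_inj.
move=> hA p; apply/idP/idP => [pA|]; last apply: contraLR => npA.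
  rewrite -{1}(card_lt p.+1 (ltn_ord p)); apply/subset_leq_card/subsetP => q.
  by rewrite inE /= ltnS => /hA; apply.
rewrite -leqNgt -(card_lt p (ltnW (ltn_ord p))).
apply/subset_leq_card/subsetP => q qA; rewrite inE /= ltnNge.
by apply: contra npA => /hA; apply.
Qed.

(** * Tuples of string points *)

Section Points.
Variables (C : numFieldType) (g : simple_datum C) (a : mdegree g).
Local Notation V := (box a).
Local Notation K := (rfun a).

Definition boxes (m : V -> nat) : finType := {v : V & 'I_(m v)}.

(** The listing of [points], for an occupation with arbitrary natural values: it is applied as well
    to what remains of an occupation and to the later parts of strings. *)
Definition pointsf (pt : V -> nat -> K) (k : mdegree g) (m : V -> nat)
    (u : box k) : K :=
  nth 0 (flatten [seq [seq pt v p | p <- iota 1 (m v)]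
                 | v <- enum {: box a} & tag v == tag u]) (tagged u).

(** Positions in a box set start at 0, the points of a string at p = 1. *)
Definition ptq (pt : V -> nat -> K) m (q : boxes m) : K :=
  pt (tag q) (tagged q).+1.

Definition colour_seq m i : seq (boxes m) :=
  flatten [seq [seq Tagged (fun v => 'I_(m v)) p | p <- enum 'I_(m v)]
          | v <- enum {: box a} & tag v == i].

Lemma mem_colour_seq m i (q : boxes m) : (q \in colour_seq m i) = (tag (tag q) == i).
Proof.
apply/flatten_mapP/idP => [[v]|h].
  by rewrite mem_filter => /andP[h _] /mapP[p _ ->].
case: q h => v p /= h; exists v; first by rewrite mem_filter h mem_enum.
by apply/mapP; exists p; rewrite ?mem_enum.
Qed.

Lemma size_colour_seq m i : size (colour_seq m i) = (\sum_(v | tag v == i) m v)%N.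
Proof.
rewrite size_flatten /shape -map_comp sumnE big_map big_filter big_enum_cond /=.
by apply: eq_bigr => v _; rewrite size_map size_enum_ord.
Qed.

Lemma uniq_colour_seq m i : uniq (colour_seq m i).
Proof.
rewrite /colour_seq; have : uniq [seq v <- enum {: box a} | tag v == i].
  by rewrite filter_uniq ?enum_uniq.
elim: [seq v <- _ | _] => //= v s IH /andP[vs us]; rewrite cat_uniq IH // andbT.
apply/andP; split.
  rewrite map_inj_uniq ?enum_uniq // => p p' /eqP; rewrite eq_Tagged => /eqP //.
apply/hasPn => q /flatten_mapP[v' v's /mapP[p' _ ->]].
by apply/negP => /mapP[p _ [e _]]; rewrite -e v's in vs.
Qed.

Lemma map_colour_seq (pt : V -> nat -> K) m i :
  [seq ptq pt q | q <- colour_seq m i] =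
  flatten [seq [seq pt v p | p <- iota 1 (m v)] | v <- enum {: box a} & tag v == i].
Proof.
rewrite map_flatten -map_comp; congr flatten; apply: eq_map => v /=.
have -> : iota 1 (m v) = map (addn 1) (iota 0 (m v)) by rewrite -iotaDl.
by rewrite -val_enum_ord -!map_comp; apply: eq_map.
Qed.

(** The bijection replaces variables by pairs of a string and a position, after which the order of
    the listing no longer matters. It is independent of [pt], so one bijection serves several
    families of points. *)
Lemma points_enum m (k : mdegree g) :
  (forall i, k i = (\sum_(v | tag v == i) m v)%N) ->
  exists (f : box k -> boxes m) (f' : boxes m -> box k),
  [/\ cancel f f', cancel f' f, forall u, tag (tag (f u)) = tag u &
      forall pt u, pointsf pt m u = ptq pt (f u)].
Proof.
move=> hk.
have ex (u : box k) : exists q : boxes m,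
    q \in colour_seq m (tag u) /\ index q (colour_seq m (tag u)) = tagged u :> nat.
  have lt : (tagged u < size (colour_seq m (tag u)))%N.
    by rewrite size_colour_seq -hk.
  case e : (colour_seq m (tag u)) => [|q0 s]; first by rewrite e in lt.
  rewrite -e; exists (nth q0 (colour_seq m (tag u)) (tagged u)).
  by split; [rewrite mem_nth | rewrite index_uniq ?uniq_colour_seq].
have [f hf] := fin_all_exists ex.
have lt q : (index q (colour_seq m (tag (tag q))) < k (tag (tag q)))%N.
  by rewrite hk -size_colour_seq index_mem mem_colour_seq.
pose f' (q : boxes m) : box k := Tagged (fun i => 'I_(k i)) (Ordinal (lt q)).
have tf u : tag (tag (f u)) = tag u.
  by have [] := hf u; rewrite mem_colour_seq => /eqP.
exists f, f'; split => //.
- move=> u; have [_] := hf u; have := tf u.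
  rewrite /f'; move: (lt (f u)); case: u => i j /= l e; move: l; rewrite e => l h.
  by congr (existT _ i _); apply: val_inj.
- move=> q; have [h1 h2] := hf (f' q).
  rewrite [tagged _]/= in h2.
  have h3 : q \in colour_seq m (tag (tag q)) by rewrite mem_colour_seq.
  by rewrite -(nth_index q h1) h2 /= nth_index.
move=> pt u; have [h1 h2] := hf u.
rewrite /pointsf -map_colour_seq (nth_map (f u)).
  by rewrite -h2 nth_index.
by rewrite size_colour_seq -hk.
Qed.

End Points.

(** * Symmetrisation at a tuple of distinct points *)

Section StarEvaluation.
Variables (C : numFieldType) (g : simple_datum C).
Local Notation I := 'I_(rk g).
Local Notation mdegree := (@mdegree C g).
Local Notation rfun := (@rfun C g).
Local Notation rpoly := (@rpoly C g).

(* The factor zeta_ij for eps = 1; for eps = -1 it is zeta_ij(-z), which turns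
   the shuffle product into the opposite one. *)
Definition zeps (eps : int) (n : mdegree) (i j : I) (z : rfun n) : rfun n :=
  1 + cst n (eps%:~R * rform i j) / (2 * z).

Lemma sval_zeps eps (n k : mdegree) (z : box n -> rfun k) i j F y :
  sval z F y -> y != 0 -> sval z (zeps eps i j F) (zeps eps i j y).
Proof.
move=> h nz; apply: svalD; first exact: sval1.
apply: svalM; first exact: svalC.
have e (m : mdegree) : (2 : rfun m) = cst m 2 by rewrite rmorph_nat.
apply: svalV; first by rewrite !e; apply: svalM => //; exact: svalC.
have n2 : (2 : rfun k) != 0 by rewrite e cst_eq0 pnatr_eq0.
exact: mulf_neq0 n2 nz.
Qed.

Lemma colour_generic_sub (k n : mdegree) (y : box k -> rfun n) u u' :
  injective y -> u != u' -> y u - y u' != 0.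
Proof. by move=> iy; apply: contraNneq => /subr0_eq /iy ->. Qed.

Lemma sval_shuffle (k n : mdegree) (y : box k -> rfun n) (f : rpoly k) :
  injective y -> sval y (tofrac f / pole_denominator k)
    (psub y f / \prod_(v : box k) \prod_(v' : box k |
       (tag v < tag v')%N && linked (tag v) (tag v')) (y v - y v')).
Proof.
move=> iy; apply: svalM; first exact: sval_poly.
apply: svalV.
  apply: sval_prod => v _; apply: sval_prod => v' _.
  by apply: svalB; exact: svalX.
apply/prodf_neq0 => v _; apply/prodf_neq0 => v' /andP[lt _].
by apply: colour_generic_sub => //; apply: contraTneq lt => ->; rewrite ltnn.
Qed.

(** The poles of a shuffle element lie along x_u = x_u', so every tuple of distinct points belongs
    to its domain. *)
Lemma reg_shuffle (k n : mdegree) (y : box k -> rfun n) (E : rfun k) :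
  in_shuffle_deg E -> injective y -> reg y E.
Proof. by move=> [_ [f [-> _ _]]] iy; eexists; exact: sval_shuffle. Qed.

Lemma rsubst_ext (k n : mdegree) (F : rfun k) (x y : box k -> rfun n) :
  x =1 y -> rsubst F x = rsubst F y.
Proof. by move=> /funext ->. Qed.

Lemma symmetric_rsubst (k n : mdegree) (y : box k -> rfun n) (E : rfun k)
    (s : {perm box k}) :
  symmetric_rfun E -> colour_perm s -> reg (fun u => y (s u)) E ->
  rsubst E (fun u => y (s u)) = rsubst E y.
Proof.
move=> sE cs /reg_sval h.
have [_] := sval_comp (y := fun u => var (s u)) (z := y) (fun u => svalX y (s u)) h.
by rewrite (sE s cs) => h'; apply/esym; exact: svalP h'.
Qed.

Section Embeddings.
Variables (n k l : mdegree) (lam : box k -> box n) (rho : box l -> box n).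
Hypothesis lam_tag : forall u, tag (lam u) = tag u.
Hypothesis rho_tag : forall u, tag (rho u) = tag u.
Hypothesis lam_inj : injective lam.
Hypothesis rho_inj : injective rho.
Hypothesis lam_rho : forall u u', lam u <> rho u'.
Hypothesis cover : forall x, (exists u, x = lam u) \/ (exists u', x = rho u').
Variables (eps : int) (E : rfun k) (F : rfun l).
Hypotheses (hE : in_shuffle_deg E) (hF : in_shuffle_deg F).

(** The symmetrised term of the shuffle product, with the variables of [E] and [F] placed by
    arbitrary complementary embeddings: in the opposite product the first factor occupies the last
    variables, so both products are instances. *)
Definition embed_term : rfun n :=
  rsubst E (fun u => var (lam u)) * rsubst F (fun u => var (rho u)) *
  \prod_(u : box k) \prod_(u' : box l)
     zeps eps (tag u) (tag u') (var (lam u) - var (rho u')).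

Variables (a : mdegree) (y : box n -> rfun a).
Hypothesis y_inj : injective y.

Definition embed_value (s : {perm box n}) : rfun a :=
  rsubst E (fun u => y (s (lam u))) * rsubst F (fun u => y (s (rho u))) *
  \prod_(u : box k) \prod_(u' : box l)
     zeps eps (tag u) (tag u') (y (s (lam u)) - y (s (rho u'))).

Lemma sval_embed_term (s : {perm box n}) :
  sval y (rsubst embed_term (fun v => var (s v))) (embed_value s).
Proof.
have iys : injective (fun v => y (s v)) by move=> v v' /y_inj /perm_inj.
apply: (sval_comp (y := fun v => var (s v)) (t := fun v => y (s v)) _ _).2.
  by move=> v; exact: svalX.
apply: svalM; first apply: svalM.
- apply: (sval_comp (y := fun v => var (lam v)) (t := fun v => y (s (lam v))) _ _).2.
    by move=> v; exact: (svalX (fun v => y (s v))).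
  by apply/reg_sval/reg_shuffle => // v v' /iys /lam_inj.
- apply: (sval_comp (y := fun v => var (rho v)) (t := fun v => y (s (rho v))) _ _).2.
    by move=> v; exact: (svalX (fun v => y (s v))).
  by apply/reg_sval/reg_shuffle => // v v' /iys /rho_inj.
- apply: sval_prod => u _; apply: sval_prod => u' _; apply: sval_zeps.
    by apply: svalB; exact: (svalX (fun v => y (s v))).
  by apply: (colour_generic_sub iys); apply/eqP; exact: lam_rho.
Qed.

Lemma sval_Sym_embed_term :
  sval y (Defs.Sym embed_term) (\sum_(s | fiber_perm (fun v : box n => tag v) s) embed_value s).
Proof. by apply: sval_sum => s _; exact: sval_embed_term. Qed.

Definition in_lam (x : box n) : bool := x \in codom lam.

Lemma in_lamP x : reflect (exists u, x = lam u) (in_lam x).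
Proof. by apply: (iffP codomP) => -[u ->]; exists u. Qed.

Lemma in_lam_lam u : in_lam (lam u).
Proof. by apply/in_lamP; exists u. Qed.

Lemma in_lam_rho u : in_lam (rho u) = false.
Proof. by apply/in_lamP => -[u' e]; apply: (lam_rho (u := u') (u' := u)). Qed.

Lemma embed_value_inv (h s : {perm box n}) :
  fiber_perm (fun x => (tag x, in_lam x)) h -> fiber_perm (fun v => tag v) s ->
  embed_value (h * s)%g = embed_value s.
Proof.
move=> /fiber_permP hh _.
(* [h] preserves the images of [lam] and [rho], so it induces colour-preserving permutations of the
   arguments of [E] and of those of [F]; the symmetry of [E] and [F] absorbs them. *)
have ex1 (u : box k) : exists u1, h (lam u) = lam u1.
  by have [_ e] := hh (lam u); rewrite in_lam_lam in e; apply/in_lamP.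
have [h1 hh1] := fin_all_exists ex1.
have ex2 (u : box l) : exists u1, h (rho u) = rho u1.
  have [_ e] := hh (rho u).
  rewrite in_lam_rho in e; case: (cover (h (rho u))) => // -[u' e'].
  by rewrite e' in_lam_lam in e.
have [h2 hh2] := fin_all_exists ex2.
have i1 : injective h1.
  by move=> u u' e; apply/lam_inj/(@perm_inj _ h); rewrite !hh1 e.
have i2 : injective h2.
  by move=> u u' e; apply/rho_inj/(@perm_inj _ h); rewrite !hh2 e.
have t1 u : tag (h1 u) = tag u.
  by have [e _] := hh (lam u); rewrite -lam_tag -hh1 e lam_tag.
have t2 u : tag (h2 u) = tag u.
  by have [e _] := hh (rho u); rewrite -rho_tag -hh2 e rho_tag.
have c1 : colour_perm (perm i1) by apply/forallP => u; rewrite permE t1.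
have c2 : colour_perm (perm i2) by apply/forallP => u; rewrite permE t2.
have iys : injective (fun v => y (s v)) by move=> v v' /y_inj /perm_inj.
have e1 u : (h * s)%g (lam u) = s (lam (perm i1 u)) by rewrite permM hh1 permE.
have e2 u : (h * s)%g (rho u) = s (rho (perm i2 u)) by rewrite permM hh2 permE.
have v1 : rsubst E (fun u => y ((h * s)%g (lam u))) = rsubst E (fun u => y (s (lam u))).
  transitivity (rsubst E (fun u => y (s (lam (perm i1 u))))).
    by apply: rsubst_ext => u; exact: congr1 (e1 u).
  apply: (symmetric_rsubst (y := fun u => y (s (lam u))) hE.1 c1).
  by apply: (reg_shuffle hE) => u u' /iys /lam_inj /perm_inj.
have v2 : rsubst F (fun u => y ((h * s)%g (rho u))) = rsubst F (fun u => y (s (rho u))).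
  transitivity (rsubst F (fun u => y (s (rho (perm i2 u))))).
    by apply: rsubst_ext => u; exact: congr1 (e2 u).
  apply: (symmetric_rsubst (y := fun u => y (s (rho u))) hF.1 c2).
  by apply: (reg_shuffle hF) => u u' /iys /rho_inj /perm_inj.
pose Z (u u' : box n) : rfun a := zeps eps (tag u) (tag u') (y (s u) - y (s u')).
have v3 : \prod_(u : box k) \prod_(u' : box l)
     zeps eps (tag u) (tag u') (y ((h * s)%g (lam u)) - y ((h * s)%g (rho u'))) =
   \prod_(u : box k) \prod_(u' : box l)
     zeps eps (tag u) (tag u') (y (s (lam u)) - y (s (rho u'))).
  transitivity (\prod_(u : box k) \prod_(u' : box l) Z (lam u) (rho u')); last first.
    apply: eq_bigr => u _; apply: eq_bigr => u' _.
    by rewrite /Z lam_tag rho_tag.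
  rewrite [RHS](reindex_inj (@perm_inj _ (perm i1))) /=; apply: eq_bigr => u _.
  rewrite [RHS](reindex_inj (@perm_inj _ (perm i2))) /=; apply: eq_bigr => u' _.
  by rewrite /Z -e1 -e2 lam_tag rho_tag !permE t1 t2.
by rewrite /embed_value v1 v2 v3.
Qed.

Lemma card_lam_colour i : #|[set x | (tag x == i) && in_lam x]| = k i.
Proof.
have inj : injective (fun s : 'I_(k i) => lam (Tagged (fun i => 'I_(k i)) s)).
  by move=> s s' /lam_inj /eqP; rewrite eq_Tagged => /eqP.
rewrite -[RHS]card_ord -(card_imset _ inj); apply: eq_card => x.
rewrite inE; apply/andP/imsetP => [[/eqP e /in_lamP[u ex]]|[s _ ->]].
  rewrite {x}ex lam_tag in e *; case: u e => j s /= e; case: i / e inj => _.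
  by exists s.
by rewrite lam_tag in_lam_lam.
Qed.

Lemma card_rho_colour i : #|[set x | (tag x == i) && ~~ in_lam x]| = l i.
Proof.
have inj : injective (fun s : 'I_(l i) => rho (Tagged (fun i => 'I_(l i)) s)).
  by move=> s s' /rho_inj /eqP; rewrite eq_Tagged => /eqP.
rewrite -[RHS]card_ord -(card_imset _ inj); apply: eq_card => x.
rewrite inE; apply/andP/imsetP => [[/eqP e nx]|[s _ ->]].
  case: (cover x) => -[u ex]; first by rewrite ex in_lam_lam in nx.
  rewrite {x nx}ex rho_tag in e *; case: u e => j s /= e; case: i / e inj => _.
  by exists s.
by rewrite rho_tag in_lam_rho.
Qed.

(** This order is the normalising denominator of the star product, against which the multiplicity of
    each coset cancels. *)
Lemma card_embed_stab : #|[set h : {perm box n} | fiber_perm (fun x => (tag x, in_lam x)) h]| =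
  (\prod_i ((k i)`! * (l i)`!))%N.
Proof.
rewrite card_fiber_perm -(pair_bigA _ (fun i b => #|[set x | (tag x, in_lam x) == (i, b)]|`!)%N) /=.
apply: eq_bigr => i _; rewrite big_bool /= -card_lam_colour -card_rho_colour.
by congr (_`! * _`!)%N; apply: eq_card => x; rewrite !inE xpair_eqE ?eqb_id ?eqbF_neg.
Qed.

End Embeddings.
End StarEvaluation.

Section StringEvaluation.
Variables (C : numFieldType) (g : simple_datum C) (a : mdegree g).
Local Notation V := (box a).
Local Notation K := (rfun a).
Variables (eps : int) (pt : V -> nat -> K).
Hypothesis pt_inj : forall v v' p p', pt v p = pt v' p' -> v = v' /\ p = p'.
Hypothesis pt_zeps : forall v p, zeps eps (tag v) (tag v) (pt v p.+1 - pt v p) = 0.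

Definition of_colour (m : V -> nat) i := (\sum_(v | tag v == i) m v)%N.

Variables (n k l : mdegree g) (lam : box k -> box n) (rho : box l -> box n).
Hypothesis lam_tag : forall u, tag (lam u) = tag u.
Hypothesis rho_tag : forall u, tag (rho u) = tag u.
Hypothesis lam_inj : injective lam.
Hypothesis rho_inj : injective rho.
Hypothesis lam_rho : forall u u', lam u <> rho u'.
Hypothesis cover : forall x, (exists u, x = lam u) \/ (exists u', x = rho u').
Hypothesis n_kl : forall i, n i = (k i + l i)%N.
Variables (E : rfun k) (F : rfun l).
Hypotheses (hE : in_shuffle_deg E) (hF : in_shuffle_deg F).
Variable nn : V -> nat.
Hypothesis n_nn : forall i, n i = of_colour nn i.

Definition pt_after (m : V -> nat) v p : K := pt v (m v + p).
Definition rest (m : V -> nat) v : nat := nn v - m v.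

(** The value of a summand whose permutation gives [E] the first m_v points of every string v and
    [F] the remaining ones; [string_perm] produces such a permutation. *)
Definition string_value (m : V -> nat) : K :=
  rsubst E (pointsf pt m) * rsubst F (pointsf (pt_after m) (rest m)) *
  \prod_(q : boxes m) \prod_(q' : boxes (rest m))
    zeps eps (tag (tag q)) (tag (tag q')) (ptq pt q - ptq (pt_after m) q').

Lemma boxes_eq (m : V -> nat) (q q' : boxes m) :
  tag q = tag q' -> tagged q = tagged q' :> nat -> q = q'.
Proof.
case: q q' => v p [v' p'] /= e; case: v' / e p' => p' e.
by congr existT; exact: val_inj.
Qed.

Variables (io : box n -> boxes nn) (io' : boxes nn -> box n).
Hypotheses (ioK : cancel io io') (io'K : cancel io' io).
Hypothesis io_tag : forall u, tag (tag (io u)) = tag u.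
Hypothesis io_pt : forall u, pointsf pt nn u = ptq pt (io u).
Local Notation y := (pointsf pt nn : box n -> K).

Lemma points_inj : injective y.
Proof.
move=> u u'; rewrite !io_pt => /pt_inj[e [e']]; apply: (can_inj ioK).
exact: boxes_eq.
Qed.

Definition initial (m : V -> nat) (x : box n) : bool :=
  (tagged (io x) < m (tag (io x)))%N.

Lemma string_perm (m : V -> nat) :
  (forall v, (m v <= nn v)%N) -> (forall i, of_colour m i = k i) ->
  exists s : {perm box n},
  [/\ fiber_perm (fun v => tag v) s, side_image (in_lam lam) s = [set x | initial m x]
    & embed_value lam rho eps E F y s = string_value m].
Proof.
move=> le_m mk.
have mk' i : k i = of_colour m i by rewrite mk.
have rl i : l i = of_colour (rest m) i.
  apply: (@addnI (k i)); rewrite -n_kl n_nn mk' -big_split /=.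
  by apply: eq_bigr => v _; rewrite /rest subnKC.
have [f [f' [fK f'K ft fp]]] := points_enum mk'.
have [h [h' [hK h'K ht hp]]] := points_enum rl.
have lt1 u : (tagged (f u) < nn (tag (f u)))%N.
  exact: leq_trans (ltn_ord _) (le_m _).
have lt2 u : (m (tag (h u)) + tagged (h u) < nn (tag (h u)))%N.
  by rewrite -ltn_subRL ltn_ord.
pose th1 u : boxes nn := Tagged (fun v => 'I_(nn v)) (Ordinal (lt1 u)).
pose th2 u : boxes nn := Tagged (fun v => 'I_(nn v)) (Ordinal (lt2 u)).
have ex (x : box n) : exists q, (forall u, x = lam u -> q = th1 u) /\
                     (forall u, x = rho u -> q = th2 u).
  case: (cover x) => -[u ->].
    exists (th1 u); split=> [u' /lam_inj -> //|u' /lam_rho //].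
  exists (th2 u); split=> [u' /esym /lam_rho //|u' /rho_inj -> //].
have [th hth] := fin_all_exists ex.
have thl u : th (lam u) = th1 u by have [h1 _] := hth (lam u); apply: h1.
have thr u : th (rho u) = th2 u by have [_ h1] := hth (rho u); apply: h1.
have th12 u u' : th1 u <> th2 u'.
  move=> e; have /= e1 := congr1 tag e.
  have /= e2 := congr1 (fun q : boxes nn => nat_of_ord (tagged q)) e.
  have em : m (tag (f u)) = m (tag (h u')) by rewrite e1.
  by have := ltn_ord (tagged (f u)); rewrite {1}e2 em ltnNge leq_addr.
have th_inj : injective th.
  move=> x x'; case: (cover x) => -[u ->]; case: (cover x') => -[u' ->].
  - rewrite !thl => e; congr lam; apply: (can_inj fK); apply: boxes_eq.
      have h0 : tag (th1 u) = tag (th1 u') by rewrite e.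
      exact: h0.
    have h0 : tagged (th1 u) = tagged (th1 u') :> nat by rewrite e.
    exact: h0.
  - by rewrite thl thr => /th12.
  - by rewrite thl thr => /esym /th12.
  - rewrite !thr => e; congr rho; apply: (can_inj hK).
    have h0 : tag (th2 u) = tag (th2 u') by rewrite e.
    have e1 : tag (h u) = tag (h u') := h0.
    apply: boxes_eq => //.
    have : tagged (th2 u) = tagged (th2 u') :> nat by rewrite e.
    have em : m (tag (h u)) = m (tag (h u')) by rewrite e1.
    by rewrite /= em => /addnI.
have s_inj : injective (fun x => io' (th x)).
  by move=> x x' /(can_inj io'K) /th_inj.
exists (perm s_inj); split.
- apply/fiber_permP => x; rewrite permE -io_tag io'K.
  by case: (cover x) => -[u ->]; rewrite ?thl ?thr /= ?ft ?ht ?lam_tag ?rho_tag.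
- apply/setP => x; rewrite inE.
  have [z ->] : exists z, x = io' (th z).
    exists ((perm s_inj)^-1%g x); by rewrite -[RHS](permE s_inj) permKV.
  rewrite -[in LHS](permE s_inj) mem_imset; last exact: perm_inj.
  rewrite inE /initial io'K; case: (cover z) => -[u ->].
    by rewrite in_lam_lam thl /= ltn_ord.
  by rewrite (in_lam_rho lam_rho) thr /= ltnNge leq_addr.
- have yl u : y (perm s_inj (lam u)) = pointsf pt m u.
    by rewrite permE io_pt io'K thl fp.
  have yr u : y (perm s_inj (rho u)) = pointsf (pt_after m) (rest m) u.
    by rewrite permE io_pt io'K thr hp /ptq /pt_after /= addnS.
  have -> : embed_value lam rho eps E F y (perm s_inj) =
    rsubst E (pointsf pt m) * rsubst F (pointsf (pt_after m) (rest m)) *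
    \prod_(u : box k) \prod_(u' : box l) zeps eps (tag u) (tag u')
      (pointsf pt m u - pointsf (pt_after m) (rest m) u').
    rewrite /embed_value (rsubst_ext E yl) (rsubst_ext F yr); congr (_ * _).
    by apply: eq_bigr => u _; apply: eq_bigr => u' _; rewrite yl yr.
  rewrite /string_value; congr (_ * _).
  rewrite [RHS](reindex f) /=; last by exists f'; [move=> ? _|move=> ? _].
  apply: eq_bigr => u _; rewrite [RHS](reindex h) /=; last first.
    by exists h'; [move=> ? _|move=> ? _].
  by apply: eq_bigr => u' _; rewrite ft ht fp hp.
Qed.

Lemma string_support (s : {perm box n}) :
  fiber_perm (fun v => tag v) s -> embed_value lam rho eps E F y s != 0 ->
  exists m : V -> nat, [/\ forall v, (m v <= nn v)%N, forall i, of_colour m i = k i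
    & side_image (in_lam lam) s = [set x | initial m x]].
Proof.
move=> /fiber_permP cs nz.
pose A v : {set 'I_(nn v)} :=
  [set p | io' (Tagged (fun v => 'I_(nn v)) p) \in side_image (in_lam lam) s].
have down1 v (p q : 'I_(nn v)) : q = p.+1 :> nat -> q \in A v -> p \in A v.
  move=> e; rewrite !inE => /imsetP[x]; rewrite inE => /in_lamP[u ->] eu.
  apply: contraT => np; set z := io' _ in np.
  have [u' eu'] : exists u', z = s (rho u').
    have zs : z = s ((s^-1)%g z) by rewrite permKV.
    case: (cover ((s^-1)%g z)) => -[u' eu']; last by exists u'; rewrite -eu'.
    by rewrite zs eu' mem_imset ?inE ?in_lam_lam // in np; exact: perm_inj.
  (* [E] has the point at position [q] and [F] its predecessor; the zeta factor of this pair is the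
     one that [pt_zeps] kills. *)
  case/eqP: nz; rewrite /embed_value (bigD1 u) //= (bigD1 u') //=.
  have tu : tag u = tag v by rewrite -lam_tag -cs -eu -io_tag io'K.
  have tu' : tag u' = tag v by rewrite -rho_tag -cs -eu' /z -io_tag io'K.
  have y1 : y (s (lam u)) = pt v p.+2 by rewrite -eu io_pt io'K /ptq /= e.
  have y2 : y (s (rho u')) = pt v p.+1 by rewrite -eu' io_pt io'K.
  rewrite y1 y2 tu tu' pt_zeps.
  by rewrite !mul0r mulr0.
have down v (p q : 'I_(nn v)) : (p <= q)%N -> q \in A v -> p \in A v.
  move=> le; move: {2}(q - p)%N (erefl (q - p)%N) => j.
  elim: j q le => [|j IH] q le e.
    suff -> : p = q by [].
    by apply/val_inj/eqP; rewrite /= eqn_leq le /= -subn_eq0 e.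
  have lt : (q.-1 < nn v)%N by apply: leq_ltn_trans (leq_pred _) (ltn_ord q).
  have q0 : (0 < q)%N by case: (nat_of_ord q) e => //; rewrite sub0n.
  move=> qA; apply: (IH (Ordinal lt)).
  - by rewrite /= -ltnS prednK // -subn_gt0 e.
  - by rewrite /= -subn1 subnAC e subn1.
  - by apply: down1 qA; rewrite /= prednK.
exists (fun v => #|A v|); split.
- by move=> v; rewrite -[X in (_ <= X)%N]card_ord; exact: max_card.
- move=> i; rewrite -(card_lam_colour lam_tag lam_inj) /of_colour.
  under eq_bigr do rewrite -sum1_card.
  rewrite (sig_big_dep _ (fun v p => p \in A v) (fun _ _ => 1%N)) /=.
  rewrite (reindex io) /=; last by exists io'; [move=> ? _|move=> ? _].
  rewrite (reindex_inj (@perm_inj _ s)) /= -sum1_card; apply: eq_bigl => x.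
  rewrite !inE io_tag cs; congr (_ && _).
  have -> : Tagged (fun v => 'I_(nn v)) (tagged (io (s x))) = io (s x) by case: (io (s x)).
  by rewrite ioK mem_imset ?inE //; exact: perm_inj.
- apply/setP => x; rewrite [RHS]inE /initial -downset_ord; last exact: down.
  rewrite inE.
  have -> : Tagged (fun v => 'I_(nn v)) (tagged (io x)) = io x by case: (io x).
  by rewrite ioK.
Qed.

End StringEvaluation.

Section StarAtPoints.
Variables (C : numFieldType) (g : simple_datum C).
Local Notation mdegree := (@mdegree C g).

Lemma xvarE (n : mdegree) i (s : 'I_(n i)) :
  xvar n i s = var (Tagged (fun i => 'I_(n i)) s).
Proof. by rewrite /xvar valK. Qed.

Lemma split_embeddings (n k l : mdegree) : (forall i, n i = (k i + l i)%N) ->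
  exists (lam : box k -> box n) (rho : box l -> box n),
  [/\ [/\ forall u, tag (lam u) = tag u, forall u, tag (rho u) = tag u,
          injective lam & injective rho],
      forall u u', lam u <> rho u',
      forall x, (exists u, x = lam u) \/ (exists u', x = rho u'),
      forall u : box k, xvar n (tag u) (tagged u) = var (lam u) &
      forall u : box l, xvar n (tag u) (k (tag u) + tagged u) = var (rho u)].
Proof.
move=> nkl.
have lt1 (u : box k) : (tagged u < n (tag u))%N.
  by rewrite nkl; apply: leq_trans (ltn_ord _) (leq_addr _ _).
have lt2 (u : box l) : (k (tag u) + tagged u < n (tag u))%N.
  by rewrite nkl ltn_add2l.
exists (fun u => Tagged (fun i => 'I_(n i)) (Ordinal (lt1 u))).
exists (fun u => Tagged (fun i => 'I_(n i)) (Ordinal (lt2 u))).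
split; first split => //.
- move=> [i s] [j t] e; have /= eij := congr1 tag e; case: j / eij t e => t.
  by move=> /eqP; rewrite eq_Tagged => /eqP /(congr1 val) /= /val_inj ->.
- move=> [i s] [j t] e; have /= eij := congr1 tag e; case: j / eij t e => t.
  by move=> /eqP; rewrite eq_Tagged => /eqP /(congr1 val) /= /addnI /val_inj ->.
- move=> [i s] [j t] e; have /= eij := congr1 tag e; case: j / eij t e => t.
  move=> /eqP; rewrite eq_Tagged => /eqP /(congr1 val) /= es.
  by have := ltn_ord s; rewrite es ltnNge leq_addr.
- move=> [i s]; have [lt|ge] := ltnP s (k i).
    left; exists (Tagged (fun i => 'I_(k i)) (Ordinal lt)).
    by congr existT; exact: val_inj.
  have lt : (s - k i < l i)%N by rewrite ltn_subLR // -nkl.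
  right; exists (Tagged (fun i => 'I_(l i)) (Ordinal lt)).
  by congr existT; apply: val_inj; rewrite /= subnKC.
- by move=> u; rewrite -xvarE.
- by move=> u; rewrite -xvarE.
Qed.

Lemma zeps1 (n : mdegree) i j (z : rfun n) : zeps 1 i j z = zeta i j z.
Proof. by rewrite /zeps mulr1z mul1r. Qed.

Lemma rform_sym (i j : 'I_(rk g)) : rform i j = rform j i.
Proof. exact: dd_sym. Qed.

Lemma zepsN1 (n : mdegree) i j (z : rfun n) : zeps (-1) i j z = zeta j i (- z).
Proof. by rewrite /zeps /zeta mulN1r rmorphN mulrN invrN mulrN rform_sym mulNr. Qed.

Definition star_eps (eps : int) (F G : shuffle g) : shuffle g :=
  if eps == 1 then star F G else star G F.

Variables (a : mdegree) (eps : int) (pt : box a -> nat -> rfun a).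
Hypothesis eps_sign : eps = 1 \/ eps = -1.
Hypothesis pt_inj : forall v v' p p', pt v p = pt v' p' -> v = v' /\ p = p'.
Hypothesis pt_zeps : forall v p, zeps eps (tag v) (tag v) (pt v p.+1 - pt v p) = 0.

Definition degf (m : box a -> nat) : mdegree := [ffun i => of_colour m i].

Definition sub_occ (nn : box a -> nat) := {dffun forall v : box a, 'I_(nn v).+1}.
Definition sub_occ_fun nn (m : sub_occ nn) : box a -> nat := fun v => m v.
Coercion sub_occ_fun : sub_occ >-> Funclass.

Lemma sub_occ_le nn (m : sub_occ nn) v : (m v <= nn v)%N.
Proof. by rewrite -ltnS /sub_occ_fun ltn_ord. Qed.

Lemma sval_Sym_string (n k l : mdegree) (lam : box k -> box n) (rho : box l -> box n)
    (E : rfun k) (F : rfun l) (nn : box a -> nat) :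
  (forall u, tag (lam u) = tag u) -> (forall u, tag (rho u) = tag u) ->
  injective lam -> injective rho -> (forall u u', lam u <> rho u') ->
  (forall x, (exists u, x = lam u) \/ (exists u', x = rho u')) ->
  (forall i, n i = (k i + l i)%N) -> in_shuffle_deg E -> in_shuffle_deg F ->
  (forall i, n i = of_colour nn i) ->
  sval (pointsf pt nn) (Defs.Sym (embed_term lam rho eps E F))
    (\sum_(m : sub_occ nn | [forall i, of_colour m i == k i])
        string_value eps pt E F nn m *+ (\prod_i ((k i)`! * (l i)`!))).
Proof.
move=> lt rt li ri lr cov nkl hE hF nnn.
have [io [io' [ioK io'K iot iop]]] := points_enum nnn.
have y_inj := points_inj pt_inj ioK (iop pt).
have := sval_Sym_embed_term li ri lr eps hE hF y_inj.
have ex (m : sub_occ nn) : exists s : {perm box n},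
    [forall i, of_colour m i == k i] ->
  [/\ fiber_perm (fun v => tag v) s,
      side_image (in_lam lam) s = [set x | initial io m x]
    & embed_value lam rho eps E F (pointsf pt nn) s = string_value eps pt E F nn m].
  case: (boolP [forall i, _]) => [/forallP hm|_]; last by exists 1%g.
  have [s hs] := string_perm eps lt rt li ri lr cov nkl E F nnn io'K iot (iop pt)
    (sub_occ_le m) (fun i => eqP (hm i)).
  by exists s.
have [sg hsg] := fin_all_exists ex.
have := coset_sum (colour := fun v : box n => tag v) (side := in_lam lam)
  (W := embed_value lam rho eps E F (pointsf pt nn))
  (P := fun m : sub_occ nn => [forall i, of_colour m i == k i]) (sigma := sg).
move=> ->.
- rewrite (card_embed_stab lt rt li ri lr cov).
  have -> : (\sum_(m : sub_occ nn | [forall i, of_colour m i == k i])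
      embed_value lam rho eps E F (pointsf pt nn) (sg m) *+
        (\prod_i ((k i)`! * (l i)`!))) =
    \sum_(m : sub_occ nn | [forall i, of_colour m i == k i])
        string_value eps pt E F nn m *+ (\prod_i ((k i)`! * (l i)`!)).
    by apply: eq_bigr => m /hsg[_ _ ->].
  exact.
- by move=> h s; apply: embed_value_inv.
- by move=> m /hsg[].
- move=> m m' /hsg[_ em _] /hsg[_ em' _]; rewrite em em' => /setP e.
  (* An occupation is recovered from its initial boxes: if [m' v < m v], then box number [m' v] of
     the string v is initial for [m] but not for [m']. *)
  have key v : m v = m' v :> nat.
    apply/eqP; rewrite eqn_leq; apply/andP; split; rewrite leqNgt; apply/negP => lv.
    + have lv' := leq_trans lv (sub_occ_le m v).
      have := e (io' (Tagged (fun v => 'I_(nn v)) (Ordinal lv'))).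
      by rewrite !inE /initial io'K /= lv ltnn.
    + have lv' := leq_trans lv (sub_occ_le m' v).
      have := e (io' (Tagged (fun v => 'I_(nn v)) (Ordinal lv'))).
      by rewrite !inE /initial io'K /= lv ltnn.
  by apply/ffunP => v; exact/val_inj/key.
- move=> s cs nz.
  have [m [lem mk em]] := string_support pt_zeps lt rt li cov ioK io'K
    iot (iop pt) cs nz.
  pose m' : sub_occ nn := [ffun v => inord (m v)].
  have m'E : (m' : box a -> nat) = m.
    by apply: funext => v; rewrite /sub_occ_fun ffunE inordK // ltnS.
  have Pm : [forall i, of_colour m' i == k i] by apply/forallP => i; rewrite m'E mk.
  by exists m' => //; rewrite em; have [_ -> _] := hsg _ Pm; rewrite m'E.
Qed.

End StarAtPoints.

Lemma invr_mulrn_cancel (K : fieldType) (N : nat) (x : K) :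
  N%:R != 0 :> K -> N%:R^-1 * (x *+ N) = x.
Proof. by move=> nz; rewrite -[x *+ N]mulr_natl mulKf. Qed.

Lemma mul3_eq (K : fieldType) (x y z x' y' z' : K) :
  x = x' -> y = y' -> z = z' -> x * y * z = x' * y' * z'.
Proof. by move=> -> -> ->. Qed.

Lemma mul3_swap (K : fieldType) (x y z : K) : x * y * z = y * x * z.
Proof. by rewrite [x * y]mulrC. Qed.

Section StarEval.
Variables (C : numFieldType) (g : simple_datum C) (a : mdegree g).
Local Notation mdegree := (@mdegree C g).
Local Notation K := (rfun a).
Variables (eps : int) (pt : box a -> nat -> K).
Hypothesis eps_sign : eps = 1 \/ eps = -1.
Hypothesis pt_inj : forall v v' p p', pt v p = pt v' p' -> v = v' /\ p = p'.
Hypothesis pt_zeps : forall v p, zeps eps (tag v) (tag v) (pt v p.+1 - pt v p) = 0.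

Definition star_hom_eps (n k l : mdegree) (F : rfun k) (G : rfun l) : rfun n :=
  if eps == 1 then star_hom n F G else star_hom n G F.

Lemma star_hom_embed (n k l : mdegree) (F : rfun k) (G : rfun l) :
  (forall i, n i = (k i + l i)%N) ->
  exists (lam : box k -> box n) (rho : box l -> box n),
  [/\ [/\ forall u, tag (lam u) = tag u, forall u, tag (rho u) = tag u,
          injective lam & injective rho],
      forall u u', lam u <> rho u',
      forall x, (exists u, x = lam u) \/ (exists u', x = rho u') &
      star_hom_eps n F G = (\prod_i ((k i)`! * (l i)`!)%:R)^-1 *
        Defs.Sym (embed_term lam rho eps F G)].
Proof.
move=> nkl; rewrite /star_hom_eps; case: eps_sign => ->.
  have [lam [rho [[lt rt li ri] lr cov xl xr]]] := split_embeddings nkl.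
  exists lam, rho; split; [by []|by []|by []|].
  have e1 : rsubst F (fun u : box k => xvar n (tag u) (tagged u)) =
            rsubst F (fun u => var (lam u)) by exact: rsubst_ext.
  have e2 : rsubst G (fun u : box l => xvar n (tag u) (k (tag u) + tagged u)) =
            rsubst G (fun u => var (rho u)) by exact: rsubst_ext.
  have e3 : \prod_(v : box k) \prod_(v' : box l) zeta (tag v) (tag v')
      (xvar n (tag v) (tagged v) - xvar n (tag v') (k (tag v') + tagged v')) =
    \prod_(u : box k) \prod_(u' : box l)
     zeps 1 (tag u) (tag u') (var (lam u) - var (rho u')).
    by apply: eq_bigr => u _; apply: eq_bigr => u' _; rewrite zeps1 xl xr.
  exact: (congr1 (fun T => (\prod_i ((k i)`! * (l i)`!)%:R)^-1 * Defs.Sym T)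
    (mul3_eq e1 e2 e3)).
(* The opposite product lists the variables of [G] first, so the two embeddings exchange their
   parts; by the symmetry of the form, zeta_ji(-z) is the factor [zeps (-1)]. *)
have nlk i : n i = (l i + k i)%N by rewrite addnC.
have [rho [lam [[rt lt ri li] lr cov xl xr]]] := split_embeddings nlk.
exists lam, rho; split; [by []| | |].
- by move=> u u' /esym; exact: lr.
- by move=> x; case: (cov x); [right|left].
have e1 : rsubst G (fun u : box l => xvar n (tag u) (tagged u)) =
          rsubst G (fun u => var (rho u)) by exact: rsubst_ext.
have e2 : rsubst F (fun u : box k => xvar n (tag u) (l (tag u) + tagged u)) =
          rsubst F (fun u => var (lam u)) by exact: rsubst_ext.
have e3 : \prod_(v : box l) \prod_(v' : box k) zeta (tag v) (tag v')
    (xvar n (tag v) (tagged v) - xvar n (tag v') (l (tag v') + tagged v')) =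
  \prod_(u : box k) \prod_(u' : box l)
   zeps (-1) (tag u) (tag u') (var (lam u) - var (rho u')).
  rewrite exchange_big /=; apply: eq_bigr => u _; apply: eq_bigr => u' _.
  by rewrite zepsN1 xl xr opprB.
have e4 : \prod_i ((l i)`! * (k i)`!)%:R = \prod_i ((k i)`! * (l i)`!)%:R :> rfun n.
  by apply: eq_bigr => i _; rewrite mulnC.
have e : rsubst G (fun u : box l => xvar n (tag u) (tagged u)) *
    rsubst F (fun u : box k => xvar n (tag u) (l (tag u) + tagged u)) *
    \prod_(v : box l) \prod_(v' : box k) zeta (tag v) (tag v')
    (xvar n (tag v) (tagged v) - xvar n (tag v') (l (tag v') + tagged v')) =
    embed_term lam rho (-1) F G.
  exact: etrans (mul3_eq e1 e2 e3) (mul3_swap _ _ _).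
exact: etrans (congr1 (fun T => (\prod_i ((l i)`! * (k i)`!)%:R)^-1 * Defs.Sym T) e)
  (congr1 (fun N => N^-1 * Defs.Sym (embed_term lam rho (-1) F G)) e4).
Qed.

Definition string_term (F G : shuffle g) (nn m : box a -> nat) : K :=
  string_value eps pt (F (degf m)) (G (degf (rest nn m))) nn m.

Lemma sval_star_hom (n k l : mdegree) (F G : shuffle g) (nn : box a -> nat) :
  in_shuffle F -> in_shuffle G -> (forall i, n i = (k i + l i)%N) ->
  (forall i, n i = of_colour nn i) ->
  sval (pointsf pt nn) (star_hom_eps n (F k) (G l))
    (\sum_(m : sub_occ nn | [forall i, of_colour m i == k i]) string_term F G nn m).
Proof.
move=> [_ hF] [_ hG] nkl nnn.
have [lam [rho [[lt rt li ri] lr cov ->]]] := star_hom_embed (F k) (G l) nkl.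
have := sval_Sym_string pt_inj pt_zeps lt rt li ri lr cov nkl (hF k) (hG l) nnn.
pose N := (\prod_i ((k i)`! * (l i)`!))%N; rewrite -/N.
have N0 : (N%:R : C) != 0.
  by rewrite pnatr_eq0 -lt0n prodn_gt0 // => i; rewrite muln_gt0 !fact_gt0.
have NC (r : mdegree) : cst r N%:R = N%:R by rewrite rmorph_nat.
have Nr (r : mdegree) : (N%:R : rfun r) != 0 by rewrite -NC cst_eq0.
rewrite sumrMnl -natr_prod -/N => h.
have hN : sval (pointsf pt nn) (N%:R : rfun n)^-1 (N%:R : K)^-1.
  by apply: svalV => //; rewrite -!NC; exact: svalC.
have := svalM hN h; rewrite (invr_mulrn_cancel _ (Nr a)).
set S1 := \sum_(m | _) _; set S2 := \sum_(m | _) _; suff -> : S1 = S2 by [].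
apply: eq_bigr => m /forallP hm; rewrite /string_term.
have -> : degf (sub_occ_fun m) = k by apply/ffunP => i; rewrite ffunE; apply/eqP.
have -> // : degf (rest nn (sub_occ_fun m)) = l.
apply/ffunP => i; rewrite ffunE; apply: (@addnI (k i)).
rewrite -nkl nnn -(eqP (hm i)) -big_split /=; apply: eq_bigr => v _.
by rewrite subnKC // sub_occ_le.
Qed.

Lemma star_epsE (F G : shuffle g) (n : mdegree) : star_eps eps F G n =
  \sum_(k : {dffun forall i, 'I_(n i).+1})
     let k1 : mdegree := [ffun i => nat_of_ord (k i)] in
     let k2 : mdegree := [ffun i => (n i - k i)%N] in
     star_hom_eps n (F k1) (G k2).
Proof.
rewrite /star_eps /star_hom_eps; case: eps_sign => -> //=.
(* For the opposite product the sum over splittings of n is reversed, k becoming n - k. *)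
pose flip (k : {dffun forall i, 'I_(n i).+1}) : {dffun forall i, 'I_(n i).+1} :=
  [ffun i => rev_ord (k i)].
have flipK : involutive flip.
  by move=> k; apply/ffunP => i; rewrite !ffunE rev_ordK.
rewrite /star (reindex_inj (inv_inj flipK)) /=; apply: eq_bigr => k _.
have -> : [ffun i => nat_of_ord (flip k i)] = [ffun i => (n i - k i)%N] :> mdegree.
  by apply/ffunP => i; rewrite !ffunE /= subSS.
have -> // : [ffun i => (n i - flip k i)%N] = [ffun i => nat_of_ord (k i)] :> mdegree.
apply/ffunP => i; rewrite !ffunE /= subSS subKn //.
by rewrite -ltnS ltn_ord.
Qed.

Lemma sval_star (F G : shuffle g) (nn : box a -> nat) :
  in_shuffle F -> in_shuffle G ->
  sval (pointsf pt nn) (star_eps eps F G (degf nn))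
    (\sum_(m : sub_occ nn) string_term F G nn m).
Proof.
move=> hF hG; rewrite star_epsE.
have le_c (m : sub_occ nn) i : (of_colour m i < (degf nn i).+1)%N.
  by rewrite ltnS ffunE leq_sum // => v _; exact: sub_occ_le.
pose kap (m : sub_occ nn) : {dffun forall i, 'I_(degf nn i).+1} :=
  [ffun i => Ordinal (le_c m i)].
(* Occupations below [nn] are grouped by the degree that they assign to [F]; each group is one
   summand of the star product. *)
rewrite (partition_big kap predT) //=; apply: sval_sum => k _.
set k1 : mdegree := [ffun i => _]; set k2 : mdegree := [ffun i => (_ - _)%N].
have nkl i : degf nn i = (k1 i + k2 i)%N.
  by rewrite [k1 i]ffunE [k2 i]ffunE subnKC // -ltnS ltn_ord.
have := sval_star_hom hF hG nkl (fun i => ffunE _ i).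
set S1 := \sum_(m | _) _; set S2 := \sum_(m | _) _; suff -> : S1 = S2 by [].
apply: eq_bigl => m.
have kE i : kap m i = Ordinal (le_c m i) by exact: ffunE.
have k1E i : k1 i = k i by exact: ffunE.
apply/forallP/eqP => [h|e i].
  apply/ffunP => i; apply/val_inj; rewrite kE.
  exact: etrans (eqP (h i)) (k1E i).
by rewrite k1E -e kE.
Qed.

End StarEval.

(** * Factorization of the coefficients *)

Lemma prod_nat_neq0 (K : fieldType) l h (F : nat -> K) :
  (forall p, (l <= p < h)%N -> F p != 0) -> \prod_(l <= p < h) F p != 0.
Proof.
move=> hF; rewrite prodf_seq_neq0; apply/allP => p; rewrite mem_index_iota.
exact: hF.
Qed.

Section WeightFactorization.
Variables (K : fieldType) (V : finType) (sc oe : rel V).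
Variables (z : V -> nat -> V -> nat -> K) (Y Y' : V -> nat -> K).
Variables (m nn : V -> nat).
Hypothesis m_le : forall v, (m v <= nn v)%N.
Hypothesis z_neq0 : forall v1 v2 p1 p2, v1 != v2 \/ (p1 < p2)%N -> z v1 p1 v2 p2 != 0.
Hypothesis z_eq1 : forall v1 v2 p1 p2, v1 != v2 -> ~~ sc v1 v2 -> ~~ oe v1 v2 ->
  ~~ oe v2 v1 -> z v1 p1 v2 p2 = 1.
Hypothesis sc_neq : forall v1 v2, sc v1 v2 -> v1 != v2.
Hypothesis oe_neq : forall v1 v2, oe v1 v2 -> v1 != v2.
Hypothesis oe_sc : forall v1 v2, oe v1 v2 -> ~~ sc v1 v2 /\ ~~ sc v2 v1.
Hypothesis oe_asym : forall v1 v2, oe v1 v2 -> ~~ oe v2 v1.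
Hypothesis Y_after : forall v p, (m v < p <= nn v)%N -> Y v p = Y' v p *
  \prod_(v2 | sc v v2) \prod_(1 <= p2 < (m v2).+1) z v p v2 p2 *
  \prod_(v2 | oe v v2) \prod_(1 <= p2 < (m v2).+1) (z v p v2 p2 / z v2 p2 v p).

Definition weight (Y : V -> nat -> K) (lo hi : V -> nat) : K :=
  \prod_v \prod_(lo v <= p < hi v) Y v p *
  \prod_v \prod_(lo v <= p2 < hi v) \prod_(lo v <= p1 < p2) (z v p1 v p2)^-1 *
  \prod_v1 \prod_(v2 | sc v1 v2) \prod_(lo v1 <= p1 < hi v1)
     \prod_(lo v2 <= p2 < hi v2) (z v1 p1 v2 p2)^-1 *
  \prod_v1 \prod_(v2 | oe v1 v2) \prod_(lo v1 <= p1 < hi v1)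
     \prod_(lo v2 <= p2 < hi v2) (z v1 p1 v2 p2)^-1.

Let M v := (m v).+1.
Let N v := (nn v).+1.
Let one (v : V) := 1%N.
Let D (l1 h1 l2 h2 : V -> nat) v1 v2 :=
  \prod_(l1 v1 <= p1 < h1 v1) \prod_(l2 v2 <= p2 < h2 v2) z v1 p1 v2 p2.
(** The two letters tell where the points of the first and of the second string lie: E for positions
    up to m, which belong to the first factor of the product, F for those after m. *)
Let EE := D one M one M.
Let EF := D one M M N.
Let FE := D M N one M.
Let FF := D M N M N.
Let A lo hi v := \prod_(lo v <= p2 < hi v) \prod_(lo v <= p1 < p2) (z v p1 v p2)^-1.

Let D_inv l1 h1 l2 h2 v1 v2 : \prod_(l1 v1 <= p1 < h1 v1)
  \prod_(l2 v2 <= p2 < h2 v2) (z v1 p1 v2 p2)^-1 = (D l1 h1 l2 h2 v1 v2)^-1.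
Proof. by rewrite /D -prodfV; apply: eq_bigr => p1 _; rewrite prodfV. Qed.

Let D_split v1 v2 : D one N one N v1 v2 =
  (EE v1 v2 * FF v1 v2) * (EF v1 v2 * FE v1 v2).
Proof.
have cat (F : nat -> K) v : \prod_(1 <= p < N v) F p =
    \prod_(1 <= p < M v) F p * \prod_(M v <= p < N v) F p.
  by rewrite (big_cat_nat (n := M v)) // ltnS.
rewrite /D /one cat; under eq_bigr do rewrite cat; rewrite big_split /=.
under [X in _ * X]eq_bigr do rewrite cat.
rewrite [X in _ * X]big_split /= -/(EE v1 v2) -/(EF v1 v2) -/(FE v1 v2) -/(FF v1 v2).
by rewrite [FE v1 v2 * _]mulrC mulrACA.
Qed.

Let A_split v : A one N v = A one M v * A M N v * (EF v v)^-1.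
Proof.
rewrite /A /one (big_cat_nat (n := M v)) //=; last by rewrite ltnS.
rewrite -mulrA; congr (_ * _).
have cat p2 : (M v <= p2 < N v)%N -> \prod_(1 <= p1 < p2) (z v p1 v p2)^-1 =
    \prod_(M v <= p1 < p2) (z v p1 v p2)^-1 * \prod_(1 <= p1 < M v) (z v p1 v p2)^-1.
  by move=> /andP[le _]; rewrite mulrC -big_cat_nat.
rewrite (eq_big_nat _ _ cat) big_split /=; congr (_ * _).
by rewrite exchange_big /=; exact: (D_inv one M M N).
Qed.

Let D_neq0 l1 h1 l2 h2 v1 v2 : v1 != v2 -> D l1 h1 l2 h2 v1 v2 != 0.
Proof.
move=> ne; apply: prod_nat_neq0 => p1 _; apply: prod_nat_neq0 => p2 _.
by apply: z_neq0; left.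
Qed.

Let EF_neq0 v1 v2 : EF v1 v2 != 0.
Proof.
case: (eqVneq v1 v2) => [<-|]; last exact: D_neq0.
apply: prod_nat_neq0 => p1 /andP[_ h1]; apply: prod_nat_neq0 => p2 /andP[h2 _].
by apply: z_neq0; right; exact: leq_trans h1 h2.
Qed.

Let Y_after_prod : \prod_v \prod_(M v <= p < N v) Y v p =
  \prod_v \prod_(M v <= p < N v) Y' v p *
  \prod_v1 \prod_(v2 | sc v1 v2) FE v1 v2 *
  (\prod_v1 (\prod_(v2 | oe v1 v2) FE v1 v2) /
   \prod_v1 (\prod_(v2 | oe v1 v2) EF v2 v1)).
Proof.
rewrite -prodf_div -!big_split /=; apply: eq_bigr => v _.
rewrite (eq_big_nat _ _ (F2 := fun p => Y' v p *
  \prod_(v2 | sc v v2) \prod_(1 <= p2 < (m v2).+1) z v p v2 p2 *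
  \prod_(v2 | oe v v2) \prod_(1 <= p2 < (m v2).+1) (z v p v2 p2 / z v2 p2 v p))).
  rewrite !big_split /= -mulrA -[RHS]mulrA; congr (_ * (_ * _)).
    by rewrite exchange_big.
  rewrite -prodf_div exchange_big /=; apply: eq_bigr => v2 _.
  rewrite /FE /EF /D -/(M v2) [in X in _ / X]exchange_big /= -prodf_div.
  by apply: eq_bigr => p _; rewrite prodf_div.
by move=> p /andP[h1 h2]; apply: Y_after; apply/andP; split.
Qed.

Let EF_prod : \prod_v1 \prod_v2 EF v1 v2 =
  \prod_v EF v v * \prod_v1 \prod_(v2 | sc v1 v2) EF v1 v2 *
  \prod_v1 \prod_(v2 | oe v1 v2) EF v1 v2 * \prod_v1 \prod_(v2 | oe v1 v2) EF v2 v1.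
Proof.
have -> : \prod_v1 \prod_(v2 | oe v1 v2) EF v2 v1 = \prod_v1 \prod_(v2 | oe v2 v1) EF v1 v2.
  by rewrite (exchange_big_dep predT).
rewrite -!big_split /=; apply: eq_bigr => v _.
rewrite (bigD1 v) //= -!mulrA; congr (_ * _).
rewrite [X in _ = X * _]big_mkcond [X in _ = _ * (X * _)]big_mkcond /=.
rewrite [X in _ = _ * (_ * X)]big_mkcond /= -!big_split /= big_mkcond /=.
apply: eq_bigr => v2 _; rewrite [v2 == v]eq_sym.
case: (boolP (sc v v2)) => [s|ns].
  have -> : oe v v2 = false by apply/negP => /oe_sc[]; rewrite s.
  have -> : oe v2 v = false by apply/negP => /oe_sc[]; rewrite s.
  by rewrite (sc_neq s) !mulr1.
case: (boolP (oe v v2)) => [s|no].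
  by rewrite (negbTE (oe_asym s)) (oe_neq s) mul1r mulr1.
case: (boolP (oe v2 v)) => [s|no'].
  by rewrite eq_sym (oe_neq s) !mul1r.
rewrite !mulr1; case: ifP => // ne; rewrite /EF /D big1 // => p1 _.
by rewrite big1 // => p2 _; exact: z_eq1.
Qed.

(** The extra product on the left is EF over all ordered pairs of strings. Its diagonal cancels the
    mixed part of the products inside strings. For equal colours EF, and FE coming from [Y_after],
    cancel the mixed inverses. For an edge (v1, v2) EF and FE cancel in the same way, and the
    reversed [EF v2 v1] cancels the denominator in [Y_after]. The other pairs contribute 1. *)
Lemma weight_split :
  weight Y (fun=> 1%N) (fun v => (nn v).+1) * (\prod_v1 \prod_v2
     \prod_(1 <= p1 < (m v1).+1) \prod_((m v2).+1 <= p2 < (nn v2).+1) z v1 p1 v2 p2) =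
  weight Y (fun=> 1%N) (fun v => (m v).+1) *
  weight Y' (fun v => (m v).+1) (fun v => (nn v).+1).
Proof.
rewrite -/(\prod_v1 \prod_v2 EF v1 v2) EF_prod /weight.
have hY : \prod_v \prod_(1 <= p < (nn v).+1) Y v p =
    \prod_v \prod_(1 <= p < (m v).+1) Y v p * \prod_v \prod_(M v <= p < N v) Y v p.
  rewrite -big_split; apply: eq_bigr => v _ /=.
  by rewrite (big_cat_nat (n := M v)) // ltnS.
rewrite hY Y_after_prod {hY}.
have hA lo hi : \prod_v \prod_(lo v <= p2 < hi v) \prod_(lo v <= p1 < p2) (z v p1 v p2)^-1
  = \prod_v A lo hi v by [].
have hD (r : rel V) lo hi : \prod_v1 \prod_(v2 | r v1 v2) \prod_(lo v1 <= p1 < hi v1)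
     \prod_(lo v2 <= p2 < hi v2) (z v1 p1 v2 p2)^-1 =
   \prod_v1 \prod_(v2 | r v1 v2) (D lo hi lo hi v1 v2)^-1.
  by apply: eq_bigr => v1 _; apply: eq_bigr => v2 _; exact: D_inv.
rewrite !hA !hD.
have sA : \prod_v A one N v = \prod_v A one M v * \prod_v A M N v * (\prod_v EF v v)^-1.
  by rewrite -prodfV -!big_split; apply: eq_bigr => v _; exact: A_split.
rewrite [X in _ * X * _ * _ * _]sA {sA}.
have sD (r : rel V) : \prod_v1 \prod_(v2 | r v1 v2) (D one N one N v1 v2)^-1 =
  \prod_v1 \prod_(v2 | r v1 v2) (EE v1 v2)^-1 *
  \prod_v1 \prod_(v2 | r v1 v2) (FF v1 v2)^-1 /
  (\prod_v1 (\prod_(v2 | r v1 v2) EF v1 v2) * \prod_v1 (\prod_(v2 | r v1 v2) FE v1 v2)).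
  rewrite -!big_split /= -prodfV -big_split /=; apply: eq_bigr => v1 _.
  rewrite -!big_split /= -prodfV -big_split /=; apply: eq_bigr => v2 _.
  by rewrite D_split !invfM.
rewrite [X in _ * X * _ * _]sD [X in _ * X * _]sD {sD}.
have n1 : \prod_v EF v v != 0 by apply/prodf_neq0 => v _; exact: EF_neq0.
have n2 (r : rel V) : \prod_v1 (\prod_(v2 | r v1 v2) EF v1 v2) != 0.
  by apply/prodf_neq0 => v1 _; apply/prodf_neq0 => v2 _; exact: EF_neq0.
have n3 : \prod_v1 (\prod_(v2 | oe v1 v2) EF v2 v1) != 0.
  by apply/prodf_neq0 => v1 _; apply/prodf_neq0 => v2 _; exact: EF_neq0.
have n4 : \prod_v1 (\prod_(v2 | sc v1 v2) FE v1 v2) != 0.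
  by apply/prodf_neq0 => v1 _; apply/prodf_neq0 => v2 /sc_neq ne; exact: D_neq0.
have n5 : \prod_v1 (\prod_(v2 | oe v1 v2) FE v1 v2) != 0.
  by apply/prodf_neq0 => v1 _; apply/prodf_neq0 => v2 /oe_neq ne; exact: D_neq0.
rewrite -/one -/EE -/FF.
move: (\prod_v EF v v) n1 (\prod_v1 \prod_(v2 | sc v1 v2) EF v1 v2) (n2 sc)
  (\prod_v1 \prod_(v2 | oe v1 v2) EF v1 v2) (n2 oe)
  (\prod_v1 \prod_(v2 | oe v1 v2) EF v2 v1) n3
  (\prod_v1 (\prod_(v2 | sc v1 v2) FE v1 v2)) n4
  (\prod_v1 (\prod_(v2 | oe v1 v2) FE v1 v2)) n5.
move=> x1 n1 x2 n2' x3 n3' x4 n4' x5 n5' x6 n6'.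
by field; rewrite n1 n2' n3' n4' n5' n6'.
Qed.

End WeightFactorization.

Lemma telescope_div (K : fieldType) (f : nat -> K) (m : nat) :
  (forall p, f p != 0) -> \prod_(1 <= p < m.+1) (f p.+1 / f p) = f m.+1 / f 1.
Proof.
move=> nz; elim: m => [|m IH]; first by rewrite big_geq // divff.
by rewrite big_nat_recr //= IH mulrC mulrA divfK.
Qed.

(* Cross-multiplied, both sides are the product of f over 0 <= p < m + n. *)
Lemma string_exchange (K : fieldType) (f : nat -> K) (m n : nat) :
  (forall p, f p != 0) ->
  \prod_(0 <= q < n) (f q / f (m + q)) = \prod_(0 <= p < m) (f p / f (n + p)).
Proof.
move=> nz; have nz' (J : seq nat) (h : nat -> nat) : \prod_(q <- J) f (h q) != 0.
  by rewrite prodf_seq_neq0; apply/allP => q _; rewrite nz.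
rewrite !prodf_div; apply: cross_divf_eq => //.
have cat m1 n1 : \prod_(0 <= q < m1) f q * \prod_(0 <= q < n1) f (m1 + q) =
    \prod_(0 <= q < m1 + n1) f q.
  rewrite [RHS](big_cat_nat (n := m1)) ?leq_addr //=; congr (_ * _).
  rewrite -{2}[m1]add0n big_addn addKn; apply: eq_bigr => q _.
  by rewrite addnC.
by rewrite cat cat addnC.
Qed.

Lemma div_add_half (K : fieldType) (x e : K) : (2 : K) != 0 -> x != 0 ->
  1 + e / (2 * x) = (x + e / 2) / x.
Proof. by move=> h2 hx; field; rewrite h2 hx. Qed.

Lemma divf_neq0 (K : fieldType) (x y : K) : x != 0 -> y != 0 -> x / y != 0.
Proof. by move=> hx hy; rewrite mulf_neq0 ?invr_eq0. Qed.

Lemma div_opp_cancel (K : fieldType) (x y t : K) :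
  x != 0 -> y != 0 -> t / x / (- y / - x) = t / y.
Proof. by move=> hx hy; field; rewrite !oppr_eq0 hx hy. Qed.

Lemma Yv_cancel (K : fieldType) (x y z t k : K) : x != 0 -> y != 0 -> z != 0 ->
  k * t / y = k * z / x * (x / y) * (t / z).
Proof. by move=> hx hy hz; field; rewrite hx hy hz. Qed.

(** * Zeta factors and the functions Y at string points *)

Section StringPoints.
Variables (C : numFieldType) (g : simple_datum C) (a : mdegree g).
Local Notation I := 'I_(rk g).
Local Notation V := (box a).
Local Notation K := (rfun a).
Variables (eps : int) (c : I -> C) (oe : rel I) (kap : V -> nat -> K).
Hypothesis eps_sign : eps = 1 \/ eps = -1.
Hypothesis oe_orient : is_orientation oe.

Local Notation cs := (@cst C g a).
Let e : C := eps%:~R.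

(* The points are w - (p - 1) d for eps = 1 and c = d (the E half), and w + p d
   for eps = -1 and c = 0 (the F half). *)
Definition pt (v : V) (p : nat) : K := var v + cs (c (tag v) - e * p%:R * dd (tag v)).

Definition sh (m : V -> nat) : V -> K := shift eps m.

Lemma e_neq0 : e != 0.
Proof. by rewrite /e intr_eq0; case: eps_sign => ->. Qed.

Lemma sval_pt m v p : sval (sh m) (pt v p) (pt v (m v + p)).
Proof.
have h := svalD (svalX (sh m) v) (svalC (sh m) (c (tag v) - e * p%:R * dd (tag v))).
suff -> : pt v (m v + p) = sh m v + cs (c (tag v) - e * p%:R * dd (tag v)) by exact: h.
rewrite /pt /sh /shift -[RHS]addrA -(rmorphN cs) -(rmorphD cs); congr (_ + cs _).
by rewrite natrD -/e; ring.
Qed.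

Lemma pt_sub v v' p p' : pt v p - pt v' p' = var v - var v' +
  cs (c (tag v) - c (tag v') - e * p%:R * dd (tag v) + e * p'%:R * dd (tag v')).
Proof.
rewrite /pt opprD addrACA -(rmorphN cs) -(rmorphD cs); congr (_ + cs _).
by ring.
Qed.

Lemma pt_sub_cst v v' p p' d : v != v' -> pt v p - pt v' p' + cs d != 0.
Proof.
move=> ne; rewrite pt_sub -addrA -(rmorphD cs) -tofrac_diff tofrac_eq0.
exact: diff_poly_neq0.
Qed.

Lemma pt_sub_neq v v' p p' : v != v' -> pt v p - pt v' p' != 0.
Proof.
by move=> ne; have := pt_sub_cst p p' 0 ne; rewrite (rmorph0 cs) addr0.
Qed.

Lemma pt_sub_same v p p' : pt v p - pt v p' = cs (e * (p'%:R - p%:R) * dd (tag v)).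
Proof. by rewrite pt_sub subrr add0r; congr (cs _); ring. Qed.

Lemma pt_inj v v' p p' : pt v p = pt v' p' -> v = v' /\ p = p'.
Proof.
move=> h; have [ev|ne] := eqVneq v v'; last first.
  by have := pt_sub_neq p p' ne; rewrite h subrr eqxx.
split=> //; move: h; rewrite -ev => /eqP; rewrite -subr_eq0 pt_sub_same cst_eq0.
rewrite !mulf_eq0 (negbTE e_neq0) (gt_eqF (dd_gt0 _)) orbF /=.
by rewrite subr_eq0 eqr_nat eq_sym => /eqP.
Qed.

Lemma two_neq0 : (2 : K) != 0.
Proof. by rewrite -(rmorph_nat cs) cst_eq0 pnatr_eq0. Qed.

Lemma zepsE i j (x : K) : x != 0 ->
  zeps eps i j x = (x + cs (e * rform i j / 2)) / x.
Proof.
move=> nz; have := div_add_half (cs (e * rform i j)) two_neq0 nz.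
by rewrite /zeps => ->; rewrite !(rmorphM cs) (fmorphV cs) (rmorph_nat cs).
Qed.

Lemma rform_diag (i : I) : rform i i / 2 = dd i.
Proof. by rewrite /rform cartan_diag mulfK // pnatr_eq0. Qed.

(** Hence zeta between points P_p and P'_q of one colour is (P_p - P'_{q+1}) / (P_p - P'_q), a
    quotient of consecutive differences, and products along a string telescope. *)
Lemma pt_step v p p' v' : tag v = tag v' ->
  pt v p - pt v' p' + cs (e * dd (tag v)) = pt v p - pt v' p'.+1.
Proof.
move=> et; rewrite !pt_sub -addrA -(rmorphD cs); congr (_ + cs _).
by rewrite et -natr1; ring.
Qed.

Lemma pt_zeps v p : zeps eps (tag v) (tag v) (pt v p.+1 - pt v p) = 0.
Proof.
have nz : pt v p.+1 - pt v p != 0.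
  by apply/eqP => /subr0_eq /pt_inj[_ /eqP]; rewrite eqn_leq ltnn.
rewrite (zepsE _ _ nz) -mulrA rform_diag.
have -> : pt v p.+1 - pt v p + cs (e * dd (tag v)) = 0.
  by rewrite pt_step // subrr.
by rewrite mul0r.
Qed.

Lemma zeps_neq0 v1 v2 p1 p2 : v1 != v2 \/ (p1 < p2)%N ->
  zeps eps (tag v1) (tag v2) (pt v1 p1 - pt v2 p2) != 0.
Proof.
have [<-|ne] := eqVneq v1 v2; last first.
  move=> _; have nz := pt_sub_neq p1 p2 ne.
  by rewrite (zepsE _ _ nz); exact: divf_neq0 (pt_sub_cst _ _ _ ne) nz.
case=> // lt.
have nz : pt v1 p1 - pt v1 p2 != 0.
  by apply/eqP => /subr0_eq /pt_inj[_ h]; rewrite h ltnn in lt.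
rewrite (zepsE _ _ nz) -mulrA rform_diag; apply: (fun h => divf_neq0 h nz).
rewrite (pt_step _ _ (erefl (tag v1))); apply/eqP => /subr0_eq /pt_inj[_ h].
by rewrite h ltnNge leqnSn in lt.
Qed.

Lemma zeps_unlinked (i j : I) (x : K) : i != j -> ~~ linked i j -> zeps eps i j x = 1.
Proof.
rewrite /linked => -> /=; rewrite negbK => /eqP h.
by rewrite /zeps /rform h mulr0z !mulr0 (rmorph0 cs) mul0r addr0.
Qed.

Lemma linked_sym (i j : I) : linked i j = linked j i.
Proof.
rewrite /linked eq_sym; congr (_ && ~~ _).
have := dd_sym i j; case: (eqVneq (cartan g i j) 0) => [->|nz].
  move=> /esym/eqP; rewrite mulr0z mulr0 mulf_eq0 (gt_eqF (dd_gt0 _)) /= intr_eq0.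
  by move=> ->.
move=> h; apply/esym/negbTE; apply: contra nz => /eqP h0; move/eqP: h.
by rewrite h0 mulr0z mulr0 mulf_eq0 (gt_eqF (dd_gt0 _)) /= intr_eq0.
Qed.

Definition sc : rel V := fun v1 v2 => (tag v2 == tag v1) && (v1 != v2).
Definition ed : rel V := fun v1 v2 => oe (tag v1) (tag v2).
Definition zz v1 p1 v2 p2 : K := zeps eps (tag v1) (tag v2) (pt v1 p1 - pt v2 p2).

Lemma ed_linked v1 v2 : ed v1 v2 -> linked (tag v1) (tag v2).
Proof. exact: oe_orient.1. Qed.

Lemma ed_neq v1 v2 : ed v1 v2 -> v1 != v2.
Proof. by move=> /ed_linked /andP[h _]; apply: contraNneq h => ->. Qed.

Lemma ed_asym v1 v2 : ed v1 v2 -> ~~ ed v2 v1.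
Proof.
by move=> h; have := oe_orient.2 _ _ (ed_linked h); rewrite -/(ed v1 v2) h => /esym.
Qed.

Lemma ed_sc v1 v2 : ed v1 v2 -> ~~ sc v1 v2 /\ ~~ sc v2 v1.
Proof.
move=> /ed_linked /andP[ne _]; by rewrite /sc eq_sym (negbTE ne).
Qed.

Lemma zz_eq1 v1 v2 p1 p2 : v1 != v2 -> ~~ sc v1 v2 -> ~~ ed v1 v2 -> ~~ ed v2 v1 ->
  zz v1 p1 v2 p2 = 1.
Proof.
rewrite /sc => ne; rewrite ne andbT eq_sym => ne' n1 n2; apply: zeps_unlinked => //.
apply/negP => hl; have := oe_orient.2 _ _ hl; rewrite -/(ed v1 v2) -/(ed v2 v1).
by rewrite (negbTE n1) (negbTE n2).
Qed.

Definition nlink (v v2 : V) : nat := absz (cartan g (tag v2) (tag v)).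

Lemma rform_nlink v v2 : ed v v2 -> rform (tag v) (tag v2) = - ((nlink v v2)%:R * dd (tag v2)).
Proof.
move=> /ed_linked /andP[ne _]; rewrite rform_sym /rform /nlink.
have le : cartan g (tag v2) (tag v) <= 0 by apply: cartan_offdiag; rewrite eq_sym.
have := ler0_norm le; rewrite -abszE => h.
have -> : (absz (cartan g (tag v2) (tag v)))%:R = (- cartan g (tag v2) (tag v))%:~R :> C.
  by rewrite -h.
by rewrite mulrNz mulNr opprK mulrC.
Qed.

(** For an edge, with i and j the colours of v and v2 and n = -a_ji: for [p2 = 1] and 0 <= q < n
    these are the linear factors of the W_j product in Y; q = 0 gives the numerator of zeta_ij at
    the two points, and q = n, up to sign, that of zeta_ji at the opposite difference. One step
    along the string of v2 amounts to one step in q. *)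
Definition link_factor v p v2 p2 q : K := pt v p - pt v2 p2 +
  cs (e * (q%:R - (nlink v v2)%:R / 2) * dd (tag v2)).

(* Y_v at the p-th point of its string; [kap] is the factor without W_j. *)
Definition Yv (v : V) (p : nat) : K := kap v p *
  \prod_(v2 | ed v v2) \prod_(0 <= q < nlink v v2) link_factor v p v2 1 q /
  \prod_(v2 | sc v v2) (pt v p - pt v2 1).

(* The image of Yv v (p - m v) under the shift by m. *)
Definition Yshift (m : V -> nat) (v : V) (p : nat) : K := kap v p *
  \prod_(v2 | ed v v2) \prod_(0 <= q < nlink v v2) link_factor v p v2 (m v2).+1 q /
  \prod_(v2 | sc v v2) (pt v p - pt v2 (m v2).+1).

Lemma link_factor_shift v p v2 p2 q r :
  link_factor v p v2 (p2 + r) q = link_factor v p v2 p2 (r + q).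
Proof.
rewrite /link_factor !pt_sub -!addrA -!(rmorphD cs); congr (_ + (_ + cs _)).
by rewrite !natrD; ring.
Qed.

Lemma link_factor_neq0 v p v2 p2 q : ed v v2 -> link_factor v p v2 p2 q != 0.
Proof. by move=> /ed_neq; exact: pt_sub_cst. Qed.

Lemma zz_num v p v2 p2 : ed v v2 ->
  zz v p v2 p2 = link_factor v p v2 p2 0 / (pt v p - pt v2 p2).
Proof.
move=> hed; have h1 := pt_sub_neq p p2 (ed_neq hed).
rewrite /zz (zepsE _ _ h1) (rform_nlink hed).
by congr ((_ + cs _) / _); rewrite sub0r; ring.
Qed.

Lemma zz_link v p v2 p2 : ed v v2 -> zz v p v2 p2 / zz v2 p2 v p =
  link_factor v p v2 p2 0 / link_factor v p v2 p2 (nlink v v2).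
Proof.
move=> hed; have ne := ed_neq hed; have ne' : v2 != v by rewrite eq_sym.
have r1 := rform_nlink hed; rewrite rform_sym in r1.
rewrite zz_num // /zz (zepsE _ _ (pt_sub_neq _ _ ne')) r1.
have -> : pt v2 p2 - pt v p + cs (e * - ((nlink v v2)%:R * dd (tag v2)) / 2) =
    - link_factor v p v2 p2 (nlink v v2).
  rewrite /link_factor [RHS]opprD -(rmorphN cs) [in RHS](opprB (pt v p)).
  congr (_ + cs _).
  by field.
have h1 := pt_sub_neq p p2 ne; have h2 := link_factor_neq0 p p2 (nlink v v2) hed.
rewrite -[pt v2 p2 - pt v p]opprB.
exact: (div_opp_cancel _ h1 h2).
Qed.

Lemma Yv_after m v p : Yv v p = Yshift m v p *
  \prod_(v2 | sc v v2) \prod_(1 <= p2 < (m v2).+1) zz v p v2 p2 *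
  \prod_(v2 | ed v v2) \prod_(1 <= p2 < (m v2).+1) (zz v p v2 p2 / zz v2 p2 v p).
Proof.
have hsc : \prod_(v2 | sc v v2) \prod_(1 <= p2 < (m v2).+1) zz v p v2 p2 =
    \prod_(v2 | sc v v2) (pt v p - pt v2 (m v2).+1) / \prod_(v2 | sc v v2) (pt v p - pt v2 1).
  rewrite -prodf_div; apply: eq_bigr => v2 /andP[/eqP et ne].
  rewrite -(telescope_div (f := fun q => pt v p - pt v2 q)); last first.
    by move=> q; exact: pt_sub_neq.
  apply: eq_bigr => q _; rewrite /zz zepsE ?pt_sub_neq // et -mulrA rform_diag.
  by rewrite pt_step.
(* By [link_factor_shift] all factors are values of one sequence, [link_factor v p v2 1]. Each of
   the [m v2] points contributes a quotient of terms at distance n, and [string_exchange] trades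
   these for n quotients of terms at distance [m v2]. *)
have hed : \prod_(v2 | ed v v2) \prod_(1 <= p2 < (m v2).+1) (zz v p v2 p2 / zz v2 p2 v p) =
    \prod_(v2 | ed v v2) \prod_(0 <= q < nlink v v2) link_factor v p v2 1 q /
    \prod_(v2 | ed v v2) \prod_(0 <= q < nlink v v2) link_factor v p v2 (m v2).+1 q.
  rewrite -prodf_div; apply: eq_bigr => v2 hv; rewrite -prodf_div.
  have nz q : link_factor v p v2 1 q != 0 by exact: link_factor_neq0.
  have := string_exchange (m v2) (nlink v v2) nz; rewrite big_add1 /= => h.
  transitivity (\prod_(0 <= q < m v2) (link_factor v p v2 1 q /
     link_factor v p v2 1 (nlink v v2 + q))).
    apply: eq_bigr => q _; rewrite zz_link // -addn1 addnC !link_factor_shift.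
    by rewrite addn0 [(q + _)%N]addnC.
  rewrite -h; apply: eq_bigr => q _; rewrite -link_factor_shift.
  by rewrite add1n.
rewrite hsc hed /Yv /Yshift.
have n1 : \prod_(v2 | sc v v2) (pt v p - pt v2 (m v2).+1) != 0.
  by apply/prodf_neq0 => v2 /andP[_ ne]; exact: pt_sub_neq.
have n2 : \prod_(v2 | sc v v2) (pt v p - pt v2 1) != 0.
  by apply/prodf_neq0 => v2 /andP[_ ne]; exact: pt_sub_neq.
have n3 : \prod_(v2 | ed v v2) \prod_(0 <= q < nlink v v2) link_factor v p v2 (m v2).+1 q != 0.
  apply/prodf_neq0 => v2 hv; apply: prod_nat_neq0 => q _; exact: link_factor_neq0.
exact: (Yv_cancel _ _ n1 n2 n3).
Qed.

End StringPoints.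

Lemma mul_weight (K : fieldType) (y e a s o : K) : y * e * a * s * o = e * (y * a * s * o).
Proof. by rewrite [y * e]mulrC -!mulrA. Qed.

Lemma mul_sum_weight (K : fieldType) (J : finType) (w : K) (t r : J -> K) :
  (forall j, t j * w = r j) -> (\sum_j t j) * w = \sum_j r j.
Proof. by move=> h; rewrite mulr_suml; apply: eq_bigr => j _. Qed.

Lemma mul_weight_split (K : fieldType) (e f z w w1 w2 : K) : w * z = w1 * w2 ->
  e * f * z * w = (e * w1) * (f * w2).
Proof. by move=> h; rewrite -[LHS]mulrA [z * w]mulrC h mulrACA. Qed.

Lemma prod_boxes (C : numFieldType) (g : simple_datum C) (a : mdegree g)
    (R : comPzSemiRingType) (m : box a -> nat) (F : box a -> nat -> R) :
  \prod_(q : boxes m) F (tag q) (tagged q).+1 =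
  \prod_v \prod_(1 <= p < (m v).+1) F v p.
Proof.
under [RHS]eq_bigr do rewrite big_add1 big_mkord.
by rewrite [RHS](sig_big_dep _ (fun _ _ => true) (fun v (p : 'I_(m v)) => F v p.+1)).
Qed.

Lemma sval_prod_nat (C : numFieldType) (g : simple_datum C) (k n : mdegree g)
    (x : box k -> rfun n) (l h : nat) (F : nat -> rfun k) y :
  (forall p, (l <= p < h)%N -> sval x (F p) (y p)) ->
  sval x (\prod_(l <= p < h) F p) (\prod_(l <= p < h) y p).
Proof.
move=> hF; rewrite big_nat_cond [X in sval _ _ X]big_nat_cond.
by apply: sval_prod => p /andP[hp _]; exact: hF.
Qed.

(** * The coefficients of a shuffle product *)

Section CoefStar.
Variables (C : numFieldType) (g : simple_datum C) (a : mdegree g).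
Local Notation I := 'I_(rk g).
Local Notation V := (box a).
Local Notation K := (rfun a).
Variables (eps : int) (c : I -> C) (oe : rel I) (kap : V -> nat -> K).
Hypothesis eps_sign : eps = 1 \/ eps = -1.
Hypothesis oe_orient : is_orientation oe.
Local Notation pt := (@pt C g a eps c).
Local Notation sh := (@sh C g a eps).
Local Notation zz := (@zz C g a eps c).
Local Notation Yv := (@Yv C g a eps c oe kap).
Local Notation Yshift := (@Yshift C g a eps c oe kap).
Local Notation ed := (@ed C g a oe).
Local Notation sc := (@sc C g a).
Hypothesis kap_shift : forall m v p, sval (sh m) (kap v p) (kap v (m v + p)).

Lemma sval_zz m v1 p1 v2 p2 : v1 != v2 \/ (p1 < p2)%N ->
  sval (sh m) (zz v1 p1 v2 p2) (zz v1 (m v1 + p1) v2 (m v2 + p2)).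
Proof.
move=> h; apply: sval_zeps; first by apply: svalB; exact: sval_pt.
apply/eqP => /subr0_eq /(pt_inj eps_sign)[ev]; case: h; rewrite ev ?eqxx //.
by move=> lt /addnI e; rewrite e ltnn in lt.
Qed.

Lemma sval_link m v p v2 p2 q :
  sval (sh m) (link_factor eps c v p v2 p2 q) (link_factor eps c v (m v + p) v2 (m v2 + p2) q).
Proof.
apply: svalD; last exact: svalC.
by apply: svalB; exact: sval_pt.
Qed.

(** The point of v moves by [m v] and the first points of the other strings by their own [m v2];
    this is why [Yshift] is indexed by the position in the full string. *)
Lemma sval_Yv m v p : sval (sh m) (Yv v p) (Yshift m v (m v + p)).
Proof.
apply: svalM; first apply: svalM.
- exact: kap_shift.
- apply: sval_prod => v2 _; apply: sval_prod => q _.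
  by rewrite -[(m v2).+1]addn1; exact: sval_link.
- apply: svalV.
    apply: sval_prod => v2 _; rewrite -[(m v2).+1]addn1.
    by apply: svalB; exact: sval_pt.
  by apply/prodf_neq0 => v2 /andP[_ ne]; exact: pt_sub_neq.
Qed.

(** Common form of [coef_plus] and [coef_minus], which are recovered in [coef_plusE] and
    [coef_minusE]. *)
Definition coefg (k : mdegree g) (E : rfun k) (m : V -> nat) : K :=
  (\prod_v \prod_(1 <= p < (m v).+1) Yv v p) *
  rsubst E (pointsf pt m) *
  (\prod_v \prod_(1 <= p2 < (m v).+1) \prod_(1 <= p1 < p2) (zz v p1 v p2)^-1) *
  (\prod_v1 \prod_(v2 | sc v1 v2) \prod_(1 <= p1 < (m v1).+1)
     \prod_(1 <= p2 < (m v2).+1) (zz v1 p1 v2 p2)^-1) *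
  (\prod_v1 \prod_(v2 | ed v1 v2) \prod_(1 <= p1 < (m v1).+1)
     \prod_(1 <= p2 < (m v2).+1) (zz v1 p1 v2 p2)^-1).

Local Notation weight := (weight sc ed zz).

Lemma coefgE k (E : rfun k) m : coefg E m =
  rsubst E (pointsf pt m) * weight Yv (fun=> 1%N) (fun v => (m v).+1).
Proof. exact: mul_weight. Qed.

Lemma points_section (k : mdegree g) m : (forall i, k i = of_colour m i) ->
  injective (pointsf pt m : box k -> K) /\
  (forall (m0 : V -> nat) u, sval (sh m0) (pointsf pt m u : K) (pointsf (pt_after pt m0) m (u : box k))).
Proof.
move=> hk; have [io [io' [ioK io'K iot iop]]] := points_enum hk; split.
  exact: (points_inj (@pt_inj _ _ _ _ c eps_sign) ioK (iop pt)).
by move=> m0 u; rewrite !iop; exact: sval_pt.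
Qed.

Lemma big_shift_nat (R : comPzSemiRingType) m n (F : nat -> R) : (m <= n)%N ->
  \prod_(m.+1 <= p < n.+1) F p = \prod_(1 <= p < (n - m).+1) F (m + p)%N.
Proof.
move=> le; rewrite -[in LHS](add1n m) big_addn subSn //.
by apply: eq_bigr => p _; rewrite addnC.
Qed.

Lemma sval_weight (nn m : V -> nat) : (forall v, (m v <= nn v)%N) ->
  sval (sh m) (weight Yv (fun=> 1%N) (fun v => (rest nn m v).+1))
    (weight (Yshift m) (fun v => (m v).+1) (fun v => (nn v).+1)).
Proof.
move=> le.
have nz v1 p1 v2 p2 : v1 != v2 \/ (p1 < p2)%N -> zz v1 p1 v2 p2 != 0.
  by move=> h; exact: zeps_neq0.
have sI v1 p1 v2 p2 : v1 != v2 \/ (p1 < p2)%N ->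
    sval (sh m) (zz v1 p1 v2 p2)^-1 (zz v1 (m v1 + p1) v2 (m v2 + p2))^-1.
  move=> h; apply: svalV; first exact: sval_zz.
  apply: nz; case: (eqVneq v1 v2) h => [<-|ne _]; last by left.
  by case=> // lt; right; rewrite ltn_add2l.
have b1 v (F : nat -> K) : \prod_((m v).+1 <= p < (nn v).+1) F p =
    \prod_(1 <= p < (rest nn m v).+1) F (m v + p)%N by exact: big_shift_nat.
have b2 n p2 (F : nat -> K) : \prod_(n.+1 <= p < n + p2) F p = \prod_(1 <= p < p2) F (n + p)%N.
  by rewrite -[in LHS](add1n n) big_addn addKn; apply: eq_bigr => p _; rewrite addnC.
apply: svalM; first apply: svalM; first apply: svalM.
- by apply: sval_prod => v _; rewrite b1; apply: sval_prod => p _; exact: sval_Yv.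
- apply: sval_prod => v _; rewrite b1.
  apply: sval_prod_nat => p2 /andP[h2 _]; rewrite (b2 (m v)).
  by apply: sval_prod_nat => p1 /andP[_ lt]; apply: sI; right.
- apply: sval_prod => v1 _; apply: sval_prod => v2 /andP[_ ne]; rewrite b1.
  apply: sval_prod => p1 _; rewrite b1; apply: sval_prod => p2 _.
  by apply: sI; left.
- apply: sval_prod => v1 _; apply: sval_prod => v2 /(ed_neq oe_orient) ne; rewrite b1.
  apply: sval_prod => p1 _; rewrite b1; apply: sval_prod => p2 _.
  by apply: sI; left.
Qed.

Lemma reg_points (E : shuffle g) m : in_shuffle E ->
  reg (pointsf pt m) (E (degf m)).
Proof.
move=> [_ hE]; apply: reg_shuffle => //; apply: (points_section _).1 => i.
by rewrite ffunE.
Qed.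

Lemma reg_points_after (G : shuffle g) (nn m : V -> nat) : in_shuffle G ->
  (forall v, (m v <= nn v)%N) ->
  sval (sh m) (rsubst (G (degf (rest nn m))) (pointsf pt (rest nn m)))
    (rsubst (G (degf (rest nn m))) (pointsf (pt_after pt m) (rest nn m))).
Proof.
move=> [_ hG] le.
have [io [io' [ioK io'K iot iop]]] := @points_enum C g a (rest nn m) (degf (rest nn m))
  (fun i => ffunE _ i).
apply: (sval_comp (t := pointsf (pt_after pt m) (rest nn m)) _ _).2.
  by move=> u; rewrite !iop; exact: sval_pt.
apply/reg_sval/reg_shuffle => // u u'; rewrite !iop => /(pt_inj eps_sign)[e].
have em : m (tag (io u)) = m (tag (io u')) by rewrite e.
by rewrite em => /addnI [e']; apply: (can_inj ioK); exact: boxes_eq.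
Qed.

Lemma sval_coefg_rest (G : shuffle g) (nn m : V -> nat) : in_shuffle G ->
  (forall v, (m v <= nn v)%N) ->
  sval (sh m) (coefg (G (degf (rest nn m))) (rest nn m))
    (rsubst (G (degf (rest nn m))) (pointsf (pt_after pt m) (rest nn m)) *
     weight (Yshift m) (fun v => (m v).+1) (fun v => (nn v).+1)).
Proof.
move=> hG le; rewrite coefgE; apply: svalM; first exact: reg_points_after.
exact: sval_weight.
Qed.

(** The multiplication rule of a skew algebra of functions of w and monomials U^m, where U^m passes
    a function by shifting it. [sval_star] gives the sum over m, and [weight_split] factors each
    summand. *)
Lemma coefg_star (F G : shuffle g) (nn : V -> nat) : in_shuffle F -> in_shuffle G ->
  coefg (star_eps eps F G (degf nn)) nn = \sum_(m : sub_occ nn)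
    coefg (F (degf m)) m * rsubst (coefg (G (degf (rest nn m))) (rest nn m)) (sh m).
Proof.
move=> hF hG; rewrite coefgE.
have := sval_star eps_sign (@pt_inj _ _ _ _ c eps_sign) (pt_zeps c eps_sign) nn hF hG.
move=> /svalP ->; apply: mul_sum_weight => m.
rewrite (svalP (sval_coefg_rest hG (sub_occ_le m))) coefgE.
apply: mul_weight_split.
have -> : \prod_(q : boxes (sub_occ_fun m)) \prod_(q' : boxes (rest nn (sub_occ_fun m)))
    zeps eps (tag (tag q)) (tag (tag q')) (ptq pt q - ptq (pt_after pt (sub_occ_fun m)) q') =
  \prod_v1 \prod_v2 \prod_(1 <= p1 < (sub_occ_fun m v1).+1)
    \prod_((sub_occ_fun m v2).+1 <= p2 < (nn v2).+1) zz v1 p1 v2 p2.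
  transitivity (\prod_(q : boxes (sub_occ_fun m)) \prod_v2 \prod_(1 <= p < (rest nn (sub_occ_fun m) v2).+1)
     zz (tag q) (tagged q).+1 v2 (sub_occ_fun m v2 + p)).
    apply: eq_bigr => q _.
    exact: (@prod_boxes C g a K (rest nn (sub_occ_fun m)) (fun v2 p => zz (tag q) (tagged q).+1 v2 (sub_occ_fun m v2 + p))).
  rewrite (@prod_boxes C g a K (sub_occ_fun m) (fun v1 p1 => \prod_v2 \prod_(1 <= p < (rest nn (sub_occ_fun m) v2).+1)
     zz v1 p1 v2 (sub_occ_fun m v2 + p))).
  apply: eq_bigr => v1 _; rewrite exchange_big /=; apply: eq_bigr => v2 _.
  by apply: eq_bigr => p1 _; rewrite (big_shift_nat _ (sub_occ_le m v2)).
apply: weight_split.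
- exact: sub_occ_le.
- by move=> v1 v2 p1 p2; exact: zeps_neq0.
- by move=> v1 v2 p1 p2; exact: zz_eq1.
- by move=> v1 v2 /andP[].
- exact: ed_neq.
- exact: ed_sc.
- exact: ed_asym.
- by move=> v p _; exact: Yv_after.
Qed.

End CoefStar.

(** * Integrality of the coefficients *)

Section KillMaps.
Variables (R : idomainType) (J : eqType) (ell : J -> R) (phi : J -> {rmorphism R -> R}).
Hypothesis phi_ker : forall j x, phi j x = 0 -> exists q, x = ell j * q.
Hypothesis phi_ell : forall j, phi j (ell j) = 0.
Hypothesis ell_neq0 : forall j, ell j != 0.

(** The kernel of [phi j] is prime, its target being a domain: as [phi j] kills F but none of the
    other forms, it kills the quotient of F by their product. Distinct forms are essential, since
    multiplicities are invisible to [phi j]. *)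
Lemma dvd_prod_distinct (s : seq J) (F : R) : uniq s ->
  (forall i j, i \in s -> j \in s -> i != j -> phi j (ell i) != 0) ->
  (forall j, j \in s -> phi j F = 0) -> exists q, F = (\prod_(j <- s) ell j) * q.
Proof.
elim: s => [|j s IH] /=; first by exists F; rewrite big_nil mul1r.
move=> /andP[js us] hd hF.
have [||q e] := IH us; [|by move=> i is_; apply: hF; rewrite inE is_ orbT|].
  by move=> i i' h h'; apply: hd; rewrite inE ?h ?h' orbT.
have := hF j (mem_head _ _); rewrite e rmorphM rmorph_prod => /eqP.
rewrite mulf_eq0 => /orP[|/eqP /phi_ker[q' ->]]; last first.
  by exists q'; rewrite big_cons mulrA [_ * ell j]mulrC.
rewrite prodf_seq_eq0 => /hasP[i is_ /=]; rewrite (negbTE (hd _ _ _ _ _)) //.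
- by rewrite inE is_ orbT.
- exact: mem_head.
- by apply: contraNneq js => <-.
Qed.

(** Here forms may repeat, as they are removed one at a time: each divides D Q and is prime to D. *)
Lemma dvd_cancel_coprime (s : seq J) (D Q x : R) :
  (forall j, j \in s -> phi j D != 0) -> (\prod_(j <- s) ell j) * x = D * Q ->
  exists q, Q = (\prod_(j <- s) ell j) * q.
Proof.
elim: s x Q => [|j s IH] x Q hD; first by exists Q; rewrite big_nil mul1r.
rewrite big_cons => e; have := congr1 (phi j) e.
rewrite !rmorphM phi_ell !mul0r => /esym/eqP; rewrite mulf_eq0.
rewrite (negbTE (hD _ (mem_head _ _))) /= => /eqP /phi_ker[q1 eq].
move: e; rewrite eq mulrCA -mulrA => /(mulfI (ell_neq0 j)) e.
have [|q ->] := IH x q1 _ e.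
  by move=> i is_; apply: hD; rewrite inE is_ orbT.
by exists q; rewrite mulrA.
Qed.

(** Coprimality is asked only across the groups [s t]; inside a group, whose product is assumed to
    divide F as a whole, forms may repeat. A group will be a pair of strings. *)
Lemma dvd_prod_coprime (T : eqType) (r : seq T) (s : T -> seq J) (F : R) : uniq r ->
  (forall t t' i j, t \in r -> t' \in r -> t != t' -> i \in s t -> j \in s t' ->
     phi j (ell i) != 0) ->
  (forall t, t \in r -> exists q, F = (\prod_(j <- s t) ell j) * q) ->
  exists q, F = (\prod_(t <- r) \prod_(j <- s t) ell j) * q.
Proof.
elim: r => [|t r IH] /=; first by exists F; rewrite big_nil mul1r.
move=> /andP[tr ur] hd hF.
have [||Q e] := IH ur; [|by move=> t' h; apply: hF; rewrite inE h orbT|].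
  by move=> t1 t2 i j h1 h2; apply: hd; rewrite inE ?h1 ?h2 orbT.
have [x ex] := hF t (mem_head _ _).
have [|q eq] := @dvd_cancel_coprime (s t) _ Q x _ (etrans (esym ex) e).
  move=> j js; rewrite rmorph_prod prodf_seq_neq0; apply/allP => t' t'r /=.
  rewrite rmorph_prod prodf_seq_neq0; apply/allP => i is_ /=.
  apply: (hd t' t) => //; [by rewrite inE t'r orbT|exact: mem_head|].
  by apply: contraNneq tr => <-.
by exists q; rewrite e eq big_cons mulrA; congr (_ * _); rewrite mulrC.
Qed.

End KillMaps.

Section PolySubst.
Variables (C : numFieldType) (g : simple_datum C).
Local Notation mdegree := (@mdegree C g).
Local Notation rpoly := (@rpoly C g).

Definition polysub (k n : mdegree) (x : box k -> rpoly n) (P : rpoly k) : rpoly n :=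
  mmap (@mpolyC _ C) (fun t => x (enum_val t)) P.
HB.instance Definition _ k n (x : box k -> rpoly n) :=
  GRing.RMorphism.copy (polysub x) (mmap (@mpolyC _ C) (fun t => x (enum_val t))).

Lemma polysubC k n (x : box k -> rpoly n) c : polysub x c%:MP = c%:MP.
Proof. by rewrite /polysub mmapC. Qed.

Lemma polysubX k n (x : box k -> rpoly n) v : polysub x (pvar v) = x v.
Proof. by rewrite /polysub mmapX mmap1U enum_rankK. Qed.

Lemma tofrac_polysub k n (x : box k -> rpoly n) P :
  tofrac (polysub x P) = psub (fun v => tofrac (x v)) P.
Proof.
apply: (rpoly_hom_ext (f := @tofrac (rpoly n) \o polysub x)
  (h := psub (fun v => tofrac (x v)))) => [c|v].
  by rewrite /= polysubC psubC.
by rewrite /= polysubX psubX.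
Qed.

Lemma polysub_comp k n l (x : box k -> rpoly n) (y : box n -> rpoly l) P :
  polysub y (polysub x P) = polysub (fun v => polysub y (x v)) P.
Proof.
apply: (rpoly_hom_ext (f := polysub y \o polysub x)
  (h := polysub (fun v => polysub y (x v)))) => [c|v].
  by rewrite /= !polysubC.
by rewrite /= !polysubX.
Qed.

Definition peval (k : mdegree) (z : box k -> C) (P : rpoly k) : C :=
  P.@[fun t => z (enum_val t)].
HB.instance Definition _ k (z : box k -> C) :=
  GRing.RMorphism.copy (peval z) (meval (fun t => z (enum_val t))).

Lemma pevalC k (z : box k -> C) c : peval z c%:MP = c.
Proof. by rewrite /peval mevalC. Qed.

Lemma pevalX k (z : box k -> C) v : peval z (pvar v) = z v.
Proof. by rewrite /peval mevalXU enum_rankK. Qed.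

Lemma peval_polysub k n (x : box k -> rpoly n) (z : box n -> C) P :
  peval z (polysub x P) = peval (fun v => peval z (x v)) P.
Proof.
apply: (rpoly_hom_ext (f := peval z \o polysub x)
  (h := peval (fun v => peval z (x v)))) => [c|v].
  by rewrite /= polysubC !pevalC.
by rewrite /= polysubX !pevalX.
Qed.

(** The wheel condition speaks of points with coordinates in the ground field; this turns it into
    the vanishing of polynomials. *)
Lemma peval_inj k (P : rpoly k) : (forall z, peval z P = 0) -> P = 0.
Proof.
move=> h; apply: mpoly_meval_inj => x.
have := h (fun v => x (enum_rank v)); rewrite /peval => <-.
by apply: meval_eq => t; rewrite enum_valK.
Qed.

Lemma symmetric_peval k (f : rpoly k) (s : {perm box k}) (z : box k -> C) :
  symmetric_rfun (tofrac f) -> colour_perm s ->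
  peval (fun v => z (s v)) f = peval z f.
Proof.
move=> hf cs; have := hf s cs; rewrite (svalP (sval_poly _ f)) => e.
have e' : polysub (fun v => pvar (s v)) f = f.
  by apply: tofrac_inj; rewrite tofrac_polysub -[RHS]e.
rewrite -[in RHS]e' peval_polysub.
by congr (peval _ f); apply: funext => v; rewrite pevalX.
Qed.

Definition elim_var (k : mdegree) (t : box k) (L : rpoly k) : box k -> rpoly k :=
  fun v => if v == t then L else pvar v.

Lemma elim_varP k (t : box k) (L : rpoly k) P :
  polysub (elim_var t L) P = 0 -> exists q, P = (pvar t - L) * q.
Proof.
move=> e; have [||q] := @mpoly_elim_var _ _ (enum_rank t) L (polysub (elim_var t L)) _ _ P.
- by move=> c; rewrite /= polysubC.
- move=> i; rewrite -[i]enum_valK /= polysubX /elim_var.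
  by rewrite (inj_eq enum_rank_inj).
by rewrite /= e add0r => ->; exists q.
Qed.

End PolySubst.

(** Allows the wheel condition, stated for the first variables of two colours, to be used for any
    boxes of these colours. The induction corrects a permutation by a transposition of two elements
    with equal [f]. *)
Lemma extend_fiber_perm (X Y : finType) (f : X -> Y) (l1 l2 : seq X) :
  uniq l1 -> uniq l2 -> map f l1 = map f l2 ->
  exists2 s : {perm X}, fiber_perm f s & map s l1 = l2.
Proof.
elim: l1 l2 => [|x l1 IH] [|y l2] //=; first by exists 1%g => //; apply/fiber_permP => x; rewrite perm1.
move=> /andP[xl u1] /andP[yl u2] [exy el].
have [s /fiber_permP cs e] := IH l2 u1 u2 el.
have tf z : f (tperm (s x) y z) = f z.
  by case: tpermP => // ->; rewrite ?cs exy.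
exists (s * tperm (s x) y)%g.
  by apply/fiber_permP => z; rewrite permM tf cs.
rewrite permM tpermL; congr (_ :: _); rewrite -e.
apply/eq_in_map => z zl; rewrite permM tpermD //.
  by apply: contraNneq xl => /perm_inj ->.
by apply: contraNneq yl => ->; rewrite -e map_f.
Qed.

Lemma link_arith (R : comPzRingType) (x y b c d : R) :
  x - y + (b - c + d) = x + b - (y + c - d).
Proof. by ring. Qed.

(** * Divisibility of the numerator by the wheel conditions *)

Section Integrality.
Variables (C : numFieldType) (g : simple_datum C) (a : mdegree g).
Local Notation I := 'I_(rk g).
Local Notation V := (box a).
Local Notation K := (rfun a).
Variables (eps : int) (c : I -> C) (oe : rel I).
Hypothesis eps_sign : eps = 1 \/ eps = -1.
Hypothesis oe_orient : is_orientation oe.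
Local Notation e := (eps%:~R : C).
Local Notation pt := (@pt C g a eps c).
Local Notation ed := (@ed C g a oe).

Definition pt_poly (v : V) (p : nat) : rpoly a :=
  pvar v + (c (tag v) - e * p%:R * dd (tag v))%:MP.

Lemma tofrac_pt_poly v p : tofrac (pt_poly v p) = pt v p.
Proof. by rewrite tofracD. Qed.

Definition link_cst (v : V) p v2 (q : nat) : C :=
  c (tag v) - e * p%:R * dd (tag v) - (c (tag v2) - e * 1%:R * dd (tag v2)) +
  e * (q%:R - (nlink v v2)%:R / 2) * dd (tag v2).
Definition link_poly (v : V) p v2 q : rpoly a := diff_poly v v2 (link_cst v p v2 q).

Lemma link_polyE v p v2 q : link_poly v p v2 q = pt_poly v p -
  (pt_poly v2 1 - (e * (q%:R - (nlink v v2)%:R / 2) * dd (tag v2))%:MP).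
Proof.
rewrite /link_poly /diff_poly /link_cst /pt_poly mpolyCD mpolyCB.
exact: link_arith.
Qed.

Lemma tofrac_link_poly v p v2 q :
  tofrac (link_poly v p v2 q) = link_factor eps c v p v2 1 q.
Proof.
rewrite tofrac_diff /link_factor pt_sub -[RHS]addrA -(rmorphD (@cst C g a)).
by congr (_ + cst a _); rewrite /link_cst; ring.
Qed.

Lemma absz_1B (v v2 : V) : ed v v2 -> absz (1 - cartan g (tag v2) (tag v)) = (nlink v v2).+1.
Proof.
move=> /(ed_linked oe_orient) /andP[ne _]; rewrite /nlink.
have : cartan g (tag v2) (tag v) <= 0 by apply: cartan_offdiag; rewrite eq_sym.
by case: (cartan g (tag v2) (tag v)) => [[|n]|n].
Qed.

Lemma cartan_nlink v v2 : ed v v2 ->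
  (cartan g (tag v2) (tag v))%:~R = - (nlink v v2)%:R :> C.
Proof.
move=> /(ed_linked oe_orient) /andP[ne _]; rewrite /nlink.
have : cartan g (tag v2) (tag v) <= 0 by apply: cartan_offdiag; rewrite eq_sym.
by case: (cartan g (tag v2) (tag v)) => [[|n]|n] //; rewrite oppr0.
Qed.

Section Degree.
Variables (k : mdegree g) (m : V -> nat) (f : rpoly k).
Hypotheses (f_sym : symmetric_rfun (tofrac f)) (f_wheel : wheel f).
Hypothesis k_m : forall i, k i = of_colour m i.
Variables (io : box k -> boxes m) (io' : boxes m -> box k).
Hypotheses (ioK : cancel io io') (io'K : cancel io' io).
Hypothesis io_tag : forall u, tag (tag (io u)) = tag u.

Definition at_points : rpoly a :=
  polysub (fun u => pt_poly (tag (io u)) (tagged (io u)).+1) f.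

Let bx v (p : 'I_(m v)) : box k := io' (Tagged (fun v => 'I_(m v)) p).

Let bx_inj v : injective (@bx v).
Proof. by move=> p p' /(can_inj io'K) /eqP; rewrite eq_Tagged => /eqP. Qed.

Let bx_tag v p : tag (@bx v p) = tag v.
Proof. by rewrite /bx -io_tag io'K. Qed.

(* The numerator vanishes when x_u1 and the string of v2 form a wheel. *)
Lemma wheel_vanish v1 v2 (u1 : box k) (q : 'I_(m v2)) (x0 : C) (Z : box k -> C) :
  ed v1 v2 -> tag u1 = tag v1 -> (nlink v1 v2 <= q)%N ->
  (forall p : 'I_(m v2), Z (bx p) = x0 - e * p%:R * dd (tag v2)) ->
  Z u1 = x0 - e * (q%:R - (nlink v1 v2)%:R / 2) * dd (tag v2) ->
  peval Z f = 0.
Proof.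
set n := nlink v1 v2 => hed tu1 nq Zp Zu.
have /andP[ne hl] := ed_linked oe_orient hed.
(* The wheel w, w - d, ..., w - n d occupies the positions q - n, ..., q of the string: in this
   order for eps = 1 and backwards for eps = -1, where the points increase. *)
pose pos (t : 'I_n.+1) : nat := if eps == 1 then (q - n + t)%N else (q - t)%N.
have pos_lt t : (pos t < m v2)%N.
  apply: leq_ltn_trans (ltn_ord q); rewrite /pos; case: ifP => _; last exact: leq_subr.
  by rewrite -leq_subRL ?leq_subr // subKn // -ltnS ltn_ord.
have pos_inj : injective (fun t => bx (Ordinal (pos_lt t))).
  move=> t t' /bx_inj /(congr1 val) /=; rewrite /pos => h; apply: val_inj.
  have le (s : 'I_n.+1) : (s <= q)%N by apply: leq_trans nq; rewrite -ltnS ltn_ord.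
  move: h; case: ifP => _; first by move=> /addnI.
  by move=> h; rewrite /= -(subKn (le t)) h subKn.
have kj : (n.+1 <= k (tag v2))%N.
  rewrite k_m /of_colour (bigD1 v2) //=; apply: leq_trans (leq_addr _ _).
  exact: leq_ltn_trans nq (ltn_ord q).
have ki : (0 < k (tag v1))%N.
  by rewrite -tu1; case: (u1) => i s /=; apply: leq_ltn_trans (ltn_ord s).
pose bj (t : 'I_n.+1) : box k :=
  Tagged (fun i => 'I_(k i)) (widen_ord kj t : 'I_(k (tag v2))).
pose bi : box k := Tagged (fun i => 'I_(k i)) (Ordinal ki).
have bj_inj : injective bj.
  by move=> t t' /eqP; rewrite eq_Tagged => /eqP /(congr1 val) /= /val_inj.
have [||| s cs] := @extend_fiber_perm _ _ (fun u : box k => tag u)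
  (bi :: [seq bj t | t <- enum 'I_n.+1])
  (u1 :: [seq bx (Ordinal (pos_lt t)) | t <- enum 'I_n.+1]).
- rewrite /= map_inj_uniq ?enum_uniq // andbT; apply/mapP => -[t _ h].
  by have := congr1 (fun u : box k => tag u) h => /= h'; rewrite h' eqxx in ne.
- rewrite /= map_inj_uniq ?enum_uniq // andbT; apply/mapP => -[t _ h].
  have := congr1 (fun u : box k => tag u) h => /= h'.
  by rewrite tu1 bx_tag in h'; rewrite h' eqxx in ne.
- rewrite /= tu1 -!map_comp; congr (_ :: _); apply: eq_map => t /=.
  by rewrite bx_tag.
move=> /= [es es']; rewrite -map_comp in es'; move/eq_in_map: es' => es'.
rewrite -(symmetric_peval _ f_sym cs).
have es2 t : s (bj t) = bx (Ordinal (pos_lt t)) := es' t (mem_enum _ t).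
have fw := f_wheel; rewrite /wheel in fw.
(* In the wheel condition the colour of [v2] plays the part of i and that of [v1] the part of j. *)
apply: (fw (tag v2) (tag v1) _ _ _ (x0 - e * (pos ord0)%:R * dd (tag v2))
  (fun v => Z (s v))).
- by rewrite -(linked_sym (tag v1)); apply/andP.
- by rewrite (absz_1B hed).
- by [].
- rewrite (absz_1B hed) => t lt; have := es2 (Ordinal lt).
  have -> : bj (Ordinal lt) = Tagged (fun i => 'I_(k i)) t.
    by congr existT; exact: val_inj.
  have tq : (t <= q)%N by apply: leq_trans nq; rewrite -ltnS.
  move=> ->; rewrite Zp /= /pos /=; case: eps_sign => ->.
    by rewrite eqxx addn0 natrD natrB //; ring.
  by rewrite /= subn0 natrB //; ring.
- move=> t t0; have -> : Tagged (fun i => 'I_(k i)) t = bi.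
    by congr existT; exact: val_inj.
  rewrite es Zu (cartan_nlink hed) -/n /pos; case: eps_sign => ->.
    by rewrite eqxx addn0 natrB //; field.
  by rewrite /= subn0; field.
Qed.

(** The range of q says that the string of [v2] contains the n + 1 consecutive points ending at
    position q that a wheel requires. The forms with q < n come from the numerators of Y instead. *)
Definition pair_prod v1 v2 : rpoly a :=
  \prod_(1 <= p < (m v1).+1) \prod_(nlink v1 v2 <= q < m v2) link_poly v1 p v2 q.

(** If the two d's agree, (p, q) and (p + 1, q + 1) give the same form in w, so multiplicities
    cannot be tested on w. Only the string of [v2] is specialised, to a progression from a free base
    point [r0]; the other variables stay free, and the forms for different (p, q) are then coprime.
    Sending the variables to the string points gives the claim. *)
Lemma pair_dvd v1 v2 : ed v1 v2 -> exists Q, at_points = pair_prod v1 v2 * Q.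
Proof.
move=> hed; have /andP[ne _] := ed_linked oe_orient hed.
have [le|lt] := leqP (m v2) (nlink v1 v2).
  exists at_points; rewrite /pair_prod big1 ?mul1r // => p _.
  by rewrite big_geq.
have m2 : (0 < m v2)%N by exact: leq_ltn_trans (leq0n _) lt.
pose r0 := bx (Ordinal m2).
pose cq (q : 'I_(m v2)) : C := e * (q%:R - (nlink v1 v2)%:R / 2) * dd (tag v2).
have cq_inj : injective cq.
  move=> q q' /(mulIf (lt0r_neq0 (dd_gt0 _))) /(mulfI (e_neq0 C eps_sign)) /addIr /eqP.
  by rewrite eqr_nat => /eqP; exact: val_inj.
pose x1 (u : box k) : rpoly k := if tag (io u) == v2
  then pvar r0 - (e * (tagged (io u))%:R * dd (tag v2))%:MP else pvar u.
pose Lq q : rpoly k := pvar r0 - (cq q)%:MP.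
pose ell (j : 'I_(m v1) * 'I_(m v2)) : rpoly k := pvar (bx j.1) - Lq j.2.
pose phi (j : 'I_(m v1) * 'I_(m v2)) : {rmorphism rpoly k -> rpoly k} :=
  polysub (elim_var (bx j.1) (Lq j.2)).
have r0_neq (p : 'I_(m v1)) : r0 != bx p.
  by apply: contraNneq ne => h; rewrite -(bx_tag p) -h bx_tag.
have phi_r0 j : phi j (pvar r0) = pvar r0.
  by rewrite /phi /= polysubX /elim_var (negbTE (r0_neq _)).
have phi_C j x : phi j x%:MP = x%:MP by rewrite /phi /= polysubC.
have phi_L j q : phi j (Lq q) = Lq q by rewrite /Lq rmorphB phi_r0 phi_C.
pose s := filter (fun j : 'I_(m v1) * 'I_(m v2) => (nlink v1 v2 <= j.2)%N)
  (enum {: 'I_(m v1) * 'I_(m v2)}).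
have [||||Q eQ] := @dvd_prod_distinct _ _ ell phi _ s (polysub x1 f).
- by move=> j x; exact: elim_varP.
- by rewrite filter_uniq ?enum_uniq.
- move=> [p q] [p' q'] _ _ nij; rewrite /ell rmorphB phi_L.
  have -> : phi (p', q') (pvar (bx p)) = if p == p' then Lq q' else pvar (bx p).
    by rewrite /phi /= polysubX /elim_var (inj_eq (@bx_inj _)).
  case: (eqVneq p p') => [epp|npp] /=; last first.
    rewrite /Lq opprB addrC -addrA addrC.
    have -> : - pvar r0 + pvar (bx p) + (cq q)%:MP = diff_poly (bx p) r0 (cq q).
      by rewrite /diff_poly [- _ + _]addrC.
    by apply: diff_poly_neq0; rewrite eq_sym.
  rewrite /Lq opprB [(cq q)%:MP - _]addrC addrACA subrr add0r addrC.
  rewrite -mpolyCN -mpolyCD mpolyC_eq0 subr_eq0.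
  apply: contraNneq nij => hc; rewrite epp xpair_eqE eqxx /=.
  by apply/eqP/cq_inj; rewrite hc.
- move=> [p q]; rewrite mem_filter /= => /andP[nq _]; apply: peval_inj => z.
  rewrite !peval_polysub; apply: (wheel_vanish (x0 := z r0) (u1 := bx p) (q := q) hed _ nq).
  + by rewrite bx_tag.
  + move=> t; rewrite /x1 io'K /= eqxx rmorphB /=.
    by rewrite !(pevalX, pevalC) /elim_var (negbTE (r0_neq _)) pevalX.
  + rewrite /x1 io'K /=.
    have -> : (v1 == v2) = false by apply: contraNF ne => /eqP ->.
    by rewrite pevalX /elim_var eqxx rmorphB /= pevalX pevalC.
pose th (u : box k) := pt_poly (tag (io u)) (tagged (io u)).+1.
(* The points of [v2] form the progression starting at the image of [r0], so specialising in two
   stages is the same as specialising at once. *)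
have eth : at_points = polysub th (polysub x1 f).
  rewrite polysub_comp; congr (polysub _ f); apply: funext => u; rewrite /x1.
  case: eqP => [h|_]; last by rewrite polysubX.
  rewrite rmorphB /= polysubX polysubC /th /r0 /bx io'K /=.
  move: (nat_of_ord (tagged (io u))) => t; rewrite h /pt_poly.
  rewrite -addrA -mpolyCB; congr (_ + _%:MP).
  by rewrite -natr1; ring.
exists (polysub th Q); rewrite eth eQ rmorphM rmorph_prod; congr (_ * _).
rewrite /pair_prod big_filter big_enum_cond /=.
rewrite -(pair_big_dep xpredT (fun _ (q : 'I_(m v2)) => (nlink v1 v2 <= q)%N)
  (fun p q => polysub th (ell (p, q)))) /=.
rewrite big_add1 big_mkord; apply: eq_bigr => p _.
rewrite big_geq_mkord; apply: eq_bigr => q _.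
rewrite link_polyE /ell /Lq !rmorphB /= !polysubX polysubC /th /r0 /bx !io'K.
by [].
Qed.

End Degree.
End Integrality.

Lemma coef_rearrange (K : fieldType) (k ln s q pp d x a sc lm lr : K) :
  x != 0 -> lm != 0 -> d != 0 -> s != 0 -> ln * pp = lr * lm ->
  k * ln / s * (pp * q / (d * x)) * a * sc * (x / lm) =
  k * s^-1 * q * d^-1 * a * sc * lr.
Proof.
move=> hx hm hd hs e; have -> : lr = ln * pp / lm by rewrite e mulfK.
by field; rewrite hx hm hd hs.
Qed.

(** One of the two ranges between n and m is empty. *)
Lemma prod_range_swap (K : fieldType) (F : nat -> K) (n m : nat) :
  \prod_(0 <= q < n) F q * \prod_(n <= q < m) F q =
  \prod_(m <= q < n) F q * \prod_(0 <= q < m) F q.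
Proof.
have [le|/ltnW le] := leqP n m.
  by rewrite [X in _ = X * _]big_geq // mul1r -big_cat_nat.
by rewrite [X in _ * X = _]big_geq // mulr1 mulrC -big_cat_nat.
Qed.

(** The pole denominator orders linked colours by their index, the formula for the homomorphism by
    the orientation; [S] collects the signs of the reversed pairs. *)
Lemma prod_orient (K : fieldType) (V : finType) (l r : rel V) (D S : V -> V -> K) :
  (forall v1 v2, r v1 v2 -> ~~ r v2 v1) ->
  (forall v1 v2, r v1 v2 -> l v2 v1 = ~~ l v1 v2) ->
  (forall v1 v2, r v1 v2 -> D v2 v1 = S v1 v2 * D v1 v2) ->
  \prod_v1 \prod_(v2 | l v1 v2 && (r v1 v2 || r v2 v1)) D v1 v2 =
  \prod_v1 \prod_(v2 | r v1 v2) (if l v1 v2 then 1 else S v1 v2) *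
  \prod_v1 \prod_(v2 | r v1 v2) D v1 v2.
Proof.
move=> r_asym rl DS.
transitivity (\prod_v1 \prod_(v2 | l v1 v2 && r v1 v2) D v1 v2 *
              \prod_v1 \prod_(v2 | l v1 v2 && r v2 v1) D v1 v2).
  rewrite -big_split /=; apply: eq_bigr => v1 _; rewrite (bigID (r v1)) /=.
  congr (_ * _); apply: eq_bigl => v2; rewrite -andbA; congr (_ && _).
    by case: (r v1 v2); rewrite ?andbF.
  by case: (boolP (r v1 v2)) => [/r_asym /negbTE -> //|_]; rewrite andbT.
rewrite [X in _ * X](exchange_big_dep predT) //= -!big_split /=.
apply: eq_bigr => v1 _; rewrite -big_split /= [RHS](bigID (l v1)) /=.
congr (_ * _).
  by apply: eq_big => [v2|v2 /andP[-> _]]; rewrite ?mul1r // andbC.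
apply: eq_big => [v2|v2 /andP[h1 h2]].
  by case: (boolP (r v1 v2)) => [/rl ->|]; rewrite ?andbT ?andbF.
by rewrite (DS _ _ h2); move: h1; rewrite (rl _ _ h2) => /negbTE ->.
Qed.

Lemma sub_sub_add (R : comPzRingType) (u y v x : R) : u - y - v + x = u - v + (x - y).
Proof. by ring. Qed.

Lemma sub_subr_add (R : comPzRingType) (v u y x : R) : v - (u - y) + x = v - u + (y + x).
Proof. by ring. Qed.

Lemma sub_add_sub (R : comPzRingType) (v u x : R) : v - u + x = v - (u - x).
Proof. by ring. Qed.

Lemma sub_sub_cancel (R : comPzRingType) (u x : R) : u - x - u + x = 0.
Proof. by ring. Qed.

(** * Membership of the coefficients in the localization *)

Section CoefLoc.
Variables (C : numFieldType) (g : simple_datum C) (a : mdegree g).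
Local Notation I := 'I_(rk g).
Local Notation V := (box a).
Local Notation K := (rfun a).
Variables (eps : int) (c : I -> C) (oe : rel I) (kap : V -> nat -> K).
Hypothesis eps_sign : eps = 1 \/ eps = -1.
Hypothesis oe_orient : is_orientation oe.
Local Notation e := (eps%:~R : C).
Local Notation cs := (@cst C g a).
Local Notation pt := (@pt C g a eps c).
Local Notation zz := (@zz C g a eps c).
Local Notation ed := (@ed C g a oe).
Local Notation sc := (@sc C g a).
Local Notation link_poly := (@link_poly C g a eps c).
Local Notation link_factor := (@link_factor C g a eps c).
Hypothesis kap_loc : forall v p, loc (kap v p).

Let link_elim (t : V * V) (x : C) : {rmorphism rpoly a -> rpoly a} :=
  polysub (elim_var t.1 (pvar t.2 - x%:MP)).

Let link_elim_neq0 (t t' : V * V) x y : ed t.1 t.2 -> ed t'.1 t'.2 -> t != t' ->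
  link_elim t' y (diff_poly t.1 t.2 x) != 0.
Proof.
case: t t' => [v1 v2] [u1 u2] /= h h' ne.
have n1 := ed_neq oe_orient h; have n2 := ed_neq oe_orient h'.
have E v : link_elim (u1, u2) y (pvar v) = if v == u1 then pvar u2 - y%:MP else pvar v.
  by rewrite /link_elim /= polysubX.
have EC : link_elim (u1, u2) y x%:MP = x%:MP by rewrite /link_elim /= polysubC.
rewrite /diff_poly rmorphD rmorphB EC !E.
have fold (v v' : V) (z : C) : pvar v - pvar v' + z%:MP = diff_poly v v' z by [].
case: (eqVneq v1 u1) ne n1 => [->|nu] ne n1.
  rewrite [v2 == u1]eq_sym (negbTE n1).
  have nv : u2 != v2 by apply: contraNneq ne => ->.
  have -> : pvar u2 - y%:MP - pvar v2 + x%:MP = diff_poly u2 v2 (x - y).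
    by rewrite /diff_poly mpolyCB; exact: sub_sub_add.
  exact: diff_poly_neq0.
case: (eqVneq v2 u1) ne n1 => [e2|nu'] ne n1; last by rewrite fold diff_poly_neq0.
(* The form of the reversed pair would be proportional, but an orientation never contains both
   directions of an edge. *)
have nv : v1 != u2.
  by apply: contraNneq (ed_asym oe_orient h') => <-; rewrite -e2.
have -> : pvar v1 - (pvar u2 - y%:MP) + x%:MP = diff_poly v1 u2 (y + x).
  by rewrite /diff_poly mpolyCD; exact: sub_subr_add.
exact: diff_poly_neq0.
Qed.

Lemma points_dvd (k : mdegree g) (m : V -> nat) (f : rpoly k) (io : box k -> boxes m) io' :
  symmetric_rfun (tofrac f) -> wheel f -> (forall i, k i = of_colour m i) ->
  cancel io io' -> cancel io' io -> (forall u, tag (tag (io u)) = tag u) ->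
  exists Q, at_points eps c f io =
    (\prod_v1 \prod_(v2 | ed v1 v2) pair_prod eps c m v1 v2) * Q.
Proof.
move=> fs fw hk ioK io'K iot.
pose T : finType := {t in [pred t : V * V | ed t.1 t.2]}.
have Ted (t : T) : ed (val t).1 (val t).2 by have := valP t.
pose J : eqType := (T * (nat * nat))%type.
pose x (j : J) := link_cst eps c (val j.1).1 j.2.1 (val j.1).2 j.2.2.
pose ell (j : J) : rpoly a := link_poly (val j.1).1 j.2.1 (val j.1).2 j.2.2.
pose phi (j : J) := link_elim (val j.1) (x j).
pose s (t : T) : seq J := [seq (t, (p, q)) | p <- index_iota 1 (m (val t).1).+1,
   q <- index_iota (nlink (val t).1 (val t).2) (m (val t).2)].
have [||||||Q eQ] := @dvd_prod_coprime _ J ell phi _ _ _ T (enum {: T}) s (at_points eps c f io).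
- move=> j y h; have [q ->] := elim_varP h; exists q; congr (_ * _).
  exact/esym/sub_add_sub.
- move=> [t [p q]]; rewrite /phi /ell /link_poly /diff_poly /link_elim /=.
  rewrite rmorphD rmorphB /= !polysubX polysubC /elim_var eqxx.
  rewrite [_ == (val t).1]eq_sym (negbTE (ed_neq oe_orient (Ted t))) /x /=.
  exact: sub_sub_cancel.
- by move=> [t [p q]]; apply: diff_poly_neq0; exact: ed_neq (Ted t).
- exact: enum_uniq.
- move=> t t' i j _ _ ne /allpairsP[[p q] [_ _ ->]] /allpairsP[[p' q'] [_ _ ->]].
  by apply: link_elim_neq0; rewrite ?Ted // (inj_eq val_inj).
- move=> t _; have [Q ->] := pair_dvd c eps_sign oe_orient fs fw hk io'K iot (Ted t).
  by exists Q; rewrite /s big_allpairs_dep.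
exists Q; rewrite eQ; congr (_ * _).
rewrite big_enum /= (pair_big_dep xpredT (fun v1 v2 => ed v1 v2)) /=.
rewrite (big_sub [pred t : V * V | ed t.1 t.2]) /=.
by apply: eq_bigr => t _; rewrite /s big_allpairs_dep.
Qed.

Local Notation Yv := (@Yv C g a eps c oe kap).

(** For equal colours the constants [c] cancel and an integer multiple of d remains, as in the
    inverted generators. *)
Lemma loc_inv_pt v v' p p' : tag v = tag v' -> v != v' -> loc (pt v p - pt v' p')^-1.
Proof.
move=> et ne; rewrite pt_sub.
have -> : c (tag v) - c (tag v') - e * p%:R * dd (tag v) + e * p'%:R * dd (tag v') =
    (eps * (p'%:Z - p%:Z))%:~R * dd (tag v).
  by rewrite -et rmorphM rmorphB /= -!pmulrn; ring.
exact: loc_inv_diff.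
Qed.

Lemma loc_pt v p : loc (pt v p).
Proof. by rewrite -tofrac_pt_poly; exact: loc_poly. Qed.

Lemma loc_link_factor v p v2 q : loc (link_factor v p v2 1 q).
Proof. by rewrite -tofrac_link_poly; exact: loc_poly. Qed.

Lemma zz_same_tag v1 p1 v2 p2 : tag v1 = tag v2 -> pt v1 p1 - pt v2 p2 != 0 ->
  (zz v1 p1 v2 p2)^-1 = (pt v1 p1 - pt v2 p2) / (pt v1 p1 - pt v2 p2.+1).
Proof.
move=> et nz; rewrite /zz (zepsE _ _ _ nz) -et -mulrA rform_diag pt_step // invf_div.
by [].
Qed.

Lemma loc_zz_same v p1 p2 : (p1 < p2)%N -> loc (zz v p1 v p2)^-1.
Proof.
move=> lt; rewrite zz_same_tag // !pt_sub_same.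
  by rewrite -(fmorphV cs) -(rmorphM cs); exact: locC.
rewrite cst_eq0 !mulf_neq0 ?(e_neq0 C eps_sign) ?(lt0r_neq0 (dd_gt0 _)) //.
by rewrite subr_eq0 eqr_nat gtn_eqF.
Qed.

Lemma loc_zz_sc v1 p1 v2 p2 : sc v1 v2 -> loc (zz v1 p1 v2 p2)^-1.
Proof.
move=> /andP[/eqP et ne]; rewrite zz_same_tag ?pt_sub_neq //.
apply: locM; last exact: loc_inv_pt.
by apply: locB; exact: loc_pt.
Qed.

Lemma prod_boxes_cond (R : comPzSemiRingType) (m : V -> nat) (P : pred V)
    (F : V -> nat -> R) :
  \prod_(q : boxes m | P (tag q)) F (tag q) (tagged q).+1 =
  \prod_(v | P v) \prod_(1 <= p < (m v).+1) F v p.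
Proof.
under [RHS]eq_bigr do rewrite big_add1 big_mkord.
rewrite [RHS](sig_big_dep P (fun _ _ => true) (fun v (p : 'I_(m v)) => F v p.+1)).
by apply: eq_bigl => q; rewrite andbT.
Qed.

Let D (m : V -> nat) v1 v2 : K := \prod_(1 <= p1 < (m v1).+1)
  \prod_(1 <= p2 < (m v2).+1) (pt v1 p1 - pt v2 p2).
Let S (m : V -> nat) v1 v2 : K := \prod_(1 <= p1 < (m v1).+1)
  \prod_(1 <= p2 < (m v2).+1) -1.

Lemma linked_ed v1 v2 : linked (tag v1) (tag v2) = ed v1 v2 || ed v2 v1.
Proof.
apply/idP/orP => [hl|[]]; last 2 first.
- exact: ed_linked.
- by rewrite linked_sym; exact: ed_linked.
have := oe_orient.2 _ _ hl; rewrite -/(ed v1 v2) -/(ed v2 v1).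
by case: (ed v2 v1) => h; [right|left].
Qed.

(** Both products run over the same pairs of points; [d] is the product of the signs, hence its own
    inverse. *)
Lemma pole_at_points (k : mdegree g) (m : V -> nat) (io : box k -> boxes m) io' :
  cancel io io' -> cancel io' io -> (forall u, tag (tag (io u)) = tag u) ->
  exists d, [/\ d != 0, loc d^-1 & \prod_(u : box k) \prod_(u' : box k |
       (tag u < tag u')%N && linked (tag u) (tag u')) (ptq pt (io u) - ptq pt (io u')) =
     d * \prod_v1 \prod_(v2 | ed v1 v2) D m v1 v2].
Proof.
move=> ioK io'K iot; pose l (v1 v2 : V) := (tag v1 < tag v2)%N.
have S2 v1 v2 : S m v1 v2 * S m v1 v2 = 1.
  rewrite /S -big_split big1 //= => p1 _; rewrite -big_split big1 //= => p2 _.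
  by rewrite mulrNN mulr1.
set d := \prod_v1 \prod_(v2 | ed v1 v2) (if l v1 v2 then 1 else S m v1 v2).
have d2 : d * d = 1.
  rewrite /d -big_split big1 //= => v1 _; rewrite -big_split big1 //= => v2 _.
  by case: ifP; rewrite ?mulr1 ?S2.
have d0 : d != 0 by apply: contra_eq_neq d2 => ->; rewrite mul0r eq_sym oner_neq0.
exists d; split=> //.
  have -> : d^-1 = d by rewrite -[LHS]mulr1 -d2 mulKf.
  apply: loc_prod => v1 _; apply: loc_prod => v2 _; case: ifP => _; first exact: loc1.
  by apply: loc_prod => p1 _; apply: loc_prod => p2 _; apply: locN; exact: loc1.
rewrite -(prod_orient (S := S m)); last first.
- move=> v1 v2 _; rewrite /D /S exchange_big /= -big_split /=; apply: eq_bigr => p1 _.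
  by rewrite -big_split /=; apply: eq_bigr => p2 _; rewrite mulN1r opprB.
- move=> v1 v2 /(ed_linked oe_orient) /andP[ne _].
  have ne' : (tag v2 != tag v1 :> nat) by rewrite eq_sym.
  by rewrite /l -leqNgt ltn_neqAle ne'.
- exact: (ed_asym oe_orient).
rewrite (reindex io') /=; last by exists io; [move=> ? _|move=> ? _].
have bij2 (P : pred (box k)) (F : box k -> K) :
    \prod_(u' | P u') F u' = \prod_(q | P (io' q)) F (io' q).
  by rewrite (reindex io') //=; exists io; [move=> ? _|move=> ? _].
under eq_bigr do rewrite bij2.
have e q : \prod_(q' | (tag (io' q) < tag (io' q'))%N && linked (tag (io' q)) (tag (io' q')))
      (ptq pt (io (io' q)) - ptq pt (io (io' q'))) =
    \prod_(v2 | l (tag q) v2 && (ed (tag q) v2 || ed v2 (tag q)))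
      \prod_(1 <= p2 < (m v2).+1) (pt (tag q) (tagged q).+1 - pt v2 p2).
  rewrite -(@prod_boxes_cond K m (fun v2 => l (tag q) v2 && (ed (tag q) v2 || ed v2 (tag q)))
    (fun v2 p2 => pt (tag q) (tagged q).+1 - pt v2 p2)).
  apply: eq_big => [q'|q' _]; last by rewrite !io'K.
  by rewrite -!(iot (io' _)) !io'K linked_ed.
rewrite (eq_bigr _ (fun q _ => e q)).
rewrite (@prod_boxes C g a K m (fun v1 p1 => \prod_(v2 | l v1 v2 && (ed v1 v2 || ed v2 v1))
   \prod_(1 <= p2 < (m v2).+1) (pt v1 p1 - pt v2 p2))).
by apply: eq_bigr => v1 _; rewrite exchange_big.
Qed.

(** X is both the pole of [E] at the points, up to sign, and the denominator of the zeta factors for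
    linked colours, so it cancels. The numerators LM of these zeta factors are absorbed by LN, from
    the W_j in Y, and PP, from the wheel conditions; a polynomial surplus LR is left where a string
    is shorter than n. Apart from [kap], the remaining denominators are constants or involve equal
    colours only. *)
Lemma coefg_loc (k : mdegree g) (E : rfun k) (m : V -> nat) :
  in_shuffle_deg E -> (forall i, k i = of_colour m i) -> loc (coefg eps c oe kap E m).
Proof.
move=> [_ [f [-> fs fw]]] hk.
have [io [io' [ioK io'K iot iop]]] := points_enum hk.
have p_inj : injective (pointsf pt m : box k -> K) := (points_section c eps_sign hk).1.
have [Q eQ] := points_dvd fs fw hk ioK io'K iot.
have [d [d0 dl ed_pole]] := pole_at_points ioK io'K iot.
pose X := \prod_v1 \prod_(v2 | ed v1 v2) D m v1 v2.
pose PP := \prod_v1 \prod_(v2 | ed v1 v2) \prod_(1 <= p < (m v1).+1)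
  \prod_(nlink v1 v2 <= q < m v2) link_factor v1 p v2 1 q.
pose LN := \prod_v1 \prod_(v2 | ed v1 v2) \prod_(1 <= p < (m v1).+1)
  \prod_(0 <= q < nlink v1 v2) link_factor v1 p v2 1 q.
pose LM := \prod_v1 \prod_(v2 | ed v1 v2) \prod_(1 <= p < (m v1).+1)
  \prod_(0 <= q < m v2) link_factor v1 p v2 1 q.
pose LR := \prod_v1 \prod_(v2 | ed v1 v2) \prod_(1 <= p < (m v1).+1)
  \prod_(m v2 <= q < nlink v1 v2) link_factor v1 p v2 1 q.
pose Kp := \prod_v \prod_(1 <= p < (m v).+1) kap v p.
pose Sd := \prod_v \prod_(1 <= p < (m v).+1) \prod_(v2 | sc v v2) (pt v p - pt v2 1).
have eE : rsubst (tofrac f / pole_denominator k) (pointsf pt m) = PP * tofrac Q / (d * X).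
  rewrite (svalP (sval_shuffle f p_inj)).
  have -> : psub (pointsf pt m) f = PP * tofrac Q.
    have -> : psub (pointsf pt m) f = tofrac (at_points eps c f io).
      rewrite tofrac_polysub; congr (psub _ f); apply: funext => u.
      by rewrite tofrac_pt_poly iop.
    rewrite eQ tofracM; congr (_ * _); rewrite /PP rmorph_prod; apply: eq_bigr => v1 _.
    rewrite rmorph_prod; apply: eq_bigr => v2 _; rewrite /pair_prod rmorph_prod.
    apply: eq_bigr => p _; rewrite rmorph_prod; apply: eq_bigr => q _.
    exact: tofrac_link_poly.
  congr (_ / _); rewrite /X -ed_pole.
  by apply: eq_bigr => u _; apply: eq_bigr => u' _; rewrite !iop.
have eY : \prod_v \prod_(1 <= p < (m v).+1) Yv v p = Kp * LN / Sd.
  have -> : LN = \prod_v \prod_(1 <= p < (m v).+1) \prod_(v2 | ed v v2)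
      \prod_(0 <= q < nlink v v2) link_factor v p v2 1 q.
    by apply: eq_bigr => v _; rewrite exchange_big.
  rewrite /Kp /Sd -big_split -prodf_div; apply: eq_bigr => v _.
  by rewrite -big_split -prodf_div; apply: eq_bigr => p _.
have eOE : \prod_v1 \prod_(v2 | ed v1 v2) \prod_(1 <= p1 < (m v1).+1)
     \prod_(1 <= p2 < (m v2).+1) (zz v1 p1 v2 p2)^-1 = X / LM.
  rewrite /X /LM -prodf_div; apply: eq_bigr => v1 _.
  rewrite -prodf_div; apply: eq_bigr => v2 hed; rewrite /D.
  rewrite -prodf_div; apply: eq_bigr => p1 _.
  have -> : \prod_(0 <= q < m v2) link_factor v1 p1 v2 1 q =
      \prod_(1 <= p2 < (m v2).+1) link_factor v1 p1 v2 p2 0.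
    rewrite big_add1; apply: eq_bigr => q _.
    by have := link_factor_shift eps c v1 p1 v2 1 0 q; rewrite addn0 add1n => ->.
  rewrite -prodf_div; apply: eq_bigr => p2 _.
  by rewrite (zz_num eps c oe_orient p1 p2 hed) invf_div.
have X0 : X != 0.
  apply/prodf_neq0 => v1 _; apply/prodf_neq0 => v2 hed.
  apply: prod_nat_neq0 => p1 _; apply: prod_nat_neq0 => p2 _.
  exact: pt_sub_neq (ed_neq oe_orient hed).
have LM0 : LM != 0.
  apply/prodf_neq0 => v1 _; apply/prodf_neq0 => v2 hed.
  apply: prod_nat_neq0 => p1 _; apply: prod_nat_neq0 => p2 _.
  exact: (link_factor_neq0 eps c oe_orient _ _ _ hed).
have Sd0 : Sd != 0.
  apply/prodf_neq0 => v _; apply: prod_nat_neq0 => p _.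
  by apply/prodf_neq0 => v2 /andP[_ ne]; exact: pt_sub_neq.
have eL : LN * PP = LR * LM.
  rewrite /LN /PP /LR /LM -!big_split; apply: eq_bigr => v1 _.
  rewrite -!big_split; apply: eq_bigr => v2 _; rewrite -!big_split.
  by apply: eq_bigr => p _; exact: prod_range_swap.
rewrite /coefg eE eY eOE.
rewrite (coef_rearrange _ _ _ _ X0 LM0 d0 Sd0 eL).
apply: locM; first apply: locM; first apply: locM; first apply: locM;
  first apply: locM; first apply: locM.
- by apply: loc_prod => v _; apply: loc_prod => p _; exact: kap_loc.
- rewrite /Sd -prodfV; apply: loc_prod => v _; rewrite -prodfV; apply: loc_prod => p _.
  rewrite -prodfV; apply: loc_prod => v2 /andP[/eqP et ne].
  exact: loc_inv_pt.
- exact: loc_poly.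
- exact: dl.
- apply: loc_prod => v _; rewrite big_nat_cond; apply: loc_prod => p2 _.
  rewrite big_nat_cond; apply: loc_prod => p1 /andP[/andP[_ lt] _].
  exact: loc_zz_same.
- apply: loc_prod => v1 _; apply: loc_prod => v2 hs.
  apply: loc_prod => p1 _; apply: loc_prod => p2 _; exact: loc_zz_sc.
- apply: loc_prod => v1 _; apply: loc_prod => v2 _.
  apply: loc_prod => p1 _; apply: loc_prod => p2 _; exact: loc_link_factor.
Qed.

End CoefLoc.

(** * The homomorphism *)

Lemma eq_big_support (T : eqType) (A : nmodType) (F : T -> A) (s1 s2 : seq T) :
  uniq s1 -> uniq s2 -> (forall x, x \notin s1 -> F x = 0) ->
  (forall x, x \notin s2 -> F x = 0) -> \sum_(x <- s1) F x = \sum_(x <- s2) F x.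
Proof.
move=> u1 u2 h1 h2.
have red s : \sum_(x <- s) F x = \sum_(x <- [seq x <- s | F x != 0]) F x.
  by rewrite big_filter (big_mkcond (fun x => F x != 0)); apply: eq_bigr => x _; case: eqP.
rewrite red [RHS]red; apply: perm_big; apply: uniq_perm; rewrite ?filter_uniq // => x.
rewrite !mem_filter; case: eqP => //= nz.
have i1 : x \in s1 by apply/negPn/negP => /h1.
have i2 : x \in s2 by apply/negPn/negP => /h2.
by rewrite i1 i2.
Qed.

Section Convolution.
Variables (C : numFieldType) (g : simple_datum C) (a : mdegree g) (S : pzRingType).
Local Notation V := (box a).
Local Notation T := {ffun V -> nat}.
Variables (x y u : T -> S) (z : T -> T -> S) (s1 s2 : seq T).
Local Notation addT m m' := ([ffun v => (m v + m' v)%N] : T).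
Local Notation occT m := ([ffun v => sub_occ_fun m v] : T).
Local Notation subT n m := ([ffun v => (n v - m v)%N] : T).
Hypothesis u_y : forall m m', u m * y m' = z m m' * u m.
Hypothesis u_u : forall m m', u m * u m' = u (addT m m').
Hypotheses (us1 : uniq s1) (us2 : uniq s2).
Hypothesis x_supp : forall m, m \notin s1 -> x m = 0.
Hypothesis z_supp : forall m m', m' \notin s2 -> z m m' = 0.

Definition conv (n : T) : S := \sum_(m : sub_occ n) x (occT m) * z (occT m) (subT n (occT m)).

(** Lists stand for finite supports, and any list outside which the terms vanish will do; [z m m']
    is [y m'] after [u m] has been moved past it. *)
Lemma conv_mul (t : seq T) : uniq t -> (forall n, n \notin t -> conv n = 0) ->
  (\sum_(m <- s1) x m * u m) * (\sum_(m <- s2) y m * u m) = \sum_(n <- t) conv n * u n.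
Proof.
move=> ut ht; pose h (p : T * T) := x p.1 * z p.1 p.2.
pose ad (p : T * T) : T := addT p.1 p.2.
pose pr := [seq (m, m') | m <- s1, m' <- s2].
have upr : uniq pr.
  by apply: allpairs_uniq => // -[m1 m2] [m1' m2'] _ _ [-> ->].
have hpr p : p \notin pr -> h p = 0.
  rewrite /h; case: (boolP (p.1 \in s1)) => [i1|/x_supp ->]; last by rewrite mul0r.
  case: (boolP (p.2 \in s2)) => [i2|/z_supp ->]; last by rewrite mulr0.
  by move=> /negP[]; apply/allpairsP; exists p; split=> //; case: p i1 i2.
transitivity (\sum_(p <- pr) h p * u (ad p)).
  rewrite mulr_suml big_allpairs; apply: eq_bigr => m _.
  rewrite mulr_sumr; apply: eq_bigr => m' _.
  by rewrite /h /= -mulrA [u m * _]mulrA u_y -!mulrA u_u.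
pose t0 := undup [seq ad p | p <- pr].
(* Pairs outside [pr] contribute 0, so the sum over the pairs in [pr] with sum n may be taken over
   all splittings of n. *)
have part n : \sum_(p <- pr | ad p == n) h p = conv n.
  rewrite big_mkcond /=.
  rewrite (eq_big_support (s2 := [seq (occT m, subT n (occT m)) | m : sub_occ n]) upr).
  - rewrite big_map big_enum /=; apply: eq_bigr => m _.
    rewrite (_ : _ == n) //; apply/eqP/ffunP => v; rewrite !ffunE subnKC //.
    exact: sub_occ_le.
  - rewrite map_inj_uniq ?enum_uniq // => m m' [/ffunP e _]; apply/ffunP => v.
    by apply: val_inj; have := e v; rewrite !ffunE.
  - by move=> p /hpr ->; rewrite if_same.
  - move=> p; case: eqP => // e np; case/negP: np; apply/mapP.
    have lt v : (p.1 v < (n v).+1)%N by rewrite -e ffunE ltnS leq_addr.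
    exists [ffun v => Ordinal (lt v)]; first by rewrite mem_enum.
    have e1 : occT (finfun (fun v => Ordinal (lt v)) : sub_occ n) = p.1.
      by apply/ffunP => v; rewrite ffunE /sub_occ_fun ffunE.
    rewrite e1; case: p e {lt e1} => m m' /= e; congr pair.
    by apply/ffunP => v; rewrite -e /ad !ffunE addKn.
rewrite (eq_big_support (s2 := t0) ut); last first.
- move=> n nt; rewrite -part big_seq_cond big1 ?mul0r // => p /andP[pp /eqP e].
  by case/negP: nt; rewrite mem_undup; apply/mapP; exists p.
- by move=> n /ht ->; rewrite mul0r.
- exact: undup_uniq.
under [RHS]eq_bigr do rewrite -part mulr_suml.
rewrite (exchange_big_dep predT) //= big_seq [RHS]big_seq; apply: eq_bigr => p pp.
rewrite (eq_bigl (fun n => n == ad p)); last by move=> n; rewrite eq_sym.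
rewrite -big_filter filter_pred1_uniq ?undup_uniq ?big_seq1 //.
by rewrite mem_undup; apply/mapP; exists p.
Qed.

End Convolution.

Lemma sum_mulDl (S : pzRingType) (T : Type) (s : seq T) (x y u : T -> S) :
  \sum_(m <- s) (x m + y m) * u m = \sum_(m <- s) x m * u m + \sum_(m <- s) y m * u m.
Proof. by rewrite -big_split; apply: eq_bigr => m _; exact: mulrDl. Qed.

Section Phit.
Variables (C : numFieldType) (g : simple_datum C) (a : mdegree g).
Local Notation I := 'I_(rk g).
Local Notation V := (box a).
Local Notation K := (rfun a).
Local Notation Osc := (osc a).
Local Notation T := {ffun V -> nat}.
Local Notation scal := (presented_scalar (@osc_rel C g a)).
Variables (eps : int) (c : I -> C) (oe : rel I) (kap : V -> nat -> K) (U : V -> Osc).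
Hypothesis eps_sign : eps = 1 \/ eps = -1.
Hypothesis oe_orient : is_orientation oe.
Hypothesis kap_loc : forall v p, loc (kap v p).
Hypothesis kap_shift : forall m v p, sval (@sh C g a eps m) (kap v p) (kap v (m v + p)).
Hypothesis U_ow : forall v v', U v * ow v' =
  (ow v' - scal (if v == v' then eps%:~R * dd (tag v) else 0)) * U v.
Hypothesis U_comm : forall v v', U v * U v' = U v' * U v.

Local Notation sh := (@sh C g a eps).
Local Notation coefg := (@coefg C g a eps c oe kap).

Definition Cf (E : shuffle g) (m : T) : K := coefg (E (degf m)) m.

Lemma degfE (m : V -> nat) i : degf m i = of_colour m i.
Proof. exact: ffunE. Qed.

Lemma Cf_loc E m : in_shuffle E -> loc (Cf E m).
Proof. by move=> [_ hE]; apply: coefg_loc => // i; exact: degfE. Qed.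

Lemma coefg0 (k : mdegree g) m : (forall i, k i = of_colour m i) -> coefg (0 : rfun k) m = 0.
Proof. by move=> hk; rewrite coefgE (svalP (sval0 _)) mul0r. Qed.

Lemma Cf_eq0 (E : shuffle g) (m : T) : E (degf m) = 0 -> Cf E m = 0.
Proof. by rewrite /Cf => ->; apply: coefg0 => i; exact: degfE. Qed.

Definition covers (E : shuffle g) (s : seq T) : Prop :=
  uniq s /\ forall m, m \notin s -> Cf E m = 0.

Definition occT k (m : occupation a k) : T := [ffun v => nat_of_ord (m v)].

Lemma occT_inj k : injective (@occT k).
Proof.
move=> m m' /ffunP e; apply/ffunP => v; apply: val_inj.
by have := e v; rewrite !ffunE.
Qed.

Lemma occ_okE k (m : occupation a k) : occ_ok m = (degf (occT m) == k).
Proof.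
have h i : of_colour (occT m) i = (\sum_(v : V | tag v == i) m v)%N.
  by apply: eq_bigr => v _; rewrite ffunE.
apply/forallP/eqP => [e|e i]; last by rewrite -h -degfE e.
by apply/ffunP => i; rewrite degfE h; exact/eqP.
Qed.

Lemma occT_surj k (m : T) : degf m = k -> exists m' : occupation a k, m = occT m'.
Proof.
move=> e; have lt v : (m v < (\sum_i k i).+1)%N.
  rewrite ltnS -e (bigD1 (tag v)) //= degfE /of_colour (bigD1 v) //= -addnA.
  exact: leq_addr.
exists [ffun v => Ordinal (lt v)]; apply/ffunP => v.
by rewrite !ffunE.
Qed.

Lemma covers_homogeneous k (E : shuffle g) : homogeneous k E ->
  covers E [seq occT m | m <- enum {: occupation a k} & occ_ok m].
Proof.
move=> hE; split; first by rewrite (map_inj_uniq (@occT_inj k)) filter_uniq ?enum_uniq.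
move=> m nm; apply: Cf_eq0; apply: hE; apply: contra nm => /eqP e.
have [m' em] := occT_surj e; rewrite em; apply/mapP; exists m' => //.
by rewrite mem_filter mem_enum andbT occ_okE -em e.
Qed.

Lemma covers_exists (E : shuffle g) : in_shuffle E -> exists s, covers E s.
Proof.
move=> [[s0 hs] _]; exists (undup (flatten [seq [seq occT m | m <- enum {: occupation a k}] | k <- s0])).
split=> [|m]; first exact: undup_uniq.
rewrite mem_undup => nm; apply: Cf_eq0; apply: hs; apply: contra nm => ks.
have [m' em] := occT_surj (erefl (degf m)).
apply/flatten_mapP; exists (degf m) => //; rewrite {1}em.
by apply/mapP; exists m'; rewrite ?mem_enum.
Qed.

(* The sum over all occupations; since a shuffle element has finitely many
   components, some finite list contains all nonzero coefficients, and the
   value does not depend on the list chosen by xget. *)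
Definition phit (E : shuffle g) : Osc :=
  \sum_(m <- classical_sets.xget [::] (covers E)) oscv (Cf E m) * umon U m.

Lemma phitE E s : covers E s -> phit E = \sum_(m <- s) oscv (Cf E m) * umon U m.
Proof.
move=> hs; rewrite /phit; case: classical_sets.xgetP => [s' _ hs'|/(_ s)//].
have z (m : T) : Cf E m = 0 -> oscv (Cf E m) * umon U m = 0.
  by move=> ->; rewrite oscv0; exact: mul0r.
case: hs => us zs; case: hs' => us' zs'.
by apply: eq_big_support => // m nm; apply: z; [exact: zs'|exact: zs].
Qed.

Lemma covers_widen E s s' : covers E s -> uniq s' -> {subset s <= s'} -> covers E s'.
Proof.
move=> [us h] us' sub; split=> // m nm; apply: h; apply: contra nm; exact: sub.
Qed.

Lemma CfD E F m : in_shuffle E -> in_shuffle F ->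
  Cf (fun k => E k + F k) m = Cf E m + Cf F m.
Proof.
move=> hE hF; rewrite /Cf !coefgE.
have rE := reg_sval (reg_points c eps_sign m hE).
have rF := reg_sval (reg_points c eps_sign m hF).
by rewrite (svalP (svalD rE rF)) mulrDl.
Qed.

Lemma CfZ x E m : in_shuffle E -> Cf (fun k => cst k x * E k) m = cst a x * Cf E m.
Proof.
move=> hE; rewrite /Cf !coefgE.
have rE := reg_sval (reg_points c eps_sign m hE).
by rewrite (svalP (svalM (svalC _ x) rE)) mulrA.
Qed.

Lemma phitD E F : in_shuffle E -> in_shuffle F ->
  phit (fun k => E k + F k) = phit E + phit F.
Proof.
move=> hE hF; have [s1 c1] := covers_exists hE; have [s2 c2] := covers_exists hF.
pose s := undup (s1 ++ s2).
have c1' : covers E s.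
  by apply: covers_widen c1 (undup_uniq _) _ => m h; rewrite mem_undup mem_cat h.
have c2' : covers F s.
  by apply: covers_widen c2 (undup_uniq _) _ => m h; rewrite mem_undup mem_cat h orbT.
have c3 : covers (fun k => E k + F k) s.
  split=> [|m nm]; first exact: undup_uniq.
  by rewrite CfD // c1'.2 // c2'.2 // addr0.
rewrite (phitE c1') (phitE c2') (phitE c3).
apply: etrans (sum_mulDl s (fun m => oscv (Cf E m)) (fun m => oscv (Cf F m)) (fun m => umon U m)).
apply: eq_bigr => m _; apply: (congr1 (fun z => z * umon U m)).
exact: etrans (congr1 (@oscv _ _ _) (CfD m hE hF)) (oscvD (Cf_loc m hE) (Cf_loc m hF)).
Qed.

Lemma phitZ x E : in_shuffle E -> phit (fun k => cst k x * E k) = x *: phit E.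
Proof.
move=> hE; have [s c1] := covers_exists hE.
have c2 : covers (fun k => cst k x * E k) s.
  by split=> [|m nm]; [exact: c1.1|rewrite CfZ // c1.2 // mulr0].
rewrite (phitE c1) (phitE c2) scaler_sumr; apply: eq_bigr => m _.
apply: etrans _ (esym (presented_scalerAl _ _ _)); apply: (congr1 (fun z => z * umon U m)).
exact: etrans (congr1 (@oscv _ _ _) (CfZ x m hE)) (oscvZ x (Cf_loc m hE)).
Qed.

Lemma umon_oscv m f : loc f -> loc (rsubst f (sh m)) /\
  umon U m * oscv f = oscv (rsubst f (sh m)) * umon U m.
Proof.
move=> hf; have [f' [x' [h1 h2 h3]]] := umon_osc_value U_ow m (oscvP hf).
rewrite (svalP h1); split; first by exists x'.
by rewrite (oscvE h2).
Qed.

Local Notation addT m m' := ([ffun v => (m v + m' v)%N] : T).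

Lemma Cf_star F G (n : T) : in_shuffle F -> in_shuffle G ->
  Cf (star_eps eps F G) n = \sum_(m : sub_occ n)
    Cf F [ffun v => sub_occ_fun m v] *
    rsubst (Cf G [ffun v => (n v - [ffun v => sub_occ_fun m v] v)%N])
           (sh ([ffun v => sub_occ_fun m v] : T)).
Proof.
move=> hF hG; apply: etrans (coefg_star c eps_sign oe_orient kap_shift n hF hG) _.
apply: eq_bigr => m _.
have e1 : (([ffun v => sub_occ_fun m v] : T) : V -> nat) = sub_occ_fun m.
  by apply: funext => v; rewrite ffunE.
have e2 : (([ffun v => (n v - [ffun v => sub_occ_fun m v] v)%N] : T) : V -> nat) =
    rest n (sub_occ_fun m).
  by apply: funext => v; rewrite !ffunE.
by rewrite /Cf e2 e1.
Qed.

Lemma phitM F G : in_shuffle F -> in_shuffle G ->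
  phit (star_eps eps F G) = phit F * phit G.
Proof.
move=> hF hG; have [s1 [us1 c1]] := covers_exists hF.
have [s2 [us2 c2]] := covers_exists hG.
pose ad (m m' : T) : T := addT m m'.
pose t := undup [seq ad m m' | m <- s1, m' <- s2].
have z0 m m' : m' \notin s2 -> rsubst (Cf G m') (sh (m : T)) = 0.
  by move=> /c2 ->; exact: svalP (sval0 _).
have ct : covers (star_eps eps F G) t.
  split=> [|n nt]; first exact: undup_uniq.
  rewrite Cf_star // big1 // => m _.
  set m1 : T := [ffun v => sub_occ_fun m v]; set m2 : T := [ffun v => _].
  case: (boolP (m1 \in s1)) => [i1|/c1 ->]; last by rewrite mul0r.
  case: (boolP (m2 \in s2)) => [i2|n2]; last by rewrite z0 ?mulr0.
  case/negP: nt; rewrite mem_undup; apply/allpairsP; exists (m1, m2); split=> //.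
  by apply/ffunP => v; rewrite /ad !ffunE subnKC // sub_occ_le.
rewrite (phitE ct) (phitE (conj us1 c1)) (phitE (conj us2 c2)).
pose x (m : T) := oscv (Cf F m); pose y (m : T) := oscv (Cf G m).
pose u (m : T) := umon U m.
pose z (m m' : T) : Osc := oscv (rsubst (Cf G m') (sh m)).
have convE n : conv x z n = oscv (Cf (star_eps eps F G) n).
  rewrite Cf_star // oscv_sum.
    apply: eq_bigr => m _; apply/esym/oscvM; first exact: Cf_loc.
    by apply: (umon_oscv _ _).1; exact: Cf_loc.
  move=> m _; apply: locM; first exact: Cf_loc.
  by apply: (umon_oscv _ _).1; exact: Cf_loc.
rewrite (@conv_mul C g a Osc x y u z s1 s2 _ _ us1 us2 _ _ t ct.1).
- by apply: eq_bigr => n _; rewrite convE.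
- by move=> m m'; apply: (umon_oscv _ _).2; exact: Cf_loc.
- move=> m m'; apply: etrans (esym (umonD U_comm m m')) _.
  by congr (umon U _); apply: funext => v; rewrite ffunE.
- by move=> m /c1 e; rewrite /x e oscv0.
- by move=> m m' /z0 e; rewrite /z e oscv0.
- by move=> n /ct.2 e; rewrite convE e oscv0.
Qed.

End Phit.

(** * The explicit formula, the unit and the generators *)

Section PhitFormula.
Variables (C : numFieldType) (g : simple_datum C) (a : mdegree g).
Local Notation I := 'I_(rk g).
Local Notation V := (box a).
Local Notation K := (rfun a).
Local Notation Osc := (osc a).
Local Notation T := {ffun V -> nat}.
Local Notation scal := (presented_scalar (@osc_rel C g a)).
Variables (eps : int) (c : I -> C) (oe : rel I) (kap : V -> nat -> K) (U : V -> Osc).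
Hypothesis eps_sign : eps = 1 \/ eps = -1.
Hypothesis oe_orient : is_orientation oe.
Hypothesis kap_loc : forall v p, loc (kap v p).
Local Notation coefg := (@coefg C g a eps c oe kap).
Local Notation Cf := (@Cf C g a eps c oe kap).
Local Notation phit := (@phit C g a eps c oe kap U).
Local Notation covers := (@covers C g a eps c oe kap).

Lemma sum_osc_prod (k : mdegree g) (E : shuffle g) : in_shuffle E -> homogeneous k E ->
  exists c0 : occupation a k -> Osc,
    (forall m, occ_ok m -> osc_value (coefg (E k) (fun v => nat_of_ord (m v))) (c0 m)) /\
    phit E = \sum_(m : occupation a k | occ_ok m) c0 m * \prod_(v : V) U v ^+ m v.
Proof.
move=> hE hk; exists (fun m => oscv (coefg (E k) (fun v => nat_of_ord (m v)))).
have eT (m : occupation a k) : ((occT m : T) : V -> nat) = (fun v => nat_of_ord (m v)).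
  by apply: funext => v; rewrite ffunE.
have eC (m : occupation a k) : occ_ok m -> Cf E (occT m) = coefg (E k) (fun v => nat_of_ord (m v)).
  rewrite occ_okE => /eqP e; rewrite /Cf e.
  by rewrite eT.
split=> [m ok|]; first by rewrite -eC //; apply: oscvP; exact: Cf_loc.
rewrite (phitE U (covers_homogeneous eps c oe kap hk)) big_map big_filter big_enum_cond /=.
apply: eq_bigr => m ok; rewrite (eC _ ok); congr (_ * _).
by apply: eq_bigr => v _; rewrite ffunE.
Qed.

Lemma weight_empty (m : V -> nat) (Y : V -> nat -> K) : (forall v, m v = 0%N) ->
  weight (@sc C g a) (@ed C g a oe) (@zz C g a eps c) Y (fun=> 1%N) (fun v => (m v).+1) = 1.
Proof.
move=> m0; rewrite /weight.
have e (x y z t : K) : x = 1 -> y = 1 -> z = 1 -> t = 1 -> x * y * z * t = 1.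
  by move=> -> -> -> ->; rewrite !mulr1.
apply: e.
- by rewrite big1 // => v _; rewrite m0 big_geq.
- by rewrite big1 // => v _; rewrite m0 big_geq.
- by rewrite big1 // => v _; rewrite big1 // => v2 _; rewrite m0 big_geq.
- by rewrite big1 // => v _; rewrite big1 // => v2 _; rewrite m0 big_geq.
Qed.

Lemma phit1 : phit (fun k => if k == [ffun=> 0%N] then 1 else 0) = 1.
Proof.
set E : shuffle g := fun k => _; pose z : T := [ffun=> 0%N].
have z0 v : z v = 0%N by rewrite ffunE.
have dz : degf z = [ffun=> 0%N].
  by apply/ffunP => i; rewrite degfE [RHS]ffunE /of_colour big1 // => v _; rewrite z0.
have cov : covers E [:: z].
  split=> // m; rewrite inE => nm; apply: Cf_eq0; rewrite /E; case: eqP => // e.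
  case/negP: nm; apply/eqP/ffunP => v; rewrite z0; apply/eqP.
  have := congr1 (fun f : mdegree g => f (tag v)) e; rewrite degfE ffunE => /eqP.
  by rewrite /of_colour sum_nat_eq0 => /forallP/(_ v); rewrite eqxx.
rewrite (phitE U cov) big_seq1.
have eU : umon U z = 1 by rewrite /umon big1 // => v _; rewrite z0 expr0.
have -> : Cf E z = 1.
  rewrite /Cf coefgE /E dz eqxx (svalP (sval1 _)).
  have h := weight_empty (Yv eps c oe kap) z0; exact: etrans (mul1r _) h.
rewrite oscv1 eU; exact: mul1r.
Qed.

Definition delta (v : V) : T := [ffun v' => (v' == v) : nat].

Lemma degf_delta v : degf (delta v) = unit_degree (tag v).
Proof.
apply/ffunP => i; rewrite degfE ffunE /of_colour.
have [->|ne] := eqVneq i (tag v).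
  rewrite (bigD1 v) //= ffunE eqxx big1 // => v' /andP[_ /negbTE nv].
  by rewrite ffunE nv.
rewrite big1 // => v' /eqP tv'; rewrite ffunE; case: eqP => // e.
by rewrite -tv' e eqxx in ne.
Qed.

Lemma unit_degree_delta (m : T) i : degf m = unit_degree i ->
  exists2 v, tag v == i & m = delta v.
Proof.
move=> e; have ed i' : of_colour m i' = (i' == i) by rewrite -degfE e ffunE.
have [v tv mv] : exists2 v, tag v == i & (0 < m v)%N.
  have /eqP := ed i; rewrite eqxx /of_colour.
  case: (boolP [exists v, (tag v == i) && (0 < m v)%N]) => [/existsP[v /andP[]]|h].
    by exists v.
  rewrite big1 // => v tv; apply/eqP; rewrite -leqn0 leqNgt.
  by apply: contra h => h; apply/existsP; exists v; rewrite tv.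
exists v => //; have := ed i; rewrite eqxx /of_colour (bigD1 v) //=.
case em : (m v) mv => [//|[|n]] _; rewrite ?addSn // add0n => -[/eqP].
rewrite sum_nat_eq0 => /forallP h.
apply/ffunP => v'; rewrite ffunE; have [->//|nv] := eqVneq v' v.
case: (eqVneq (tag v') i) => [tv'|nt].
  by apply/eqP; have := h v'; rewrite tv' eqxx nv.
have := ed (tag v'); rewrite (negbTE nt) /of_colour => /eqP.
by rewrite sum_nat_eq0 => /forallP/(_ v'); rewrite eqxx => /eqP.
Qed.

(** A single occupied box leaves no pair of points, hence no zeta factor. *)
Lemma weight_delta v (Y : V -> nat -> K) :
  weight (@sc C g a) (@ed C g a oe) (@zz C g a eps c) Y (fun=> 1%N)
    (fun v' => (delta v v').+1) = Y v 1%N.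
Proof.
have e (x y z t r : K) : x = r -> y = 1 -> z = 1 -> t = 1 -> x * y * z * t = r.
  by move=> -> -> -> ->; rewrite !mulr1.
have dE v' : delta v v' = (v' == v) by rewrite ffunE.
have pair (v1 v2 : V) (F : nat -> nat -> K) : v1 != v2 ->
    \prod_(1 <= p1 < (delta v v1).+1) \prod_(1 <= p2 < (delta v v2).+1) F p1 p2 = 1.
  move=> ne; case: (eqVneq v1 v) => [e1|n1]; last by rewrite dE (negbTE n1) big_geq.
  rewrite big1 // => p _; rewrite dE big_geq //.
  by case: eqP => // e2; rewrite e1 e2 eqxx in ne.
apply: e.
- rewrite (bigD1 v) //= dE eqxx big_nat1 big1 ?mulr1 // => v' /negbTE nv.
  by rewrite dE nv big_geq.
- rewrite big1 // => v' _; rewrite big_nat_cond big1 // => p2 /andP[/andP[_]].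
  rewrite dE ltnS => le _; rewrite big_geq //.
  by apply: leq_trans le _; case: eqP.
- by rewrite big1 // => v1 _; rewrite big1 // => v2 /andP[_ ne]; exact: pair.
- by rewrite big1 // => v1 _; rewrite big1 // => v2 /(ed_neq oe_orient) ne; exact: pair.
Qed.

(** The occupations of unit degree are those with one point on one string, so the general formula
    collapses to the shape that Phi prescribes on a generator. *)
Lemma phit_gen i n : in_shuffle (shuffle_gen i n) ->
  phit (shuffle_gen i n) = \sum_(v | tag v == i)
    oscv (Yv eps c oe kap v 1 * pt eps c v 1 ^+ n) * U v.
Proof.
move=> hE; set E := shuffle_gen i n in hE *.
have dinj : injective delta.
  move=> v v' /ffunP/(_ v); rewrite !ffunE eqxx.
  by case: eqP.
have cov : covers E [seq delta v | v <- enum {: V} & tag v == i].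
  split=> [|m nm]; first by rewrite map_inj_uniq // filter_uniq ?enum_uniq.
  apply: Cf_eq0; rewrite /E /shuffle_gen; case: eqP => // /unit_degree_delta[v tv em].
  by case/negP: nm; rewrite em; apply/mapP; exists v; rewrite // mem_filter tv mem_enum.
rewrite (phitE U cov) big_map big_filter big_enum_cond /=.
apply: eq_bigr => v /eqP tv.
have -> : umon U (delta v) = U v.
  by rewrite /umon (big_only1 v) //= => [|v' /negbTE nv _]; rewrite ffunE ?eqxx ?nv.
apply: (congr1 (fun z => oscv z * U v)).
rewrite /Cf coefgE weight_delta.
suff -> : rsubst (E (degf (delta v))) (pointsf (pt eps c) (delta v)) = pt eps c v 1 ^+ n.
  exact: mulrC.
rewrite /E degf_delta tv /shuffle_gen eqxx.
have lt : (0 < unit_degree i i)%N by rewrite ffunE eqxx.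
have -> : xvar (unit_degree i) i 0 =
    var (Tagged (fun i' => 'I_((unit_degree i) i')) (Ordinal lt)).
  exact: (xvarE (Ordinal lt)).
rewrite (svalP (svalXn n (svalX _ _))); congr (_ ^+ n).
have hk i' : unit_degree i i' = of_colour (delta v) i'.
  by rewrite -tv -degf_delta degfE.
have [io [io' [ioK io'K iot iop]]] := points_enum hk.
rewrite iop /ptq; set q := io _.
have lt1 : (tagged q < (tag q == v))%N.
  by apply: leq_trans (ltn_ord (tagged q)) _; rewrite /delta ffunE.
have eq_pt w p : (p < (w == v))%N -> pt eps c w p.+1 = pt eps c v 1.
  by case: eqP => [->|//]; rewrite ltnS leqn0 => /eqP ->.
exact: eq_pt lt1.
Qed.

End PhitFormula.

(** * The two halves *)

Lemma mul5_congr (R : pzRingType) (x1 x2 x3 x4 x5 y1 y2 y3 y4 y5 : R) :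
  x1 = y1 -> x2 = y2 -> x3 = y3 -> x4 = y4 -> x5 = y5 ->
  x1 * x2 * x3 * x4 * x5 = y1 * y2 * y3 * y4 * y5.
Proof. by move=> -> -> -> -> ->. Qed.

Lemma div_scaled_den (F : fieldType) (x d w : F) : x / (d * w) = d^-1 * x / w.
Proof. by rewrite invfM mulrA [x * _]mulrC. Qed.

Lemma opp_mul_div (F : fieldType) (z x w : F) : - (z * x / w) = - z * x / w.
Proof. by rewrite !mulNr. Qed.

Lemma prod_colours (C : numFieldType) (g : simple_datum C) (a : mdegree g)
    (R : comPzSemiRingType) (P : pred 'I_(rk g)) (n : 'I_(rk g) -> nat)
    (F : 'I_(rk g) -> nat -> box a -> R) :
  \prod_(j | P j) \prod_(1 <= p < (n j).+1) \prod_(v | tag v == j) F j p v =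
  \prod_(v | P (tag v)) \prod_(1 <= p < (n (tag v)).+1) F (tag v) p v.
Proof.
rewrite [RHS](partition_big (fun v : box a => tag v) P) //=.
apply: eq_bigr => j Pj; rewrite exchange_big /=.
apply: eq_big => [v|v /eqP <- //].
by case: eqP => [->|]; rewrite ?Pj ?andbF.
Qed.

Lemma prod_nat_rev (R : comPzSemiRingType) n (F : nat -> R) :
  \prod_(1 <= q < n.+1) F (n - q)%N = \prod_(0 <= q < n) F q.
Proof. by rewrite big_add1 [RHS]big_nat_rev. Qed.

Lemma additive_regroup (A B : zmodType) (f : {additive A -> B}) (x w : B) (s t u r : A) :
  r = u - s - t -> x - f s - f t - w = x - (w + f u) + f r.
Proof.
move=> ->; rewrite !raddfB -!addrA; congr (x + _).
by rewrite opprD -[RHS]addrA addKr addrA addrC.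
Qed.

(** * Comparison of the two explicit formulas with their common form *)

Section Translation.
Variables (C : numFieldType) (g : simple_datum C) (a : mdegree g).
Local Notation I := 'I_(rk g).
Local Notation V := (box a).
Local Notation K := (rfun a).
Local Notation cs := (@cst C g a).
Variables (o : rel I) (M : nat) (cw : 'I_M -> I) (zs : 'I_M -> C).
Hypothesis o_orient : is_orientation o.

(** [ed v v2] has to say that the colour of v2 occurs among the W_j in the Y of v. For Y these are
    the j with j -> i, for Y' those with i -> j, so the E half takes the opposite orientation. *)
Definition op_rel : rel I := fun i j => o j i.

Lemma op_orient : is_orientation op_rel.
Proof.
case: o_orient => h1 h2; split=> [i j /h1|i j]; first by rewrite linked_sym.
by rewrite linked_sym => /h2.
Qed.

Definition kap_plus (v : V) (p : nat) : K := (cs (dd (tag v)))^-1.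
(** Y' is taken at w + (p - 1) d and contains Z_i(z + d_i), so Z_i is evaluated at the p-th point
    itself. *)
Definition kap_minus (v : V) (p : nat) : K :=
  - Zfun cw zs (tag v) (pt (-1) (fun=> 0) v p).

Lemma pt_plusE : pt 1 (@dd C g) = @pt_plus C g a.
Proof.
apply: funext => v; apply: funext => p; rewrite /pt /pt_plus -(rmorphN cs).
by congr (_ + cs _); rewrite mulr1z; ring.
Qed.

Lemma pt_minusE : pt (-1) (fun=> 0) = @pt_minus C g a.
Proof.
apply: funext => v; apply: funext => p; rewrite /pt /pt_minus.
by congr (_ + cs _); rewrite mulrN1z; ring.
Qed.

Lemma pt_plus1 v : pt_plus v 1 = @var C g a v.
Proof. by rewrite /pt_plus subrr mul0r (rmorph0 cs) subr0. Qed.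

Lemma Yfun_plus v p : Yfun o v (pt_plus v p) = Yv 1 (@dd C g) op_rel kap_plus v p.
Proof.
apply: etrans (div_scaled_den _ _ _) _; rewrite /Yv.
have -> : Wfun' v (pt_plus v p) =
    \prod_(v2 | sc v v2) (pt 1 (@dd C g) v p - pt 1 (@dd C g) v2 1).
  rewrite pt_plusE; apply: eq_big => [v2|v2 _]; last by rewrite pt_plus1.
  by rewrite /sc [v == v2]eq_sym.
apply: (congr1 (fun z => kap_plus v p * z / _)).
apply: etrans (prod_colours _ (fun j => absz (cartan g j (tag v))) (fun j q v2 =>
  pt_plus v p - cs (rform (tag v) j / 2) - cs (q%:R * dd j) - var v2)) _.
(* In the E half the factor number p of the W_j product is the link factor with q = n - p. *)
apply: eq_bigr => v2 hv; rewrite -[RHS]prod_nat_rev.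
rewrite big_nat [RHS]big_nat; apply: eq_bigr => q /andP[_]; rewrite ltnS => le.
rewrite (rform_nlink op_orient (v := v) (v2 := v2) hv) /link_factor -pt_plusE.
apply: (@additive_regroup _ _ cs _ (var v2) _ _ (dd (tag v2) - 1%:~R * 1%:R * dd (tag v2))).
by rewrite natrB //; field.
Qed.

Lemma pt_minus_pred v p : (0 < p)%N ->
  @pt_minus C g a v p.-1 + cs (dd (tag v)) = pt_minus v p.
Proof.
case: p => // p _; rewrite /pt_minus -addrA -(rmorphD cs); congr (_ + cs _).
by rewrite /= -natr1; ring.
Qed.

Lemma Yfun_minus v p : (0 < p)%N ->
  Yfun' o cw zs v (pt_minus v p.-1) = Yv (-1) (fun=> 0) o kap_minus v p.
Proof.
move=> p0; rewrite /Yfun' (pt_minus_pred v p0).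
apply: etrans (opp_mul_div _ _ _) _; rewrite /Yv /kap_minus pt_minusE.
(* Y' is evaluated one step before the p-th point, and the first point of a string lies one step
   after its w; for equal colours the two steps cancel. *)
have -> : Wfun' v (pt_minus v p.-1) =
    \prod_(v2 | sc v v2) (@pt_minus C g a v p - pt_minus v2 1).
  apply: eq_big => [v2|v2 /andP[/eqP tv _]]; first by rewrite /sc [v == v2]eq_sym.
  have -> : pt_minus v2 1 = @var C g a v2 + cs (dd (tag v)) by rewrite /pt_minus tv mul1r.
  by rewrite -[in RHS](pt_minus_pred v p0) opprD addrACA subrr addr0.
apply: (congr1 (fun z => - Zfun cw zs (tag v) (pt_minus v p) * z / _)).
apply: etrans (prod_colours _ (fun j => absz (cartan g j (tag v))) (fun j q v2 =>
  pt_minus v p - cs (rform (tag v) j / 2) - cs (q%:R * dd j) - var v2)) _.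
(* In the F half the order of the factors is kept, with q = p - 1. *)
apply: eq_bigr => v2 hv; rewrite big_add1; apply: eq_bigr => q _.
rewrite (rform_nlink o_orient (v := v) (v2 := v2) hv) /link_factor -pt_minusE.
apply: (@additive_regroup _ _ cs _ (var v2) _ _ (0 - (-1)%:~R * 1%:R * dd (tag v2))).
by rewrite -natr1 mulrN1z; field.
Qed.

Lemma coef_plusE k (E : rfun k) (m : occupation a k) :
  coef_plus o E m = coefg 1 (@dd C g) op_rel kap_plus E (fun v => nat_of_ord (m v)).
Proof.
apply: mul5_congr.
- by apply: eq_bigr => v _; apply: eq_bigr => p _; exact: Yfun_plus.
- by rewrite pt_plusE.
- apply: eq_bigr => v _; apply: eq_bigr => p _; apply: eq_bigr => q _.
  by rewrite /zz zeps1 pt_plusE.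
- apply: eq_bigr => v _; apply: eq_bigr => v2 _; apply: eq_bigr => p _.
  by apply: eq_bigr => q _; rewrite /zz zeps1 pt_plusE.
- apply: eq_bigr => v _; apply: eq_bigr => v2 _; apply: eq_bigr => p _.
  by apply: eq_bigr => q _; rewrite /zz zeps1 pt_plusE.
Qed.

Lemma coef_minusE k (E : rfun k) (m : occupation a k) :
  coef_minus o cw zs E m = coefg (-1) (fun=> 0) o kap_minus E (fun v => nat_of_ord (m v)).
Proof.
apply: mul5_congr.
- apply: eq_bigr => v _; rewrite big_nat [RHS]big_nat; apply: eq_bigr => p /andP[p0 _].
  exact: Yfun_minus.
- by rewrite pt_minusE.
- apply: eq_bigr => v _; apply: eq_bigr => p _; apply: eq_bigr => q _.
  by rewrite /zz zepsN1 opprB pt_minusE.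
- apply: eq_bigr => v _; apply: eq_bigr => v2 /andP[/eqP tv _]; apply: eq_bigr => p _.
  by apply: eq_bigr => q _; rewrite /zz zepsN1 opprB pt_minusE tv.
- apply: eq_bigr => v _; apply: eq_bigr => v2 _; apply: eq_bigr => p _.
  by apply: eq_bigr => q _; rewrite /zz zepsN1 opprB pt_minusE.
Qed.

End Translation.

Lemma conj_inverse (S : pzRingType) (u i w s : S) : u * i = 1 -> i * u = 1 ->
  u * w = (w - s) * u -> s * i = i * s -> i * w = (w + s) * i.
Proof.
move=> ui iu uw si; have e : w * u = u * w + s * u by rewrite uw mulrBl subrK.
rewrite -[i * w]mulr1 -ui -[i * w * _]mulrA [w * (u * i)]mulrA e mulrDl mulrDr.
by rewrite !mulrA iu mul1r -si -(mulrA s) iu mulr1 mulrDl.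
Qed.

Lemma scale_opp (R : pzRingType) (L : lmodType R) (x y : R) (u : L) :
  x = - y -> x *: u = - (y *: u).
Proof. by move=> ->; rewrite scaleNr. Qed.

(** * Commutation rules in the oscillator algebra *)

Section OscillatorRelations.
Variables (C : numFieldType) (g : simple_datum C) (a : mdegree g).
Local Notation V := (box a).
Local Notation scal := (presented_scalar (@osc_rel C g a)).

Lemma ou_comm (v v' : V) : ou v * ou v' = ou v' * ou v.
Proof.
apply/eqP; rewrite -subr_eq0 /ou !pcls_mul -pclsB; apply/eqP.
by apply: pcls_rel; exact: osc_uu.
Qed.

Lemma ou_ouV (v : V) : ou v * ouV v = 1.
Proof.
apply/eqP; rewrite -subr_eq0 pcls_mul -[1]/(pcls _ 1) -pclsB; apply/eqP.
by apply: pcls_rel; exact: osc_uV.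
Qed.

Lemma ouV_ou (v : V) : ouV v * ou v = 1.
Proof.
apply/eqP; rewrite -subr_eq0 pcls_mul -[1]/(pcls _ 1) -pclsB; apply/eqP.
by apply: pcls_rel; exact: osc_Vu.
Qed.

Lemma ouV_comm (v v' : V) : ouV v * ouV v' = ouV v' * ouV v.
Proof.
apply: inverse_comm (ou_ouV v) (ouV_ou v) _; apply/esym.
exact: inverse_comm (ou_ouV v') (ouV_ou v') (ou_comm v' v).
Qed.

(** The relation [u, w] = d u reads u w = (w + d) u, which is the sign eps = -1. *)
Lemma ou_ow (v v' : V) : ou v * ow v' =
  (ow v' - scal (if v == v' then (-1)%:~R * dd (tag v) else 0)) * ou v.
Proof.
have h : ou v * ow v' - ow v' * ou v =
    pcls _ (if v == v' then dd (tag v) *: free_gen C (Gu v) else 0).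
  apply/eqP; rewrite -subr_eq0; apply/eqP; rewrite !pcls_mul -!pclsB.
  by apply: pcls_rel; exact: osc_uw.
have e : ou v * ow v' = ow v' * ou v + (if v == v' then dd (tag v) else 0) *: ou v.
  rewrite -[LHS](subrK (ow v' * ou v)) h addrC; congr (_ + _).
  case: eqP => _; first by apply/esym; exact: pcls_scale.
  by rewrite scale0r; exact: pcls0.
apply: etrans e _; apply: etrans _ (esym (mulrBl _ _ _)).
apply: (congr1 (fun z => ow v' * ou v + z)).
apply: etrans _ (esym (congr1 -%R (presented_scalarE _ _))).
apply: scale_opp.
by case: eqP; rewrite ?oppr0 // mulrN1z mulN1r opprK.
Qed.

Lemma ouV_ow (v v' : V) : ouV v * ow v' =
  (ow v' - scal (if v == v' then 1%:~R * dd (tag v) else 0)) * ouV v.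
Proof.
apply: etrans (conj_inverse (ou_ouV v) (ouV_ou v) (ou_ow v v') (presented_scalarC _ _)) _.
apply: (congr1 (fun z => (ow v' + z) * ouV v)).
apply: etrans _ (rmorphN scal _); apply: (congr1 scal).
by case: eqP => _; rewrite ?oppr0 // mulrN1z mulN1r mul1r.
Qed.

End OscillatorRelations.

Lemma alg_hom_comp (C T U W : Type) (oT : alg_ops C T) (oU : alg_ops C U)
    (oW : alg_ops C W) (D : T -> Prop) (D' : U -> Prop) (f : T -> U) (h : U -> W) :
  alg_hom_on oT D oU f -> (forall x, D x -> D' (f x)) -> alg_hom_on oU D' oW h ->
  alg_hom_on oT D oW (h \o f).
Proof.
move=> [fD fZ f1 fM] fD' [hD hZ h1 hM]; split=> [x y Dx Dy|c x Dx||x y Dx Dy] /=.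
- by rewrite fD // hD //; exact: fD'.
- by rewrite fZ // hZ //; exact: fD'.
- by rewrite f1.
- by rewrite fM // hM //; exact: fD'.
Qed.

Lemma alg_hom_weaken (C T U : Type) (oT : alg_ops C T) (oU : alg_ops C U)
    (D D' : T -> Prop) (f : T -> U) :
  (forall x, D x -> D' x) -> alg_hom_on oT D' oU f -> alg_hom_on oT D oU f.
Proof.
move=> sub [fD fZ f1 fM]; split=> // [x y Dx Dy|c x Dx|x y Dx Dy].
- by apply: fD; exact: sub.
- by apply: fZ; exact: sub.
- by apply: fM; exact: sub.
Qed.

Lemma subalg_hom_ext (C : fieldType) (G : choiceType) (rel : free_alg C G -> Prop)
    (S : presented rel -> Prop) (U : Type) (oU : alg_ops C U) (f h : presented rel -> U) :
  alg_hom_on (presented_ops rel) (subalg_gen S) oU f ->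
  alg_hom_on (presented_ops rel) (subalg_gen S) oU h ->
  (forall x, S x -> f x = h x) -> forall x, subalg_gen S x -> f x = h x.
Proof.
move=> [fD fZ f1 fM] [hD hZ h1 hM] e x; elim=> {x}.
- exact: e.
- exact: etrans f1 (esym h1).
- move=> x y Sx ex Sy ey; apply: etrans (fD _ _ Sx Sy) _.
  by rewrite ex ey; apply/esym; exact: hD.
- move=> c x Sx ex; apply: etrans (fZ _ _ Sx) _.
  by rewrite ex; apply/esym; exact: hZ.
- move=> x y Sx ex Sy ey; apply: etrans (fM _ _ Sx Sy) _.
  by rewrite ex ey; apply/esym; exact: hM.
Qed.

Section Halves.
Variables (C : numFieldType) (g : simple_datum C) (a : mdegree g).
Local Notation I := 'I_(rk g).
Local Notation V := (box a).
Local Notation cs := (@cst C g a).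
Variables (o : rel I) (M : nat) (cw : 'I_M -> I) (zs : 'I_M -> C) (b : I -> int).
Hypothesis o_orient : is_orientation o.

Lemma kap_plusE (v : V) p : kap_plus v p = cs (dd (tag v))^-1.
Proof. by rewrite (fmorphV cs). Qed.

Lemma kap_plus_loc (v : V) p : loc (kap_plus v p).
Proof. by rewrite kap_plusE; exact: locC. Qed.

Lemma kap_plus_shift m (v : V) p :
  sval (@sh C g a 1 m) (kap_plus v p) (kap_plus v (m v + p)).
Proof. by rewrite !kap_plusE; exact: svalC. Qed.

Lemma kap_minus_loc (v : V) p : loc (kap_minus cw zs v p).
Proof.
apply: locN; apply: loc_prod => s _; apply: locB; last exact: locC.
by apply: locB; [exact: loc_pt|exact: locC].
Qed.

Lemma kap_minus_shift m (v : V) p :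
  sval (@sh C g a (-1) m) (kap_minus cw zs v p) (kap_minus cw zs v (m v + p)).
Proof.
apply: svalN; apply: sval_prod => s _; apply: svalB; last exact: svalC.
by apply: svalB; [exact: sval_pt|exact: svalC].
Qed.

Lemma plus_half : exists Phit : shuffle g -> osc a,
  [/\ plus_formula o Phit,
      alg_hom_on (shuffle_ops g) (@in_shuffle _ g) (osc_ops a) Phit &
      forall (Phi : yangian b -> osc a) (iota : yangian b -> yangian (fun=> 0))
             (Ups : yangian (fun=> 0) -> shuffle g),
        is_Phi o cw zs Phi -> is_plus_iso iota -> is_Upsilon_plus Ups ->
        forall y, yangian_plus y -> Phit (Ups (iota y)) = Phi y].
Proof.
have s1 : 1 = 1 :> int \/ 1 = -1 :> int by left.
pose Phit := @phit C g a 1 (@dd C g) (op_rel o) (@kap_plus C g a) (@ouV C g a).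
have op := op_orient o_orient.
have hom : alg_hom_on (shuffle_ops g) (@in_shuffle _ g) (osc_ops a) Phit.
  split=> [E F hE hF|x E hE||E F hE hF].
  - exact: (phitD _ _ s1 op kap_plus_loc hE hF).
  - exact: (phitZ _ _ s1 op kap_plus_loc x hE).
  - exact: phit1.
  - rewrite /= -[star E F]/(star_eps 1 E F).
    exact: (phitM _ s1 op kap_plus_loc kap_plus_shift (@ouV_ow C g a) (@ouV_comm C g a) hE hF).
exists Phit; split=> // [k E hE hk|Phi iota Ups].
  have [c0 [hc e]] := sum_osc_prod (@dd C g) (@ouV C g a) s1 op kap_plus_loc hE hk.
  exists c0; split=> // m /hc; by rewrite coef_plusE.
move=> [homPhi PhiE _ _] [[homi iD _ _] iE] [homU UD UE].
have homc := alg_hom_comp homi iD (alg_hom_comp homU UD hom).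
have homP D := alg_hom_weaken (fun (x : yangian b) (_ : D x) => Logic.I) homPhi.
refine (subalg_hom_ext homc (homP _) _) => y [i [k [k0 ->]]].
have [c0 [hc ->]] := PhiE i k k0.
have yp : yangian_plus (yE (fun=> 0) i k) by apply: subalg_gen_gen; exists i, k.
have hs := UD _ yp; rewrite /= iE // UE // in hs *.
rewrite /Phit (phit_gen _ _ _ _ op hs).
apply: eq_bigr => v /eqP tv; apply: (congr1 (fun z => z * ouV v)).
(* The single point of the string is w itself, so x^(k-1) becomes w^(k-1), as in the expansion of
   1/(z - w). *)
apply: oscvE; rewrite -Yfun_plus // pt_plusE pt_plus1; exact: hc.
Qed.

Lemma minus_half : exists Phit : shuffle g -> osc a,
  [/\ minus_formula o cw zs Phit,
      alg_hom_on (opposite_ops (shuffle_ops g)) (@in_shuffle _ g) (osc_ops a) Phit &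
      forall (Phi : yangian b -> osc a) (iota : yangian b -> yangian (fun=> 0))
             (Ups : yangian (fun=> 0) -> shuffle g),
        is_Phi o cw zs Phi -> is_minus_iso iota -> is_Upsilon_minus Ups ->
        forall y, yangian_minus y -> Phit (Ups (iota y)) = Phi y].
Proof.
have s1 : -1 = 1 :> int \/ -1 = -1 :> int by right.
pose Phit := @phit C g a (-1) (fun=> 0) o (kap_minus cw zs) (@ou C g a).
have hom : alg_hom_on (opposite_ops (shuffle_ops g)) (@in_shuffle _ g) (osc_ops a) Phit.
  split=> [E F hE hF|x E hE||E F hE hF].
  - exact: (phitD _ _ s1 o_orient kap_minus_loc hE hF).
  - exact: (phitZ _ _ s1 o_orient kap_minus_loc x hE).
  - exact: phit1.
  - rewrite /= -[star F E]/(star_eps (-1) E F).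
    exact: (phitM _ s1 o_orient kap_minus_loc kap_minus_shift (@ou_ow C g a) (@ou_comm C g a) hE hF).
exists Phit; split=> // [k E hE hk|Phi iota Ups].
  have [c0 [hc e]] := sum_osc_prod (fun=> 0) (@ou C g a) s1 o_orient kap_minus_loc hE hk.
  exists c0; split=> // m /hc; by rewrite coef_minusE.
move=> [homPhi _ PhiF _] [[homi iD _ _] iF] [homU UD UF].
have homc := alg_hom_comp homi iD (alg_hom_comp homU UD hom).
have homP D := alg_hom_weaken (fun (x : yangian b) (_ : D x) => Logic.I) homPhi.
refine (subalg_hom_ext homc (homP _) _) => y [i [k [k0 ->]]].
have [c0 [hc ->]] := PhiF i k k0.
have yp : yangian_minus (yF (fun=> 0) i k) by apply: subalg_gen_gen; exists i, k.
have hs := UD _ yp; rewrite /= iF // UF // in hs *.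
rewrite /Phit (phit_gen _ _ _ _ o_orient hs).
apply: eq_bigr => v /eqP tv; apply: (congr1 (fun z => z * ou v)).
apply: oscvE; rewrite -Yfun_minus // pt_minusE.
(* Here Y' is evaluated at w while the single point is w + d, the position of the pole in the image
   of F_i(z). *)
have -> : pt_minus v 1.-1 = @var C g a v by rewrite /pt_minus mul0r (rmorph0 cs) addr0.
have -> : pt_minus v 1 = @var C g a v + cs (dd i) by rewrite /pt_minus mul1r tv.
exact: hc tv.
Qed.

End Halves.

From mathcomp Require Import reals complex.
Local Open Scope complex_scope.

Theorem theoremB17 (R : realType) (g : simple_datum R[i])
    (o : rel 'I_(rk g)) (ho : is_orientation o)
    (M : nat) (cw : 'I_M -> 'I_(rk g)) (zs : 'I_M -> R[i])
    (b : 'I_(rk g) -> int) (a : mdegree g)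
    (* lambda - mu = \sum_i a_i alpha_i, paired with the j-th simple root *)
    (hab : forall j, #|[set s | cw s == j]|%:Z - b j =
                     \sum_i (a i)%:Z * cartan g i j) :
  (exists Phit : shuffle g -> osc a,
     [/\ plus_formula o Phit,
         alg_hom_on (shuffle_ops g) (@in_shuffle _ g) (osc_ops a) Phit &
         forall (Phi : yangian b -> osc a)
                (iota : yangian b -> yangian (fun=> 0))
                (Ups : yangian (fun=> 0) -> shuffle g),
           is_Phi o cw zs Phi -> is_plus_iso iota -> is_Upsilon_plus Ups ->
           forall y, yangian_plus y -> Phit (Ups (iota y)) = Phi y]) /\
  (exists Phit : shuffle g -> osc a,
     [/\ minus_formula o cw zs Phit,
         alg_hom_on (opposite_ops (shuffle_ops g)) (@in_shuffle _ g)
                    (osc_ops a) Phit &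
         forall (Phi : yangian b -> osc a)
                (iota : yangian b -> yangian (fun=> 0))
                (Ups : yangian (fun=> 0) -> shuffle g),
           is_Phi o cw zs Phi -> is_minus_iso iota -> is_Upsilon_minus Ups ->
           forall y, yangian_minus y -> Phit (Ups (iota y)) = Phi y]).
Proof.
by split; [exact: plus_half|exact: minus_half].
Qed.
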